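(* Let $(A,\mathfrak m)$ be a Cohen-Macaulay local domain of dimension $d\geq 1$. Suppose $\omega_A$ is the canonical module of $A$. Let $M$ be a maximal Cohen-Macaulay $A$-module and let $N_i=\operatorname{Syz}^A_i(M)$ be the $i$-th syzygy of $M$. If $A$ is a quasi-Hilbert ring, then for all $i\geq 1$ the function $n\mapsto \ell\big(r(\mathfrak m^n,N_i^{\dagger})/\widetilde{\mathfrak m^n}\big)$ coincides, for all sufficiently large $n$, with a polynomial of degree $d-1$, where $N_i^{\dagger}=\operatorname{Hom}_A(N_i,\omega_A)$.
   Context: All rings are commutative Noetherian with unity and all modules are finitely generated; $\ell(-)$ is length. $\operatorname{Syz}^A_i(M)$ is the $i$-th syzygy in the minimal free resolution of $M$. For an ideal $I$, an $A$-module $M$ and $n\ge 1$, $r(I^n,M)=\bigcup_{k\ge 0}(I^{n+k}M:_A I^kM)\subseteq A$, with $r(I^0,M)=A$; and $\widetilde{I^n}=r(I^n,A)$ is the Ratliff-Rush closure of $I^n$. One has $\widetilde{I^n}\subseteq r(I^n,M)$. Put $\mathcal R^I=\bigoplus_{n\ge 0}I^nt^n$. Quasi-Hilbert ring: Let $A$ be a Cohen-Macaulay ring of dimension $d\ge 1$ with a canonical module $\omega_A$, whose Jacobson radical $J\ne 0$ (intersection of all maximal ideals; $J=\mathfrak m$ if $A$ is local) contains a non-zero divisor. $A$ is called quasi-Hilbert if the Krull dimension of the $\mathcal R^J$-module $\bigoplus_{n\ge 0}r(J^n,\omega_A)/\widetilde{J^n}$ equals $d$.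
   Formalization: The module M is additionally assumed not to be free: for free M all syzygies N_i with i ≥ 1 vanish, r(m^n, 0) = A, and the length of A modulo the Ratliff-Rush closure of m^n has degree d rather than d−1, so the claim as stated fails exactly there. *)

(* Defs.v *)
From HB Require Import structures.
From mathcomp Require Import all_boot all_order all_algebra.
From mathcomp Require Import all_classical.

Set Implicit Arguments.
Unset Strict Implicit.
Unset Printing Implicit Defensive.

Import GRing.Theory.

Local Open Scope classical_set_scope.
Local Open Scope ring_scope.

(* Ideals and submodules are sets; an ideal of A is a submodule of A^o.       *)

Section Ideals.
Variable A : comNzRingType.

(* idealr_closed is the library's notion of a proper ideal. *)
Definition prime_ideal (P : set A) : Prop :=
  idealr_closed [in P] /\ prime_idealr_closed [in P].

Definition maximal_ideal (m : set A) : Prop :=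
  idealr_closed [in m] /\
  forall I : set A, idealr_closed [in I] -> m `<=` I -> I = m.

Definition jacobson_radical : set A :=
  [set x | forall m : set A, maximal_ideal m -> m x].

Definition is_local (m : set A) : Prop :=
  maximal_ideal m /\ forall m' : set A, maximal_ideal m' -> m' = m.

Definition prime_chain_over (I : set A) (n : nat) (P : nat -> set A) : Prop :=
  (forall i, (i <= n)%N -> prime_ideal (P i) /\ I `<=` P i) /\
  (forall i, (i < n)%N -> P i `<` P i.+1).

(* dim A/I = d for a natural number d; it never holds when I = A. *)
Definition quot_krull_dim (I : set A) (d : nat) : Prop :=
  (exists P, prime_chain_over I d P) /\
  (forall n P, prime_chain_over I n P -> (n <= d)%N).

Definition krull_dim (d : nat) : Prop := quot_krull_dim [set 0] d.

End Ideals.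

Arguments jacobson_radical : clear implicits.
Arguments krull_dim : clear implicits.

Section Submodules.
Variables (A : comNzRingType) (V : lmodType A).

(* I S: all finite sums of products a x with a in I and x in S. *)
Definition smul (I : set A) (S : set V) : set V :=
  [set x | exists k : nat, exists a : 'I_k -> A, exists y : 'I_k -> V,
    (forall i, I (a i) /\ S (y i)) /\ x = \sum_i a i *: y i].

Lemma smul_submod_closed (I : set A) (S : set V) :
  submod_closed [in S] -> submod_closed [in smul I S].
Proof.
move=> [S0 SD]; split.
  rewrite inE; exists 0%N; exists (fun=> 0); exists (fun=> 0).
  by split=> [[]//|]; rewrite big_ord0.
move=> c u v; rewrite !inE => -[k [a [y [Hy ->]]]] [l [b [z [Hz ->]]]].
exists (k + l)%N.
exists (fun i : 'I_(k + l) => match fintype.split i with inl i => a i | inr i => b i end).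
exists (fun i : 'I_(k + l) => match fintype.split i with inl i => c *: y i | inr i => z i end).
split=> [i|].
  case: (fintype.split i) => j //=; have [Ia Sy] := Hy j; split=> //.
  by rewrite -[_ *: _]addr0; apply/set_mem/SD => //; exact: mem_set.
rewrite big_split_ord /= scaler_sumr; congr (_ + _); apply: eq_bigr => i _.
  by rewrite (unsplitK (inl i)) !scalerA mulrC.
by rewrite (unsplitK (inr i)).
Qed.

Definition fin_gen_sub (S : set V) : Prop :=
  exists s : seq V, S = smul setT [set` s].

(* K = S 0 < S 1 < ... < S l = L, all submodules of V. *)
Definition submod_chain (K L : set V) (l : nat) (S : nat -> set V) : Prop :=
  [/\ S 0%N = K, S l = L,
      forall i, (i <= l)%N -> submod_closed [in S i] &
      forall i, (i < l)%N -> S i `<` S i.+1].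

(* The subquotient L / K has finite length l. *)
Definition has_length (K L : set V) (l : nat) : Prop :=
  (exists S, submod_chain K L l S) /\
  (forall n S, submod_chain K L n S -> (n <= l)%N).

End Submodules.

Section Modules.
Variable A : comNzRingType.

Definition noetherian : Prop :=
  forall I : set A^o, submod_closed [in I] -> fin_gen_sub I.

Definition fin_gen (M : lmodType A) : Prop := fin_gen_sub [set: M].

Definition is_free (M : lmodType A) : Prop :=
  exists n : nat, exists f : {linear 'rV[A]_n -> M}, bijective f.

Definition regular_sequence (m : set A) (M : lmodType A) (s : seq A) : Prop :=
  [/\ forall x, x \in s -> m x,
      forall (i : nat) (y : M), (i < size s)%N ->
        smul [set` take i s] [set: M] (s`_i *: y) ->
        smul [set` take i s] [set: M] y &
      smul [set` s] [set: M] <> setT].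

Definition has_depth (m : set A) (M : lmodType A) (t : nat) : Prop :=
  (exists s, regular_sequence m M s /\ size s = t) /\
  (forall s, regular_sequence m M s -> (size s <= t)%N).

(* The next two are meant for a Noetherian local ring (A, m) of dimension d.  *)
Definition cohen_macaulay (m : set A) (d : nat) : Prop :=
  krull_dim A d /\ has_depth m A^o d.

Definition maximal_cohen_macaulay (m : set A) (d : nat) (M : lmodType A) :
    Prop :=
  fin_gen M /\ has_depth m M d.

Definition injective_module (E : lmodType A) : Prop :=
  forall (U V : lmodType A) (i : {linear U -> V}) (f : {linear U -> E}),
    injective i -> exists g : {linear V -> E}, forall u, g (i u) = f u.

Definition finite_injective_dim (M : lmodType A) : Prop :=
  exists E : nat -> lmodType A,
  exists eps : {linear M -> E 0%N},
  exists del : forall i, {linear E i -> E i.+1},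
  [/\ forall i, injective_module (E i),
      injective eps,
      forall x, del 0%N x = 0 <-> exists y, x = eps y,
      forall i x, del i.+1 x = 0 <-> exists y, x = del i y &
      exists n, forall i, (n < i)%N -> forall x : E i, x = 0].

(* Free resolution by finitely generated free modules F_i = A^(rk i). Vectors *)
(* are rows, so the differential F_(i+1) -> F_i is y |-> y *m dmx i.          *)
Record free_resolution (M : lmodType A) := FreeResolution {
  rk : nat -> nat;
  dmx : forall i, 'M[A]_(rk i.+1, rk i);
  aug : {linear 'rV[A]_(rk 0) -> M};
  aug_surj : forall y, exists x, aug x = y;
  aug_exact : forall x, aug x = 0 <-> exists y : 'rV[A]_(rk 1), x = y *m dmx 0;
  dmx_exact : forall i (x : 'rV[A]_(rk i.+1)),
    x *m dmx i = 0 <-> exists y : 'rV[A]_(rk i.+2), x = y *m dmx i.+1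
}.

Definition minimal_resolution (m : set A) (M : lmodType A)
    (F : free_resolution M) : Prop :=
  forall i j k, m (dmx F i j k).

End Modules.

Section Hom.
Variables (A : comNzRingType) (U W : lmodType A).

(* Hom_A(U, W), with the pointwise module structure. *)
Definition modHom := {linear U -> W}.
Definition modHom_fun (f : modHom) : U -> W := GRing.Linear.sort f.
Coercion modHom_fun : modHom >-> Funclass.

HB.instance Definition _ := gen_eqMixin modHom.
HB.instance Definition _ := gen_choiceMixin modHom.

Lemma modHomP (f g : modHom) : f =1 g -> f = g.
Proof.
case: f g => [f [[Mf] [Sf]]] [g [[Mg] [Sg]]] /= /funext E; subst g.
by rewrite (Prop_irrelevance Mf Mg) (Prop_irrelevance Sf Sg).
Qed.

Definition modHom_add : modHom -> modHom -> modHom :=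
  fun f g : {linear U -> W} => (f \+ g : {linear U -> W}).
Definition modHom_opp : modHom -> modHom :=
  fun f : {linear U -> W} => (\- f : {linear U -> W}).
Definition modHom_zero : modHom := (\0 : {linear U -> W}).
Definition modHom_scale : A -> modHom -> modHom :=
  fun a (f : {linear U -> W}) => (a \*: f : {linear U -> W}).

Lemma modHom_addA : associative modHom_add.
Proof. by move=> f g h; apply: modHomP => x; exact: addrA. Qed.
Lemma modHom_addC : commutative modHom_add.
Proof. by move=> f g; apply: modHomP => x; exact: addrC. Qed.
Lemma modHom_add0 : left_id modHom_zero modHom_add.
Proof. by move=> f; apply: modHomP => x; exact: add0r. Qed.
Lemma modHom_addN : left_inverse modHom_zero modHom_opp modHom_add.
Proof. by move=> f; apply: modHomP => x; exact: addNr. Qed.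
HB.instance Definition _ :=
  GRing.isZmodule.Build modHom modHom_addA modHom_addC modHom_add0 modHom_addN.

Lemma modHom_scaleA a b f :
  modHom_scale a (modHom_scale b f) = modHom_scale (a * b) f.
Proof. by apply: modHomP => x; exact: scalerA. Qed.
Lemma modHom_scale1 : left_id 1 modHom_scale.
Proof. by move=> f; apply: modHomP => x; exact: scale1r. Qed.
Lemma modHom_scaleDr : right_distributive modHom_scale +%R.
Proof. by move=> a f g; apply: modHomP => x; exact: scalerDr. Qed.
Lemma modHom_scaleDl f : {morph modHom_scale^~ f : a b / a + b}.
Proof. by move=> a b; apply: modHomP => x; exact: scalerDl. Qed.
HB.instance Definition _ := GRing.Zmodule_isLmodule.Build A modHom
  modHom_scaleA modHom_scale1 modHom_scaleDr modHom_scaleDl.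

End Hom.

Section Canonical.
Variable A : comNzRingType.

Definition is_quotient_by_ideal (I : set A) (Q : lmodType A) : Prop :=
  exists pi : {linear A^o -> Q},
    (forall q, exists a, pi a = q) /\ (forall a, pi a = 0 <-> I a).

Definition cocycles (N : lmodType A) (F : free_resolution N) (C : lmodType A)
    (n : nat) : set (modHom 'rV[A]_(rk F n) C) :=
  [set f | forall y, f (y *m dmx F n) = 0].

Definition coboundaries (N : lmodType A) (F : free_resolution N)
    (C : lmodType A) (n : nat) : set (modHom 'rV[A]_(rk F n) C) :=
  match n with
  | 0 => [set 0]
  | j.+1 => [set f | exists g : modHom 'rV[A]_(rk F j) C,
                       forall x, f x = g (x *m dmx F j)]
  end.

Arguments cocycles {N} F C n.
Arguments coboundaries {N} F C n.

(* The type of a module C of depth t is dim_k Ext^t(k, C), where k = A/m.     *)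
(* As m kills Ext^t(k, C), this dimension is the length over A.               *)
Definition has_type (m : set A) (t : nat) (C : lmodType A) (r : nat) : Prop :=
  exists (k : lmodType A) (F : free_resolution k),
    is_quotient_by_ideal m k /\
    has_length (coboundaries F C t) (cocycles F C t) r.

(* C is a canonical module of the Cohen-Macaulay local ring (A, m), of        *)
(* dimension d: a maximal Cohen-Macaulay module of type 1 and of finite       *)
(* injective dimension.                                                       *)
Definition canonical_module (m : set A) (d : nat) (C : lmodType A) : Prop :=
  [/\ maximal_cohen_macaulay m d C, has_type m d C 1 & finite_injective_dim C].

End Canonical.

Section Syzygy.
Variables (A : comNzRingType) (M : lmodType A) (F : free_resolution M).

Definition syz_pred (j : nat) : {pred 'rV[A]_(rk F j)} :=
  fun x => `[< exists y, x = y *m dmx F j >].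

Lemma syz_pred_closed j : submod_closed (@syz_pred j).
Proof.
split; first by apply/asboolP; exists 0; rewrite mul0mx.
move=> a _ _ /asboolP[y ->] /asboolP[z ->]; apply/asboolP.
by exists (a *: y + z); rewrite mulmxDl scalemxAl.
Qed.
HB.instance Definition _ j :=
  GRing.isSubmodClosed.Build A _ (@syz_pred j) (@syz_pred_closed j).

Definition syz_image (j : nat) := {x | x \in @syz_pred j}.
HB.instance Definition _ j := [isSub of syz_image j for sval].
HB.instance Definition _ j := [Choice of syz_image j by <:].
HB.instance Definition _ j := [SubChoice_isSubZmodule of syz_image j by <:].
HB.instance Definition _ j := [SubZmodule_isSubLmodule of syz_image j by <:].

(* The 0th syzygy is M; the (j+1)st is the image of F_(j+1) -> F_j. *)
Definition syz (i : nat) : lmodType A :=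
  match i with 0 => M | j.+1 => syz_image j end.

End Syzygy.

Section RatliffRush.
Variable A : comNzRingType.

Definition ideal_pow (I : set A) (n : nat) : set A :=
  iter n (@smul A A^o I) setT.

(* r(I^n, M); for n = 0 the formula gives all of A. *)
Definition ratliff_rush (I : set A) (n : nat) (M : lmodType A) : set A :=
  [set a | exists k, forall x : M,
     smul (ideal_pow I k) setT x -> smul (ideal_pow I (n + k)) setT (a *: x)].

Definition rr_closure (I : set A) (n : nat) : set A := ratliff_rush I n A^o.

End RatliffRush.

Section Rees.
Variables (A : comNzRingType) (I : set A).

Lemma ideal_pow_closed n : submod_closed [in (ideal_pow I n : set A^o)].
Proof.
elim: n => [|n IH]; last exact: smul_submod_closed.
by split=> [|a x y _ _]; apply/mem_set.
Qed.

Lemma ideal_powM m n x y :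
  ideal_pow I m x -> ideal_pow I n y -> ideal_pow I (m + n) (x * y).
Proof.
move=> + In; elim: m x => [|m IH] x.
  move=> _; have [I0 IS] := ideal_pow_closed n.
  have := IS x _ _ (mem_set In) I0.
  by rewrite addr0 => /set_mem.
case=> k [a [z [Hz ->]]]; exists k; exists a; exists (fun i => z i * y).
split=> [i|]; first by have [? /IH] := Hz i.
by rewrite mulr_suml; apply: eq_bigr => i _; exact/esym/mulrA.
Qed.

(* The Rees algebra: the subring of A[t] of the polynomials whose             *)
(* coefficient of t^n lies in I^n.                                            *)
Definition rees_pred : {pred {poly A}} :=
  fun p => `[< forall n, ideal_pow I n p`_n >].

Lemma rees_pred_closed : subring_closed rees_pred.
Proof.
have cl n := ideal_pow_closed n.
split.
- apply/asboolP=> n; rewrite coef1; case: n => [|n] //=.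
  by apply/set_mem; case: (cl n.+1).
- move=> p q /asboolP Hp /asboolP Hq; apply/asboolP=> n; rewrite coefB.
  have [_ IS] := cl n.
  have := IS (-1) _ _ (mem_set (Hq n)) (mem_set (Hp n)).
  by rewrite scaleN1r addrC => /set_mem.
- move=> p q /asboolP Hp /asboolP Hq; apply/asboolP=> n; rewrite coefM.
  have [I0 IS] := cl n.
  apply: (big_ind (fun x => ideal_pow I n x)); first exact/set_mem.
    move=> x y Hx Hy; have := IS 1 _ _ (mem_set Hx) (mem_set Hy).
    by rewrite scale1r => /set_mem.
  move=> i _; have := ideal_powM (Hp i) (Hq (n - i)%N).
  by rewrite subnKC // -ltnS.
Qed.
HB.instance Definition _ :=
  GRing.isSubringClosed.Build {poly A} rees_pred rees_pred_closed.

Definition rees := {p | p \in rees_pred}.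
HB.instance Definition _ := [isSub of rees for sval].
HB.instance Definition _ := [Choice of rees by <:].
HB.instance Definition _ := [SubChoice_isSubComNzRing of rees by <:].

(* For a module M, both (+)_n r(I^n, M) t^n and (+)_n \widetilde{I^n} t^n are *)
(* submodules of A[t] over the Rees algebra; this is the annihilator of their *)
(* quotient.                                                                  *)
Definition rr_quotient_annihilator (M : lmodType A) : set rees :=
  [set p | forall q : {poly A}, (forall n, ratliff_rush I n M q`_n) ->
             forall n, rr_closure I n (val p * q)`_n].

End Rees.

(* A is meant to be Cohen-Macaulay with canonical module omega. *)
Definition quasi_hilbert (A : comNzRingType) (omega : lmodType A) : Prop :=
  let J := jacobson_radical A in
  (exists x : A, J x /\ GRing.lreg x) /\
  exists d : nat, [/\ (1 <= d)%N, krull_dim A d &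
    quot_krull_dim (@rr_quotient_annihilator A J omega) d].

(* Main.v *)
(* Write N for the dual of the i-th syzygy, S_n = r(m^n, N) and T_n for the
   Ratliff-Rush closure of m^n.  Since omega has finite injective dimension,
   Ext^j(M, omega) = 0 for j > 0, so N is a quotient of a power of omega, whence
   r(m^n, omega) is contained in S_n; the same vanishing and the minimality of
   the resolution show that no syzygy is zero, so N contains an element with
   zero annihilator.  Multiplication by a suitable such element embeds the sum
   of the S_n into the sum of the m^n N, so that (S_n / T_n) is a finitely
   generated graded module over the Rees algebra and its length is eventually
   polynomial.  It is generated in bounded degree, so S_n / T_n is a
   subquotient of m^(n-c) / m^n, which bounds the degree by d - 1.  If the
   degree were smaller, the quotients of the Rees algebra by primes containing
   the annihilator of the sum of the r(m^n, omega) / T_n would have growth of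
   order at most d - 1, and the growth drops by one along each strict inclusion
   of primes, so there would be no chain of length d. *)

Require Import Defs.
From HB Require Import structures.
From mathcomp Require Import all_boot all_order all_algebra.
From mathcomp Require Import all_classical.
From mathcomp Require Import ring lra zify.

Set Implicit Arguments.
Unset Strict Implicit.
Unset Printing Implicit Defensive.

Import Order.TTheory GRing.Theory Num.Theory.
Local Open Scope classical_set_scope.
Local Open Scope ring_scope.

(** * Eventually polynomial functions *)

(** The obstacle to finite generation is that r(m^n, N) is a union of colons whose exponent k
    depends on the element. In large degrees the part of the associated graded module of N killed by
    a power of m vanishes, so for one fixed n0 all elements of r(m^n, N) carry m^n0 N into m^(n +
    n0) N. The suitable element is therefore x^n0 z with x regular in m; z has zero annihilator
    because A is a domain and omega is torsion free. The dimension enters from two sides. A regular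
    sequence of length d generates an ideal of finite colength, so A / m^n has length of order at
    most n^d; a chain of d strict inclusions of primes of the Rees algebra forces growth from below.
    Those primes may be inhomogeneous, so growth is measured along the filtration by degree. Ext
    vanishes above the injective dimension, then in degrees above d by descending induction over
    cyclic modules, then in all positive degrees by a regular sequence on M. Quotients are
    represented by pairs of submodules, and maps on them by maps that vanish on the smaller one. *)

Definition evpoly (k : nat) (f : nat -> rat) : Prop :=
  exists P : {poly rat}, (size P <= k)%N /\
  exists n0 : nat, forall n : nat, (n0 <= n)%N -> f n = P.[n%:R].

(** The falling factorials, which the forward difference treats as differentiation treats powers. *)
Definition falling (k : nat) : {poly rat} := \prod_(j < k) ('X - j%:R%:P).

Lemma size_falling k : size (falling k) = k.+1.
Proof. by rewrite size_prod_XsubC /= /index_enum -enumT -cardE card_ord. Qed.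

Lemma falling_diff k n :
  (falling k.+1).[n.+1%:R] - (falling k.+1).[n%:R] =
  k.+1%:R * (falling k).[n%:R].
Proof.
rewrite !horner_prod big_ord_recl [X in _ - X]big_ord_recr /=.
rewrite !hornerE.
rewrite (eq_bigr (fun i : 'I_k => ('X - i%:R%:P).[n%:R])); last first.
  by move=> i _; rewrite !hornerE /bump /= -[n.+1]addn1 !natrD; ring.
rewrite -[n.+1]addn1 -[k.+1]addn1 !natrD; ring.
Qed.

(** Discrete integration: the monic [falling k] removes the top coefficient of Q, and is itself the
    difference of [falling k.+1] divided by k + 1. *)
Lemma poly_sum_falling k (Q : {poly rat}) : (size Q <= k)%N ->
  exists R : {poly rat}, (size R <= k.+1)%N /\
    forall n : nat, R.[n.+1%:R] - R.[n%:R] = Q.[n%:R].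
Proof.
elim: k Q => [|k IH] Q sQ.
  exists 0; rewrite size_poly0; split=> // n.
  by move: sQ; rewrite leqn0 size_poly_eq0 => /eqP ->; rewrite !horner0 subr0.
pose c := Q`_k.
have [|R [sR HR]] := IH (Q - c *: falling k).
  apply/leq_sizeP => j; rewrite leq_eqVlt => /orP[/eqP <-|kj].
    rewrite coefB coefZ.
    have : falling k \is monic by apply: monic_prod_XsubC.
    by rewrite monicE /lead_coef size_falling /= => /eqP ->; rewrite mulr1 subrr.
  rewrite coefB coefZ [Q`_j]nth_default ?(leq_trans sQ) //.
  by rewrite nth_default ?size_falling // mulr0 subrr.
exists (R + (c / k.+1%:R) *: falling k.+1); split.
  apply: leq_trans (size_polyD _ _) _; rewrite geq_max (leq_trans sR) //.
  by apply: leq_trans (size_scale_leq _ _) _; rewrite size_falling.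
move=> n; rewrite !hornerD !hornerZ opprD addrACA HR -mulrBr falling_diff.
rewrite mulrA divfK ?pnatr_eq0 // hornerD hornerN hornerZ; ring.
Qed.

Lemma evpoly_diff k f : evpoly k (fun n => f n.+1 - f n) -> evpoly k.+1 f.
Proof.
move=> [Q [sQ [n0 HQ]]]; have [R [sR HR]] := poly_sum_falling sQ.
exists (R + (f n0 - R.[n0%:R])%:P); split.
  apply: leq_trans (size_polyD _ _) _; rewrite geq_max sR.
  by apply: leq_trans (size_polyC_leq1 _) _.
exists n0; elim=> [|n IH]; first rewrite leqn0 => /eqP ->.
  by rewrite !hornerD !hornerC; ring.
rewrite leq_eqVlt => /orP[/eqP <-|]; first by rewrite !hornerD !hornerC; ring.
rewrite ltnS => n0n; have := HQ n n0n; rewrite -HR.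
by move: (IH n0n); rewrite !hornerD !hornerC => ->; lra.
Qed.

Lemma evpolyB k f g : evpoly k f -> evpoly k g -> evpoly k (fun n => f n - g n).
Proof.
move=> [P [sP [n0 HP]]] [Q [sQ [n1 HQ]]]; exists (P - Q); split.
  by apply: leq_trans (size_polyD _ _) _; rewrite size_polyN geq_max sP sQ.
exists (maxn n0 n1) => n; rewrite geq_max => /andP[/HP -> /HQ ->].
by rewrite hornerD hornerN.
Qed.

Lemma evpoly_shift k f : evpoly k f -> evpoly k (fun n => f n.+1).
Proof.
move=> [P [sP [n0 HP]]]; exists (P \Po ('X + 1%:P)); split.
  by rewrite size_comp_poly2 // size_XaddC.
exists n0 => n n0n; rewrite HP ?(leq_trans n0n) //.
by rewrite horner_comp !hornerE natr1.
Qed.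

Lemma evpolyW k l f : (k <= l)%N -> evpoly k f -> evpoly l f.
Proof.
by move=> kl [P [sP HP]]; exists P; split=> //; exact: leq_trans kl.
Qed.

Lemma evpoly_eventually0 (f : nat -> rat) :
  (exists n0, forall n, (n0 <= n)%N -> f n = 0) -> evpoly 0 f.
Proof.
move=> [n0 Hf]; exists 0; rewrite size_poly0; split=> //.
by exists n0 => n /Hf ->; rewrite horner0.
Qed.

Lemma poly_bound e (P : {poly rat}) : (size P <= e.+1)%N ->
  exists C : nat, forall n : nat, `|P.[n%:R]| <= C%:R * n.+1%:R ^+ e.
Proof.
move=> sP; pose c := \sum_(i < e.+1) `|P`_i|.
have c0 : 0 <= c by apply: sumr_ge0.
exists (Num.truncn c).+1 => n.
have n1 : 1 <= n.+1%:R :> rat by rewrite ler1n.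
apply: (@le_trans _ _ (c * n.+1%:R ^+ e)); last first.
  rewrite ler_wpM2r ?exprn_ge0 //.
  exact/ltW/truncnS_gt.
rewrite (horner_coef_wide _ sP) /c mulr_suml.
apply: le_trans (ler_norm_sum _ _ _) _; apply: ler_sum => i _.
rewrite normrM ler_wpM2l // normrX ger0_norm //.
apply: (@le_trans _ _ (n.+1%:R ^+ i)).
  by rewrite lerXn2r ?nnegrE // ler_nat.
by apply: ler_weXn2l => //; rewrite -ltnS.
Qed.

Lemma evpoly_bound e (f : nat -> nat) : evpoly e.+1 (fun n => (f n)%:R) ->
  exists C : nat, forall n, (f n <= C * n.+1 ^ e)%N.
Proof.
move=> [P [/poly_bound [C HC] [n0 HP]]].
exists (C + \sum_(i < n0) f i)%N => n.
have [n0n|nn0] := leqP n0 n.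
  apply: (@leq_trans (C * n.+1 ^ e)%N); last by rewrite leq_mul2r leq_addr orbT.
  rewrite -(ler_nat rat) natrM natrX; apply: le_trans (HC n).
  by rewrite -HP // ler_norm.
apply: (@leq_trans (\sum_(i < n0) f i)%N).
  by rewrite (bigD1 (Ordinal nn0)) //= leq_addr.
apply: (@leq_trans (C + \sum_(i < n0) f i)%N); first exact: leq_addl.
by rewrite leq_pmulr // expn_gt0.
Qed.

(** If the degree were s + 1 > e with leading coefficient c, then c n^(s+1) would be bounded by a
    multiple of n^s, and |c| n would be bounded. *)
Lemma poly_growth (P : {poly rat}) (e C n0 : nat) :
  (forall n, (n0 <= n)%N -> 0 <= P.[n%:R] <= C%:R * n.+1%:R ^+ e) ->
  (size P <= e.+1)%N.
Proof.
move=> HP; rewrite leqNgt; apply/negP => eP.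
have [s sP] : exists s, size P = s.+2.
  by case: (size P) eP => [|[|s]] // _; exists s.
have es : (e <= s)%N by move: eP; rewrite sP !ltnS.
pose c := P`_s.+1.
have c0 : c != 0 by rewrite -[c]/(P`_(s.+2.-1)) -sP lead_coef_eq0 -size_poly_eq0 sP.
pose Q := P - c *: 'X^(s.+1).
have [|D HD] := @poly_bound s Q.
  apply/leq_sizeP => j; rewrite leq_eqVlt => /orP[/eqP <-|sj].
    by rewrite coefB coefZ coefXn eqxx mulr1 subrr.
  by rewrite coefB coefZ coefXn gtn_eqF // mulr0 subr0 nth_default // sP.
(* C bounds P, D bounds the lower terms Q, and 2^s compares (n + 1)^s with n^s for n >= 1. *)
pose E : rat := (C + D)%:R * 2%:R ^+ s.
have key n : (n0 < n)%N -> `|c| * n%:R <= E.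
  move=> n0n; have n_gt0 : 0 < n%:R :> rat by rewrite ltr0n (leq_ltn_trans _ n0n).
  have PE : P.[n%:R] = Q.[n%:R] + c * n%:R ^+ s.+1 by rewrite !hornerE; ring.
  have /andP[P0 PC] := HP n (ltnW n0n).
  have H1 : C%:R * n.+1%:R ^+ e <= C%:R * n.+1%:R ^+ s :> rat.
    by rewrite ler_wpM2l // ler_weXn2l // ler1n.
  have H2 : `|c * n%:R ^+ s.+1| <= (C + D)%:R * n.+1%:R ^+ s.
    rewrite (_ : c * _ = P.[n%:R] - Q.[n%:R]); last by rewrite PE; ring.
    apply: le_trans (ler_normB _ _) _; rewrite natrD mulrDl lerD //.
    by rewrite ger0_norm //; apply: le_trans H1.
  have H3 : n.+1%:R ^+ s <= 2%:R ^+ s * n%:R ^+ s :> rat.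
    rewrite -exprMn lerXn2r ?nnegrE ?mulr_ge0 // -natrM ler_nat.
    by rewrite mul2n -addnn -addn1 leq_add2l (leq_ltn_trans _ n0n).
  have n_s : 0 < n%:R ^+ s :> rat by rewrite exprn_gt0.
  rewrite -(ler_pM2r n_s) -mulrA -exprS /E -mulrA.
  apply: le_trans _ (ler_wpM2l _ H3); last by [].
  by apply: le_trans H2; rewrite normrM [X in _ <= _ * X]ger0_norm // exprn_ge0.
have c_gt0 : 0 < `|c| by rewrite normr_gt0.
have := key (n0 + (Num.truncn (E / `|c|)).+1)%N.
rewrite -addSnnS leq_addr => /(_ isT); rewrite mulrC -ler_pdivlMr //.
have := truncnS_gt (E / `|c|).
rewrite addSnnS natrD => H1 H2.
have := lt_le_trans H1 (le_trans _ H2); rewrite ltxx => /(_ _)/negP; apply=> //.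
by rewrite lerDr.
Qed.

Lemma evpoly_growth k (f : nat -> nat) (e C n0 : nat) :
  evpoly k (fun n => (f n)%:R) ->
  (forall n, (n0 <= n)%N -> (f n <= C * n.+1 ^ e)%N) ->
  evpoly e.+1 (fun n => (f n)%:R).
Proof.
move=> [P [_ [n1 HP]]] Hf; exists P; split; last by exists n1.
apply: (@poly_growth P e C (maxn n0 n1)) => n.
rewrite geq_max => /andP[/Hf Hn /HP <-].
by rewrite ler0n -natrX -natrM ler_nat.
Qed.

Lemma size_poly_diff k (P : {poly rat}) : (size P <= k.+1)%N ->
  (size (P \Po ('X + 1%:P) - P)%R <= k)%N.
Proof.
move=> sP; have sX : size ('X + 1%:P : {poly rat}) = 2 by rewrite size_XaddC.
have sC : size (P \Po ('X + 1%:P)) = size P by rewrite size_comp_poly2.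
apply/leq_sizeP => j kj; rewrite coefB.
have [Pj|jP] := leqP (size P) j; first by rewrite !nth_default ?sC // subrr.
have jE : j = (size P).-1.
  have : (j < k.+1)%N := leq_trans jP sP.
  rewrite ltnS => jk; apply/eqP.
  by rewrite -eqSS (ltn_predK jP) eqn_leq jP (leq_trans sP).
have := @lead_coef_comp _ P ('X + 1%:P); rewrite sX => /(_ isT).
by rewrite lead_coefXaddC expr1n mulr1 /lead_coef sC -jE => ->; rewrite subrr.
Qed.

(** The growth hypothesis is on sums because lengths of A modulo powers compare between ideals,
    while lengths of successive layers do not. Taking the difference lowers the degree by one. *)
Lemma evpoly_sum_growth k (f : nat -> nat) (d C : nat) :
  evpoly k (fun n => (f n)%:R) ->
  (forall n, (\sum_(j < n) f j <= C * n.+1 ^ d)%N) ->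
  evpoly d (fun n => (f n)%:R).
Proof.
move=> Hf HC; pose F n := (\sum_(j < n) f j)%N.
have HF : evpoly k.+1 (fun n => (F n)%:R).
  apply: evpoly_diff; move: Hf => [P [sP [n0 HP]]]; exists P; split=> //.
  by exists n0 => n /HP <-; rewrite /F big_ord_recr /= natrD addrC addKr.
have [P [sP [n0 HP]]] := @evpoly_growth _ _ d C 0 HF (fun n _ => HC n).
exists (P \Po ('X + 1%:P) - P); split; first exact: size_poly_diff.
exists n0 => n n0n; rewrite hornerD hornerN horner_comp hornerD hornerX hornerC natr1.
rewrite -!HP //; last exact: leq_trans (leqnSn _).
by rewrite /F big_ord_recr /= natrD addrC addKr.
Qed.

(** * Submodules *)

Section SubmoduleBasics.
Variables (A : comNzRingType) (V : lmodType A).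
Implicit Types (S T K L : set V) (I J : set A).

Definition submodule S := S 0 /\ forall a u v, S u -> S v -> S (a *: u + v).

Lemma submodP S : submod_closed [in S] <-> submodule S.
Proof.
split=> -[S0 SD]; split.
- exact/set_mem.
- by move=> a u v Su Sv; apply/set_mem/SD; apply/mem_set.
- exact/mem_set.
- by move=> a u v Su Sv; apply/mem_set/SD; apply/set_mem.
Qed.

Lemma submod0 S : submodule S -> S 0. Proof. by case. Qed.
Lemma submodZ S a u : submodule S -> S u -> S (a *: u).
Proof. by move=> [S0 SD] Su; rewrite -[_ *: _]addr0; apply: SD. Qed.
Lemma submodD S u v : submodule S -> S u -> S v -> S (u + v).
Proof. by move=> [S0 SD] Su Sv; rewrite -[u]scale1r; apply: SD. Qed.
Lemma submodN S u : submodule S -> S u -> S (- u).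
Proof. by move=> HS Su; rewrite -scaleN1r; apply: submodZ. Qed.
Lemma submodB S u v : submodule S -> S u -> S v -> S (u - v).
Proof. by move=> HS Su Sv; apply: submodD => //; apply: submodN. Qed.
Lemma submod_sum S (T : Type) (r : seq T) (P : pred T) (F : T -> V) :
  submodule S -> (forall i, P i -> S (F i)) -> S (\sum_(i <- r | P i) F i).
Proof.
move=> HS SF; apply: (big_ind S) => //; first exact: submod0.
by move=> u v; apply: submodD.
Qed.

Lemma submodT : submodule setT. Proof. by []. Qed.
Lemma submod_zero : submodule [set 0].
Proof. by split=> // a u v -> ->; rewrite scaler0 addr0. Qed.
Lemma submodI S T : submodule S -> submodule T -> submodule (S `&` T).
Proof.
move=> [S0 SD] [T0 TD]; split=> // a u v [Su Tu] [Sv Tv].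
by split; [apply: SD | apply: TD].
Qed.

Definition addsub K L : set V := [set x | exists k l, [/\ K k, L l & x = k + l]].

Lemma submod_add K L : submodule K -> submodule L -> submodule (addsub K L).
Proof.
move=> HK HL; split.
  by exists 0, 0; split; rewrite ?addr0 //; apply: submod0.
move=> a u v [k [l [Kk Ll ->]]] [k' [l' [Kk' Ll' ->]]].
exists (a *: k + k'), (a *: l + l'); split.
- by case: HK => _; apply.
- by case: HL => _; apply.
- by rewrite scalerDr addrACA.
Qed.
Lemma addsubl K L : submodule L -> K `<=` addsub K L.
Proof. by move=> HL k Kk; exists k, 0; split; rewrite ?addr0 //; case: HL. Qed.
Lemma addsubr K L : submodule K -> L `<=` addsub K L.
Proof. by move=> HK k Kk; exists 0, k; split; rewrite ?add0r //; case: HK. Qed.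
Lemma addsub_sub K L S : submodule S -> K `<=` S -> L `<=` S -> addsub K L `<=` S.
Proof. by move=> HS KS LS _ [k [l [/KS Sk /LS Sl ->]]]; apply: submodD. Qed.
Lemma addsubS K L K' L' : K `<=` K' -> L `<=` L' -> addsub K L `<=` addsub K' L'.
Proof. by move=> KK LL _ [k [l [/KK ? /LL ? ->]]]; exists k, l. Qed.

Lemma smul_gen I S a y : I a -> S y -> smul I S (a *: y).
Proof.
move=> Ia Sy; exists 1%N, (fun=> a), (fun=> y); split=> //.
by rewrite big_ord1.
Qed.

Lemma smul_sub I S T : submodule T ->
  (forall a y, I a -> S y -> T (a *: y)) -> smul I S `<=` T.
Proof.
move=> HT H _ [k [a [y [Hy ->]]]]; apply: submod_sum => // i _.
by case: (Hy i) => *; apply: H.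
Qed.

Lemma smulS I J S T : I `<=` J -> S `<=` T -> smul I S `<=` smul J T.
Proof.
move=> IJ ST _ [k [a [y [Hy ->]]]]; exists k, a, y; split=> // i.
by case: (Hy i) => /IJ ? /ST ?.
Qed.

Lemma smul0 I S : smul I S 0.
Proof.
by exists 0%N, (fun=> 0), (fun=> 0); split=> [[]//|]; rewrite big_ord0.
Qed.

Lemma smulD I S u v : smul I S u -> smul I S v -> smul I S (u + v).
Proof.
move=> -[k [a [y [Hy ->]]]] [l [b [z [Hz ->]]]].
exists (k + l)%N.
exists (fun i : 'I_(k + l) => match fintype.split i with inl i => a i | inr i => b i end).
exists (fun i : 'I_(k + l) => match fintype.split i with inl i => y i | inr i => z i end).
split=> [i|]; first by case: (fintype.split i).
rewrite big_split_ord /=; congr (_ + _); apply: eq_bigr => i _.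
  by rewrite (unsplitK (inl i)).
by rewrite (unsplitK (inr i)).
Qed.

Lemma submod_smul I S : submodule S -> submodule (smul I S).
Proof. by move=> /submodP HS; apply/submodP/smul_submod_closed. Qed.

Lemma submod_smul_l I S : (forall c a, I a -> I (c * a)) -> submodule (smul I S).
Proof.
move=> HI; split; first exact: smul0.
move=> c u v [k [a [y [Hy ->]]]] Hv; apply: smulD => //.
exists k, (fun i => c * a i), y; split=> [i|].
  by case: (Hy i) => /HI.
by rewrite scaler_sumr; apply: eq_bigr => i _; rewrite scalerA.
Qed.

Definition lspan (s : seq V) : set V := smul setT [set` s].

Lemma submod_lspan s : submodule (lspan s).
Proof. exact: submod_smul_l. Qed.

Lemma lspan_mem s x : x \in s -> lspan s x.
Proof. by move=> xs; rewrite -[x]scale1r; apply: smul_gen. Qed.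

Lemma lspan_sub s S : submodule S -> (forall x, x \in s -> S x) -> lspan s `<=` S.
Proof.
by move=> HS sS; apply: smul_sub => // a y _ ys; apply: (submodZ _ HS); apply: sS.
Qed.

Lemma lspan_nil : lspan [::] = [set 0].
Proof.
apply/seteqP; split=> [|x ->]; last exact: smul0.
by apply: lspan_sub => //; exact: submod_zero.
Qed.

Lemma lspan_cons x s v : lspan (x :: s) v <-> exists a w, lspan s w /\ v = a *: x + w.
Proof.
split.
  apply: (@lspan_sub _ (fun v => exists a w, lspan s w /\ v = a *: x + w)).
    split; first by exists 0, 0; rewrite scale0r add0r; split=> //; exact: smul0.
    move=> c u w [a [u' [Hu ->]]] [b [w' [Hw ->]]].
    exists (c * a + b), (c *: u' + w'); split.
      by case: (submod_lspan s) => _; apply.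
    by rewrite scalerDl scalerDr scalerA addrACA.
  move=> y; rewrite inE => /orP[/eqP ->|ys].
    by exists 1, 0; rewrite scale1r addr0; split=> //; exact: smul0.
  by exists 0, y; rewrite scale0r add0r; split=> //; exact: lspan_mem.
move=> [a [w [Hw ->]]]; apply: submodD; first exact: submod_lspan.
  by apply: submodZ; [exact: submod_lspan|exact/lspan_mem/mem_head].
move: w Hw; apply: lspan_sub; first exact: submod_lspan.
by move=> y ys; apply: lspan_mem; rewrite inE ys orbT.
Qed.

Lemma lspan_sub_seq s s' : {subset s <= s'} -> lspan s `<=` lspan s'.
Proof.
by move=> ss; apply: lspan_sub; [exact: submod_lspan|move=> x /ss; exact: lspan_mem].
Qed.

End SubmoduleBasics.

Section LinearImages.
Variables (A : comNzRingType) (V W : lmodType A).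

Lemma submod_preim (f : {linear V -> W}) (S : set W) :
  submodule S -> submodule (f @^-1` S).
Proof.
move=> [S0 SD]; split; first by rewrite /preimage /= linear0.
by move=> a u v Su Sv; rewrite /preimage /= linearP; apply: SD.
Qed.

Lemma submod_image (f : {linear V -> W}) (S : set V) :
  submodule S -> submodule (f @` S).
Proof.
move=> [S0 SD]; split; first by exists 0 => //; rewrite linear0.
by move=> a _ _ [u Su <-] [v Sv <-]; exists (a *: u + v); [apply: SD|rewrite linearP].
Qed.

Lemma smul_image (f : {linear V -> W}) (I : set A) (S : set V) x :
  smul I S x -> smul I (f @` S) (f x).
Proof.
move=> [k [a [y [Hy ->]]]]; exists k, a, (f \o y); split=> [i|].
  by case: (Hy i) => Ia Sy; split=> //; exists (y i).
by rewrite linear_sum; apply: eq_bigr => i _; rewrite linearZ.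
Qed.

End LinearImages.

Section LinearMaps.
Variables (A : comNzRingType) (V W : lmodType A).

Definition lin_of (f : V -> W) (Hf : linear f) : {linear V -> W} :=
  HB.pack f (GRing.isLinear.Build A V W _ f Hf).
Lemma lin_ofE (f : V -> W) (Hf : linear f) x : lin_of Hf x = f x.
Proof. by []. Qed.

End LinearMaps.

Section LinearMapInstances.
Variables (A : comNzRingType) (V : lmodType A).

Lemma homothety_is_linear (a : A) : linear ( *:%R a : V -> V).
Proof. by move=> b u v; rewrite scalerDr !scalerA mulrC. Qed.
Definition homothety (a : A) := lin_of (homothety_is_linear a).
Lemma homothetyE a v : homothety a v = a *: v. Proof. by []. Qed.

Lemma orbit_is_linear (v : V) : linear (fun a : A^o => (a : A) *: v).
Proof. by move=> b x y; rewrite scalerDl -scalerA. Qed.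

End LinearMapInstances.

Definition orbit_map (A : comNzRingType) (V : lmodType A) (v : V) :
  {linear A^o -> V} := lin_of (orbit_is_linear v).
Lemma orbit_mapE (A : comNzRingType) (V : lmodType A) (v : V) (a : A) :
  orbit_map v a = a *: v.
Proof. by []. Qed.

(** * Noetherian modules *)

Lemma increasing_leq (T : Type) (G : nat -> set T) :
  (forall k, G k `<=` G k.+1) -> forall k l, (k <= l)%N -> G k `<=` G l.
Proof.
move=> HG k; elim=> [|l IH]; first by rewrite leqn0 => /eqP ->.
rewrite leq_eqVlt => /orP[/eqP -> //|]; rewrite ltnS => /IH kl.
exact: subset_trans (HG l).
Qed.

Section AscendingChains.
Variables (A : comNzRingType) (V : lmodType A).
Implicit Types (S T K L : set V).

Definition acc_sub L := forall G : nat -> set V,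
  (forall k, submodule (G k)) -> (forall k, G k `<=` L) ->
  (forall k, G k `<=` G k.+1) ->
  exists k0, forall k, (k0 <= k)%N -> G k `<=` G k0.

Lemma acc_fin_gen L S : acc_sub L -> submodule S -> S `<=` L ->
  exists s : seq V, S = lspan s.
Proof.
move=> HL HS SL; apply: contrapT => /forallNP nS.
(* A list not contained in S gets the dummy value 0, so that [choice] applies to all lists. *)
have next (s : seq V) : exists x : V,
    (forall y, y \in s -> S y) -> S x /\ ~ lspan s x.
  have [sS|nsS] := pselect (forall y, y \in s -> S y); last by exists 0.
  apply: contrapT => /forallNP H; apply: (nS s); apply/seteqP; split.
    by move=> x Sx; apply: contrapT => nx; apply: (H x).
  exact: lspan_sub.
have [f Hf] := choice next.
pose u := fix u n := if n is n'.+1 then f (u n') :: u n' else [::].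
have uS n : forall y, y \in u n -> S y.
  elim: n => [|n IH] y //=; rewrite inE => /orP[/eqP ->|/IH //].
  by case: (Hf (u n) IH).
have [|||k0 /(_ k0.+1 (leqnSn _)) Hk] := HL (fun n => lspan (u n)).
- by move=> k; exact: submod_lspan.
- by move=> k; apply: subset_trans SL; apply: lspan_sub => //; exact: uS.
- by move=> k; apply: lspan_sub_seq => x xu; rewrite /= inE xu orbT.
have [_ nf] := Hf _ (uS k0); apply: nf; apply: Hk.
by apply: lspan_mem; rewrite /= mem_head.
Qed.

(** Noetherian induction from larger submodules to smaller ones: a failure would produce a larger
    failure, and so an infinite ascending chain. *)
Lemma acc_ind (P : set V -> Prop) : acc_sub setT ->
  (forall K, submodule K ->
     (forall K', submodule K' -> K `<` K' -> P K') -> P K) ->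
  forall K, submodule K -> P K.
Proof.
move=> HV IH K HK; apply: contrapT => nPK.
have next (K' : {K | submodule K /\ ~ P K}) :
    exists K'' : {K | submodule K /\ ~ P K}, sval K' `<` sval K''.
  case: K' => K1 [HK1 nK1] /=; apply: contrapT => /forallNP H.
  apply: nK1; apply: (IH) => // K2 HK2 K12; apply: contrapT => nK2.
  exact: (H (exist _ K2 (conj HK2 nK2))).
have [f Hf] := choice next.
pose u n := iter n f (exist _ K (conj HK nPK)).
have [|||k0 /(_ k0.+1 (leqnSn _)) Hk] := HV (fun n => sval (u n)).
- by move=> k; case: (svalP (u k)).
- by [].
- by move=> k; apply: properW; exact: Hf.
by case: (Hf (u k0)) => _; apply.
Qed.

Lemma acc_fg S : acc_sub setT -> submodule S -> fin_gen_sub S.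
Proof. by move=> HV HS; apply: (acc_fin_gen HV). Qed.

End AscendingChains.

Section Noetherian.
Variables (A : comNzRingType) (noethA : noetherian A).

Lemma noetherian_acc : acc_sub [set: A^o].
Proof.
move=> G HG _ HS; have Hle := increasing_leq HS.
pose U : set A^o := [set x | exists k, G k x].
have HU : submodule U.
  split; first by exists 0%N; apply: submod0.
  move=> a u v [k Gu] [l Gv]; exists (maxn k l); case: (HG (maxn k l)) => _; apply.
    exact: (Hle k _ (leq_maxl _ _)).
  exact: (Hle l _ (leq_maxr _ _)).
have [s Us] := noethA ((submodP _).2 HU).
have sU : forall x, x \in s -> U x by rewrite Us; exact: lspan_mem.
have [k Hk] : exists k, forall x, x \in s -> G k x.
  elim: s sU {Us} => [|y s IH] sU; first by exists 0%N.
  have [|k Hk] := IH; first by move=> x xs; apply: sU; rewrite inE xs orbT.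
  have [l Hl] := sU y (mem_head _ _).
  exists (maxn k l) => x; rewrite inE => /orP[/eqP ->|/Hk].
    exact: (Hle l _ (leq_maxr _ _)).
  exact: (Hle k _ (leq_maxl _ _)).
exists k => l _; apply: (@subset_trans _ U); first by move=> x; exists l.
by rewrite Us; apply: lspan_sub.
Qed.

(** A chain in the span of x :: s is controlled by its traces on the span of s and by its ideals of
    coefficients of x, both of which stabilise. *)
Lemma acc_lspan (V : lmodType A) (s : seq V) : acc_sub (lspan s).
Proof.
elim: s => [|x s IH] G HG GL HS; have Hle := increasing_leq HS.
  exists 0%N => k _ v /GL; rewrite lspan_nil => ->; exact: submod0.
pose G' k := G k `&` lspan s.
pose I k : set A^o := [set a : A^o | exists w, lspan s w /\ G k ((a : A) *: x + w)].
have [|||k1 Hk1] := IH G'.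
- by move=> k; apply: submodI => //; exact: submod_lspan.
- by move=> k v [].
- by move=> k v [/HS ? ?].
have [|||k2 Hk2] := noetherian_acc (G := I).
- move=> k; split.
    by exists 0; split; [exact: smul0|rewrite scale0r addr0; apply: submod0].
  move=> a u v [w [Hw Gw]] [w' [Hw' Gw']]; exists (a *: w + w'); split.
    by case: (submod_lspan s) => _; apply.
  have := (HG k).2 a _ _ Gw Gw'.
  by rewrite scalerDr addrACA scalerA -scalerDl.
- by [].
- by move=> k a [w [sw /HS Gw]]; exists w.
exists (maxn k1 k2) => k; rewrite geq_max => /andP[k1k k2k] v Gv.
have [a [w [sw vE]]] := (lspan_cons x s v).1 (GL _ _ Gv).
have [|w' [sw' Gw']] := Hk2 k k2k a; first by exists w; rewrite -vE.
have [] := Hk1 k k1k (w - w').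
  split; last by apply: submodB => //; exact: submod_lspan.
  suff -> : w - w' = v - (a *: x + w').
    by apply: submodB => //; exact: (Hle k2).
  by rewrite vE opprD addrACA subrr add0r.
move=> Gww _; rewrite (_ : v = (a *: x + w') + (w - w')); last first.
  by rewrite vE addrA addrAC addrK // -addrA; congr (_ + _); rewrite addrK.
apply: submodD => //; first exact: (Hle k2 _ (leq_maxr _ _)).
exact: (Hle k1 _ (leq_maxl _ _)).
Qed.

Lemma fin_gen_acc (V : lmodType A) : fin_gen V -> acc_sub [set: V].
Proof. by move=> [s ->]; exact: acc_lspan. Qed.

Lemma fin_gen_submod (V : lmodType A) (S : set V) :
  fin_gen V -> submodule S -> exists s, S = lspan s.
Proof. by move=> /fin_gen_acc HV HS; apply: (acc_fin_gen HV). Qed.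

Lemma ideal_fin_gen (I : set A^o) : submodule I -> exists s : seq A^o, I = lspan s.
Proof. by move=> HI; apply: (acc_fin_gen noetherian_acc). Qed.

End Noetherian.

(** * Primes and Nakayama's lemma *)

Section Adjoin.
Variables (A : comNzRingType) (V : lmodType A).

Definition adjoin (K : set V) (v : V) : set V :=
  [set x | exists c k, K k /\ x = c *: v + k].

Lemma submod_adjoin K v : submodule K -> submodule (adjoin K v).
Proof.
move=> HK; split; first by exists 0, 0; rewrite scale0r addr0; split=> //; case: HK.
move=> a _ _ [c [k [Kk ->]]] [c' [k' [Kk' ->]]].
exists (a * c + c'), (a *: k + k'); split; first by case: HK => _; apply.
by rewrite scalerDr scalerDl scalerA addrACA.
Qed.
Lemma adjoin_sub K v : K `<=` adjoin K v.
Proof. by move=> k Kk; exists 0, k; rewrite scale0r add0r. Qed.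
Lemma adjoin_mem K v : submodule K -> adjoin K v v.
Proof. by move=> HK; exists 1, 0; rewrite scale1r addr0; split=> //; case: HK. Qed.
Lemma adjoin_proper K v : submodule K -> ~ K v -> K `<` adjoin K v.
Proof.
by move=> HK nKv; split; [exact: adjoin_sub|move/(_ v (adjoin_mem v HK))].
Qed.
Lemma adjoin_min K v S : submodule S -> K `<=` S -> S v -> adjoin K v `<=` S.
Proof.
by move=> HS KS Sv _ [c [k [/KS Sk ->]]]; apply: submodD => //; apply: submodZ.
Qed.

Lemma submod_colon (K : set V) (u : V) :
  submodule K -> submodule ([set a | K (a *: u)] : set A^o).
Proof.
move=> HK; split; first by rewrite /= scale0r; case: HK.
by move=> a x y /= Kx Ky; rewrite scalerDl -scalerA; case: HK => _; apply.
Qed.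

End Adjoin.

Section Primes.
Variable A : comNzRingType.
Implicit Types (I J P : set A^o).

Lemma proper_idealP I : idealr_closed [in I : set A] <-> submodule I /\ ~ I 1.
Proof.
split=> [[I0 I1 IS]|[[I0 IS] I1]].
  split; last by move=> I1'; move: I1; rewrite mem_set.
  split; first exact/set_mem.
  by move=> a u v Iu Iv; apply/set_mem/IS; apply/mem_set.
split; [exact/mem_set|exact/negP/(contra_not _ I1)/set_mem|].
by move=> a u v Iu Iv; apply/mem_set/IS; apply/set_mem.
Qed.

Lemma prime_idealP P : prime_ideal (P : set A) <->
  [/\ submodule P, ~ P 1 & forall u v : A, P (u * v) -> P u \/ P v].
Proof.
split=> [[/proper_idealP[HP P1] Pp]|[HP P1 Pp]].
  split=> // u v Puv; have := Pp u v (mem_set Puv).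
  by case/orP => /set_mem; [left|right].
split; first exact/proper_idealP.
by move=> u v /set_mem /Pp [] ?; apply/orP; [left|right]; apply/mem_set.
Qed.

Lemma prime_sub P : prime_ideal (P : set A) -> submodule P.
Proof. by case/prime_idealP. Qed.
Lemma prime_1 P : prime_ideal (P : set A) -> ~ P 1.
Proof. by case/prime_idealP. Qed.
Lemma prime_mul P (u v : A) :
  prime_ideal (P : set A) -> P (u * v) -> P u \/ P v.
Proof. by case/prime_idealP => _ _; apply. Qed.

Lemma prime_or_factor I : submodule I -> ~ I 1 ->
  prime_ideal (I : set A) \/ exists a b : A, [/\ I (a * b), ~ I a & ~ I b].
Proof.
move=> HI I1; have [?|nP] := pselect (prime_ideal (I : set A)); [by left|right].
apply: contrapT => H; apply: nP; apply/prime_idealP; split=> // u v Iuv.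
have [?|nIu] := pselect (I u); [by left|right].
by apply: contrapT => nIv; apply: H; exists u, v.
Qed.

Lemma ideal_mulr I (a b : A) : submodule I -> I a -> I (b * a).
Proof. by move=> HI Ia; apply: (submodZ b HI). Qed.
Lemma ideal_mull I (a b : A) : submodule I -> I a -> I (a * b).
Proof. by move=> HI Ia; rewrite mulrC; apply: (submodZ b HI). Qed.

Hypothesis noethA : noetherian A.

(** An ideal maximal among those avoiding a multiplicative set is prime; Noetherian induction takes
    the place of Zorn's lemma. *)
Lemma prime_disjoint (W : set A) I :
  W 1 -> (forall x y, W x -> W y -> W (x * y)) ->
  submodule I -> (forall x, I x -> ~ W x) ->
  exists P : set A, [/\ prime_ideal P, I `<=` P & forall x, P x -> ~ W x].
Proof.
move=> W1 WM; move: I; apply: (acc_ind (noetherian_acc noethA)) => I HI IH IW.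
have I1 : ~ I 1 by move=> I1; exact: (IW _ I1).
have [|[a [b [Iab na nb]]]] := prime_or_factor HI I1; first by move=> Ip; exists I; split.
have step (c : A) : ~ I c -> (forall x, adjoin I c x -> ~ W x) ->
    exists P : set A, [/\ prime_ideal P, I `<=` P & forall x, P x -> ~ W x].
  move=> nc Wc.
  have [|P [Pp IP PW]] := IH (adjoin I c) (submod_adjoin _ HI) _ Wc.
    exact: adjoin_proper.
  by exists P; split=> //; apply: subset_trans IP; exact: adjoin_sub.
have [/(step a na)//|/existsNP[x /not_implyP[Ix /contrapT Wx]]] :=
  pselect (forall x, adjoin I a x -> ~ W x).
have [/(step b nb)//|/existsNP[y /not_implyP[Iy /contrapT Wy]]] :=
  pselect (forall x, adjoin I b x -> ~ W x).
exfalso; apply: (IW (x * y) _ (WM _ _ Wx Wy)).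
case: Ix => c [i [Ii ->]]; case: Iy => c' [i' [Ii' ->]].
rewrite mulrDl; apply: submodD => //; last exact: ideal_mull.
rewrite mulrDr; apply: submodD => //; last exact: ideal_mulr.
rewrite -[_ *: _]/(c * a) -[_ *: _]/(c' * b) mulrACA; exact: ideal_mulr.
Qed.

(** A maximal colon ideal among those of multiples of u is prime. The second conclusion records that
    the colon ideal only grows, which makes the primes comparable in [regular_torsion_free]. *)
Lemma associated_prime (V : lmodType A) (K : set V) (u : V) :
  submodule K -> ~ K u ->
  exists u' : V, prime_ideal [set a | K (a *: u')] /\
                 forall a, K (a *: u) -> K (a *: u').
Proof.
move=> HK nKu.
suff H : forall I : set A^o, submodule I -> forall u : V, ~ K u ->
    I = [set a | K (a *: u)] -> exists u' : V,
    prime_ideal [set a | K (a *: u')] /\ forall a, K (a *: u) -> K (a *: u').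
  by apply: (H _ (submod_colon u HK)).
move=> {nKu}{u}; apply: (acc_ind (noetherian_acc noethA)) => I HI IH u nKu IE.
have I1 : ~ I 1 by rewrite IE /= scale1r.
have [Ip|[a [b [Iab na nb]]]] := prime_or_factor HI I1.
  by exists u; rewrite -IE.
(* With ab in I and neither factor in I, a u still lies outside K and its colon ideal gains b. *)
have [||//|u' [Pu' Hu']] := IH [set c | K (c *: (a *: u))] (submod_colon _ HK) _
    (a *: u).
- split=> [c|/(_ b)].
    by rewrite IE /= scalerA mulrC -scalerA => Kc; apply: submodZ.
  move=> H; apply: nb; apply: H.
  by move: Iab; rewrite IE /= scalerA mulrC.
- by move: na; rewrite IE.
exists u'; split=> // c Kc; apply: Hu'.
by rewrite scalerA mulrC -scalerA; apply: submodZ.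
Qed.

Lemma proper_ideal_maximal I : submodule I -> ~ I 1 ->
  exists m : set A, maximal_ideal m /\ I `<=` m.
Proof.
move: I; apply: (acc_ind (noetherian_acc noethA)) => I HI IH I1.
have [mI|] := pselect (maximal_ideal (I : set A)); first by exists I; split.
move=> /not_andP[nI|]; first by exfalso; apply: nI; apply/proper_idealP.
move=> /existsNP[J /not_implyP[/proper_idealP[HJ J1]]].
move=> /not_implyP[IJ nIJ].
have [|m [mm Jm]] := IH J HJ _ J1; last by exists m; split=> //; exact: subset_trans Jm.
by split=> // JI; apply: nIJ; apply/seteqP.
Qed.

End Primes.

Section LocalRing.
Variables (A : comNzRingType) (m : set A).
Hypotheses (noethA : noetherian A) (localm : is_local m).

Lemma local_submod : submodule (m : set A^o).
Proof. by case: localm => -[/proper_idealP[]]. Qed.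
Lemma local_1 : ~ m 1.
Proof. by case: localm => -[/proper_idealP[]]. Qed.

Lemma local_sub (I : set A^o) : submodule I -> ~ I 1 -> I `<=` m.
Proof.
move=> HI I1; have [m' [mm' Im']] := proper_ideal_maximal noethA HI I1.
by case: localm => _ /(_ _ mm') <-.
Qed.

Lemma local_prime : prime_ideal m.
Proof.
apply/prime_idealP; split; [exact: local_submod|exact: local_1|].
move=> u v muv; apply: contrapT => /not_orP[nu nv].
have key x : ~ m x -> adjoin (m : set A^o) x 1.
  move=> nx; apply: contrapT => n1; apply: nx.
  apply: (local_sub (submod_adjoin _ local_submod) n1).
  by apply: adjoin_mem; exact: local_submod.
apply: local_1; have [c [i [mi E1]]] := key u nu; have [c' [i' [mi' E2]]] := key v nv.
have -> : 1 = (c * u + i) * (c' * v + i') by rewrite -[LHS]mul1r {1}E1 E2.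
have Hm := local_submod.
rewrite mulrDl; apply: (submodD Hm); last exact: (ideal_mull _ Hm).
rewrite mulrDr; apply: (submodD Hm); last exact: (ideal_mulr _ Hm).
by rewrite mulrACA; exact: (ideal_mulr _ Hm).
Qed.

Lemma local_inv (a : A) : ~ m a -> exists b, b * a = 1.
Proof.
move=> na; have [/(_ 1)|nI] := pselect (forall x : A, adjoin ([set 0] : set A^o) a x).
  by move=> [c [k [->]]]; rewrite addr0 => /esym E; exists c.
have HI : submodule (adjoin ([set 0] : set A^o) a) by exact/submod_adjoin/submod_zero.
exfalso; apply: na; apply: (local_sub HI); last by apply: adjoin_mem; exact: submod_zero.
by move=> I1; apply: nI => x; rewrite -[x]mulr1; exact: (ideal_mulr _ HI).
Qed.

Lemma local_1B (a : A) : m a -> exists b, b * (1 - a) = 1.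
Proof.
move=> ma; apply: local_inv => m1a; apply: local_1.
by rewrite -(subrK a 1); apply: (submodD local_submod).
Qed.

Section Nakayama.
Variable V : lmodType A.
Implicit Types (B L K : set V).

Lemma smul_lspan_cons (c : V) (s : seq V) v : smul m (lspan (c :: s)) v ->
  exists a w, [/\ m a, smul m (lspan s) w & v = a *: c + w].
Proof.
have Hm := local_submod.
apply: (@smul_sub _ _ _ _
   (fun v => exists a w, [/\ m a, smul m (lspan s) w & v = a *: c + w])).
  split.
    exists 0, 0; split; [exact: (submod0 Hm)|exact: smul0|].
    by rewrite scale0r addr0.
  move=> a _ _ [b [w [mb Hw ->]]] [b' [w' [mb' Hw' ->]]].
  exists (a * b + b'), (a *: w + w'); split; first by case: Hm => _; apply.
    by case: (submod_smul m (submod_lspan s)) => _; apply.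
  by rewrite scalerDr scalerDl scalerA addrACA.
move=> a y ma /lspan_cons [b [w [sw ->]]].
exists (a * b), (a *: w); split; first exact: ideal_mull.
  exact: smul_gen.
by rewrite scalerDr scalerA.
Qed.

(** Generators are removed one at a time: c = a c + w with a in m and w in [Y] puts c in [Y],
    because 1 - a is a unit. *)
Lemma nakayama_seq B (s : seq V) : submodule B ->
  (forall x, x \in s -> addsub (smul m (lspan s)) B x) -> forall x, x \in s -> B x.
Proof.
move=> HB; elim: s => [//|c s IH] Hs.
have Hm := local_submod.
pose Y := addsub (smul m (lspan s)) B.
have HY : submodule Y by apply: submod_add => //; apply/submod_smul/submod_lspan.
have Hcs x : x \in c :: s -> exists a w, [/\ m a, Y w & x = a *: c + w].
  move=> /Hs [k [l [/smul_lspan_cons [a [w [ma Hw ->]]] Bl ->]]].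
  by exists a, (w + l); split; rewrite ?addrA //; exists w, l.
have Yc : Y c.
  have [a [w [ma Yw cE]]] := Hcs c (mem_head _ _).
  have [b b1] := local_1B ma.
  suff -> : c = b *: w by apply: submodZ.
  have -> : w = (1 - a) *: c by rewrite scalerBl scale1r {1}cE addrC addKr.
  by rewrite scalerA b1 scale1r.
have IHs : forall x, x \in s -> B x.
  apply: IH => x xs; have [|a [w [ma Yw ->]]] := Hcs x; first by rewrite inE xs orbT.
  by apply: submodD => //; apply: submodZ.
move=> x; rewrite inE => /orP[/eqP ->|/IHs //].
move: Yc; apply: addsub_sub => //; apply: smul_sub => // a y _.
by move/(lspan_sub HB IHs); apply: submodZ.
Qed.

Lemma nakayama B L : submodule B -> fin_gen_sub L ->
  L `<=` addsub (smul m L) B -> L `<=` B.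
Proof.
move=> HB [s ->] H; rewrite -/(lspan s) in H *.
apply: lspan_sub => //; apply: nakayama_seq => // x xs.
by apply: H; exact: lspan_mem.
Qed.

Lemma nakayama1 B L (a : A) : submodule B -> fin_gen_sub L -> m a ->
  (forall x, L x -> exists y, L y /\ B (x - a *: y)) -> L `<=` B.
Proof.
move=> HB HL ma H; apply: nakayama => // x /H [y [Ly Bxy]].
exists (a *: y), (x - a *: y); split=> //; first exact: smul_gen.
by rewrite addrC subrK.
Qed.

End Nakayama.
End LocalRing.

(** * Length *)

Section Length.
Variables (A : comNzRingType) (V : lmodType A).
Implicit Types (K L M X Y : set V) (S : nat -> set V).

(** Unlike in [submod_chain], the ends need not be K and L, so that chains can be widened, cut and
    transported; [has_length_len] recovers the ends. *)
Definition chain_in K L n S :=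
  (forall i, (i <= n)%N -> [/\ submodule (S i), K `<=` S i & S i `<=` L]) /\
  (forall i, (i < n)%N -> S i `<` S i.+1).

Definition len_le K L b := forall n S, chain_in K L n S -> (n <= b)%N.
Definition fin_len K L := exists b, len_le K L b.

Lemma len_leW K L K' L' b : K `<=` K' -> L' `<=` L -> len_le K L b -> len_le K' L' b.
Proof.
move=> KK LL H n S [HS HS']; apply: (H n S); split=> // i /HS [? ? ?].
by split=> //; [apply: subset_trans KK _|apply: subset_trans LL].
Qed.

Lemma len_le_leq K L b c : (b <= c)%N -> len_le K L b -> len_le K L c.
Proof. by move=> bc H n S /H /leq_trans; apply. Qed.

Lemma chain_le K L n S i j : chain_in K L n S -> (i <= j)%N -> (j <= n)%N ->
  S i `<=` S j.
Proof.
move=> [_ HS']; elim: j => [|j IH]; first by rewrite leqn0 => /eqP -> _ x.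
rewrite leq_eqVlt => /orP[/eqP -> _ x //|]; rewrite ltnS => /IH ij jn.
by apply: subset_trans (ij (ltnW jn)) _; apply: properW; exact: HS'.
Qed.

Lemma chain_extend K X Y n S : submodule Y -> X `<` Y -> K `<=` X ->
  chain_in K X n S -> exists S', chain_in K Y n.+1 S'.
Proof.
move=> HY [XY nYX] KX [HS HS'].
exists (fun i => if (i <= n)%N then S i else Y); split=> i.
  move=> _; case: leqP => [/HS [? ? ?]|_]; split=> //.
    exact: subset_trans XY.
  exact: subset_trans XY.
move=> lin; case: (ltnP i n) => [ni|ni]; first by rewrite (ltnW ni); apply: HS'.
have -> : i = n by apply/eqP; rewrite eqn_leq ni -ltnS lin.
rewrite leqnn; have [_ _ SX] := HS n (leqnn _).
by split; [exact: subset_trans XY|move=> YS; apply: nYX; exact: subset_trans SX].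
Qed.

Lemma chain_widen K L K' L' n S : K' `<=` K -> L `<=` L' ->
  chain_in K L n S -> chain_in K' L' n S.
Proof.
move=> KK LL [HS HS']; split=> // i /HS [? ? ?].
by split=> //; [apply: subset_trans KK _|apply: subset_trans LL].
Qed.

Lemma chain0 K : submodule K -> chain_in K K 0 (fun=> K).
Proof. by split=> // i _; split. Qed.

Lemma chain_cat K L M p q S T : K `<=` L -> L `<=` M ->
  chain_in K L p S -> chain_in L M q T ->
  exists U, chain_in K M (p + q) U.
Proof.
move=> KL LM cS; elim: q M LM T => [|q IH] M LM T [HT HT'].
  by exists S; rewrite addn0; apply: chain_widen cS.
have [HTq LTq _] := HT q (leqnSn _).
have [HTM _ TM] := HT q.+1 (leqnn _).
have [|U cU] := IH (T q) LTq T.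
  split=> [i iq|i iq]; last by apply: HT'; exact: ltnW.
  have [? ? _] := HT i (leq_trans iq (leqnSn _)); split=> //.
  by apply: (chain_le (conj HT HT')).
have [|U' cU'] := chain_extend HTM (HT' q (leqnn _)) _ cU.
  exact: subset_trans LTq.
by exists U'; rewrite addnS; apply: chain_widen cU'.
Qed.

(** By the modular law, a strict step of a chain stays strict after intersecting with L or after
    adding L. The two chains are built alongside the given one. *)
Lemma len_le_add K L M a b : submodule K -> submodule L -> submodule M ->
  K `<=` L -> L `<=` M ->
  len_le K L a -> len_le L M b -> len_le K M (a + b).
Proof.
move=> HK HL HM KL LM Ha Hb n S [HS HS'].
suff: forall k, (k <= n)%N -> exists p q T U,
   [/\ (k <= p + q)%N, chain_in K (S k `&` L) p T & chain_in L (addsub (S k) L) q U].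
  case/(_ n (leqnn _)) => p [q [T [U [npq cT cU]]]].
  apply: leq_trans npq _; apply: leq_add.
    by apply: (Ha p T); apply: chain_widen cT => // x [].
  apply: (Hb q U); apply: chain_widen cU => //; apply: addsub_sub => //.
  by case: (HS n (leqnn _)).
elim=> [_|k IH kn].
  have [HS0 KS0 _] := HS 0%N (leq0n _).
  exists 0%N, 0%N, (fun=> K), (fun=> L); split=> //.
    apply: chain_widen (chain0 HK) => // x Kx; split; [exact: KS0|exact: KL].
  by apply: chain_widen (chain0 HL) => //; exact: addsubr.
have [p [q [T [U [kpq cT cU]]]]] := IH (ltnW kn).
have [HSk KSk _] := HS k (ltnW kn).
have [HSk' KSk' _] := HS k.+1 kn.
have [Skk nSkk] := HS' k kn.
have [SL|nSL] := pselect (S k.+1 `&` L `<=` S k `&` L); last first.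
  have [|||T' cT'] := @chain_extend K (S k `&` L) (S k.+1 `&` L) p T _ _ _ cT.
  - exact: submodI.
  - by split=> // x [/Skk ? ?].
  - by move=> x Kx; split; [exact: KSk|exact: KL].
  exists p.+1, q, T', U; split=> //.
  by apply: chain_widen cU => //; apply: addsubS.
have [|||U' cU'] := @chain_extend L (addsub (S k) L) (addsub (S k.+1) L) q U _ _ _ cU.
- exact: submod_add.
- split; first exact: addsubS.
  move=> SL'; apply: nSkk => x Sx.
  have [s [l [Ss Ll xE]]] := SL' x (addsubl HL Sx).
  have : (S k.+1 `&` L) l.
    split=> //; rewrite (_ : l = x - s); last by rewrite xE addrC addKr.
    by apply: submodB => //; exact: Skk.
  by move/SL => [Sl _]; rewrite xE; apply: submodD.
- exact: addsubr.
exists p, q.+1, T, U'; split=> //; first by rewrite addnS.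
by apply: chain_widen cT => // x [/Skk].
Qed.

(* len K L = 0 when the length is infinite. *)
Definition len K L : nat :=
  xget 0%N [set l | len_le K L l /\ exists S, chain_in K L l S].

Lemma lenP K L : submodule K -> submodule L -> K `<=` L -> fin_len K L ->
  len_le K L (len K L) /\ exists S, chain_in K L (len K L) S.
Proof.
move=> HK HL KL [b Hb].
have ex : exists n, `[< exists S, chain_in K L n S >].
  exists 0%N; apply/asboolP; exists (fun=> K).
  exact: chain_widen (chain0 HK).
have ub n : `[< exists S, chain_in K L n S >] -> (n <= b)%N.
  by move=> /asboolP[S /Hb].
have [l /asboolP cl lmax] := ex_maxnP ex ub.
apply: (@xgetPex _ 0%N [set l | len_le K L l /\ exists S, chain_in K L l S]).
by exists l; split=> // n S cS; apply: lmax; apply/asboolP; exists S.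
Qed.

Lemma len_leP K L b : submodule K -> submodule L -> K `<=` L ->
  len_le K L b -> (len K L <= b)%N.
Proof.
move=> HK HL KL Hb; have [|_ [S cS]] := lenP HK HL KL; first by exists b.
exact: Hb cS.
Qed.

Lemma fin_lenW K L K' L' : K `<=` K' -> L' `<=` L -> fin_len K L -> fin_len K' L'.
Proof. by move=> KK LL [b Hb]; exists b; apply: len_leW Hb. Qed.

Lemma len_add K L M : submodule K -> submodule L -> submodule M ->
  K `<=` L -> L `<=` M -> fin_len K M ->
  len K M = (len K L + len L M)%N.
Proof.
move=> HK HL HM KL LM fKM; have KM := subset_trans KL LM.
have fKL : fin_len K L by apply: fin_lenW fKM.
have fLM : fin_len L M by apply: fin_lenW fKM.
have [H1 [S1 C1]] := lenP HK HL KL fKL.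
have [H2 [S2 C2]] := lenP HL HM LM fLM.
have [H3 [S3 C3]] := lenP HK HM KM fKM.
apply/eqP; rewrite eqn_leq; apply/andP; split.
  exact: (len_le_add HK HL HM KL LM H1 H2) C3.
by have [U /H3] := chain_cat KL LM C1 C2.
Qed.

(** A chain of maximal length starts at K and ends at L, since a missing end could be added to
    it. *)
Lemma has_length_len K L : submodule K -> submodule L -> K `<=` L ->
  fin_len K L -> has_length K L (len K L).
Proof.
move=> HK HL KL fKL; have [Hl [S [HS HS']]] := lenP HK HL KL fKL.
set l := len K L in Hl HS HS' *.
split; last first.
  move=> n T [T0 Tn HT HT']; apply: (Hl n T).
  have mono i j : (i <= j)%N -> (j <= n)%N -> T i `<=` T j.
    by apply: (@chain_le set0 setT n T); split=> // k kn; split=> //; exact/submodP/HT.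
  split=> // i i_n.
  by split; [exact/submodP/HT|rewrite -T0; exact: mono|rewrite -Tn; exact: mono].
have ends X Y : chain_in K L l S -> X `<` Y -> submodule X -> submodule Y ->
    K `<=` X -> Y `<=` L -> (S l `<=` X \/ Y `<=` S 0%N) -> False.
  move=> cS XY HX HY KX YL [SX|YS].
    have [|S' cS'] := @chain_extend K X Y l S HY XY KX _.
      split=> // i il; have [? ? _] := HS i il; split=> //.
      by apply: subset_trans SX; apply: (chain_le cS).
    by have := Hl _ _ (chain_widen (@subset_refl _ _) YL cS'); rewrite ltnn.
  have c1 : chain_in X Y 1 (fun i => if i == 0%N then X else Y).
    by split=> [[|[|i]]|[|i]] //= _; split=> //; exact: properW.
  have c2 : chain_in Y L l S.
    split=> // i il; have [? _ ?] := HS i il; split=> //.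
    by apply: subset_trans YS _; apply: (chain_le cS).
  have [U cU] := chain_cat (properW XY) YL c1 c2.
  by have := Hl _ _ (chain_widen KX (@subset_refl _ _) cU); rewrite add1n ltnn.
have [HS0 KS0 S0L] := HS 0%N (leq0n _).
have [HSl KSl SlL] := HS l (leqnn _).
exists S; split=> //; last by move=> i /HS [/submodP].
- apply: contrapT => SK; apply: (ends K (S 0%N)) => //; last by right.
  by split=> // S0K; apply: SK; apply/seteqP.
- apply: contrapT => SL; apply: (ends (S l) L) => //; last by left.
  by split=> // S0K; apply: SL; apply/seteqP.
Qed.

End Length.

Section LengthTransfer.
Variables (A : comNzRingType) (V W : lmodType A).

Lemma len_le_monotone (Phi : set V -> set W) (K L : set V) (K' L' : set W) b :
  (forall S, submodule S -> K `<=` S -> S `<=` L ->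
     [/\ submodule (Phi S), K' `<=` Phi S & Phi S `<=` L']) ->
  (forall S T, submodule S -> submodule T -> K `<=` S -> T `<=` L ->
     S `<` T -> Phi S `<` Phi T) ->
  len_le K' L' b -> len_le K L b.
Proof.
move=> H1 H2 Hb n S [HS HS']; apply: (Hb n (fun i => Phi (S i))); split=> i lin.
  by have [? ? ?] := HS i lin; apply: H1.
have [? ? _] := HS i (ltnW lin); have [? _ ?] := HS i.+1 lin.
by apply: H2 => //; exact: HS'.
Qed.

Lemma len_le_inj (f : {linear V -> W}) (K L : set V) (K' L' : set W) b :
  submodule K' -> submodule L' -> K' `<=` L' ->
  (forall v, L v -> L' (f v)) -> (forall v, L v -> K' (f v) -> K v) ->
  len_le K' L' b -> len_le K L b.
Proof.
move=> HK' HL' KL' LL KK.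
apply: (@len_le_monotone (fun S => addsub K' (f @` S))).
  move=> S HS KS SL; split.
  - by apply: submod_add => //; exact: submod_image.
  - by apply: addsubl; exact: submod_image.
  - by apply: addsub_sub => // _ [v /SL /LL ? <-].
move=> S T HS HT KS TL [ST nTS]; split.
  by apply: addsubS => // _ [v /ST ? <-]; exists v.
move=> H; apply: nTS => v Tv.
have [|k [_ [K'k [s Ss <-] E]]] := H (f v).
  by apply: addsubr => //; exists v.
have Lvs : L (v - s) by apply: TL; apply: submodB => //; exact: ST.
have := KK _ Lvs; rewrite linearB E addrK => /(_ K'k) /KS Svs.
by rewrite -(subrK s v); apply: submodD.
Qed.

End LengthTransfer.

Lemma len_le_surj (A : comNzRingType) (V W : lmodType A)
  (f : {linear V -> W}) (K L : set V) (K' L' : set W) b :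
  submodule L -> K `<=` L -> (forall v, K v -> K' (f v)) ->
  (forall w, L' w -> exists2 v, L v & K' (w - f v)) ->
  len_le K L b -> len_le K' L' b.
Proof.
move=> HL KL KK LL.
apply: (@len_le_monotone _ _ _ (fun S => L `&` f @^-1` S)).
  move=> S HS KS SL; split; last by move=> v [].
  - by apply: submodI => //; exact: submod_preim.
  - by move=> v Kv; split; [exact: KL|apply/KS/KK].
move=> S T HS HT KS TL [ST nTS]; split; first by move=> v [? /ST].
move=> H; apply: nTS => w Tw.
have [v Lv Kwv] := LL _ (TL _ Tw).
have Tfv : T (f v).
  rewrite -(subrK w (f v)); apply: submodD => //; apply: ST.
  by rewrite -opprB; apply: submodN => //; exact: KS.
have [|_ Sfv] := H v; first by split.
by rewrite -(subrK (f v) w); apply: submodD => //; exact: KS.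
Qed.

Section LengthGenerators.
Variables (A : comNzRingType) (V : lmodType A).

(** Each generator contributes a quotient of A / q. *)
Lemma len_le_gen (q : set A) (K : set V) (s : seq V) c :
  submodule (q : set A^o) -> submodule K ->
  (forall a v, q a -> v \in s -> K (a *: v)) ->
  len_le (q : set A^o) setT c ->
  len_le K (addsub (lspan s) K) (size s * c).
Proof.
move=> Hq; elim: s K => [|v s IH] K HK qK Hc.
  move=> n S [HS HS']; rewrite mul0n leqNgt; apply/negP => n0.
  have [_ nS] := HS' 0%N n0; apply: nS.
  have [_ _ SL] := HS 1%N n0; have [_ KS _] := HS 0%N (ltnW n0).
  apply: subset_trans SL (subset_trans _ KS).
  by apply: addsub_sub => //; rewrite lspan_nil => _ ->; exact: submod0.
have HKv := submod_adjoin v HK.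
rewrite mulSn.
apply: (@len_le_add _ _ K (adjoin K v)) => //.
- by apply: submod_add => //; exact: submod_lspan.
- exact: adjoin_sub.
- apply: adjoin_min; first by apply: submod_add => //; exact: submod_lspan.
    exact/addsubr/submod_lspan.
  by apply: addsubl => //; apply: lspan_mem; exact: mem_head.
- apply: (@len_le_surj _ A^o V (orbit_map v) q setT) => //.
    by move=> a qa; rewrite orbit_mapE; apply: qK => //; exact: mem_head.
  move=> _ [a [k [Kk ->]]]; exists a => //.
  by rewrite orbit_mapE addrC addKr.
- apply: len_leW (IH _ HKv _ Hc) => //; last first.
    by move=> a w qa ws; apply: adjoin_sub; apply: qK; rewrite // inE ws orbT.
  move=> _ [_ [k [/lspan_cons [a [w [sw ->]]] Kk ->]]].
  exists w, (a *: v + k); split=> //; last by rewrite addrCA addrA.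
  by exists a, k.
Qed.

Lemma len_le_local (m : set A) : noetherian A -> is_local m ->
  len_le (m : set A^o) setT 1.
Proof.
move=> noethA localm [//|[//|n]] S [HS HS']; exfalso.
have [_ nS] := HS' 1%N isT; apply: nS.
have [HS1 mS1 _] := HS 1%N isT; have [_ mS0 _] := HS 0%N isT.
have [S01 nS01] := HS' 0%N isT.
have [S11|nS11] := pselect (S 1%N 1).
  by move=> x _; rewrite -[x]mulr1; exact: (ideal_mulr _ HS1).
exfalso; apply: nS01; apply: subset_trans mS0.
exact: (local_sub noethA localm HS1).
Qed.

End LengthGenerators.

(** * Graded families and the Hilbert basis theorem *)

Section IdealPowers.
Variables (A : comNzRingType) (V : lmodType A).
Implicit Types (I J : set A) (S : set V).

Lemma smulA I (J : set A) S : submodule S ->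
  smul (smul I (J : set A^o) : set A) S = smul I (smul J S).
Proof.
move=> HS; have HJS := submod_smul J HS; apply/seteqP; split.
  apply: smul_sub; first exact: submod_smul.
  move=> a y Ha Sy; pose T : set A^o := [set a | smul I (smul J S) ((a : A) *: y)].
  suff : smul I (J : set A^o) `<=` T by apply.
  apply: smul_sub; first by apply: submod_colon; exact: submod_smul.
  move=> c b Ic Jb; rewrite /T /= -[c *: b]/(c * b) -scalerA.
  by apply: smul_gen => //; exact: smul_gen.
apply: smul_sub; first exact: submod_smul.
move=> a y Ia [k [b [z [Hz ->]]]]; rewrite scaler_sumr.
apply: submod_sum => [|i _]; first exact: submod_smul.
have [Jb Sz] := Hz i; rewrite scalerA; apply: smul_gen => //.
exact: (@smul_gen _ A^o).
Qed.

Lemma submod_pow I n : submodule (ideal_pow I n : set A^o).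
Proof. exact/submodP/ideal_pow_closed. Qed.

Lemma smul_pow0 I S : submodule S -> smul (ideal_pow I 0) S = S.
Proof.
move=> HS; apply/seteqP; split; first by apply: smul_sub => // a y _; apply: submodZ.
by move=> y Sy; rewrite -[y]scale1r; apply: smul_gen.
Qed.

Lemma smul_powS I n S : submodule S ->
  smul (ideal_pow I n.+1) S = smul I (smul (ideal_pow I n) S).
Proof. exact: smulA. Qed.

Lemma smul_powD I n k S : submodule S ->
  smul (ideal_pow I (n + k)) S = smul (ideal_pow I n) (smul (ideal_pow I k) S).
Proof.
move=> HS; have HkS := submod_smul (ideal_pow I k) HS.
elim: n => [|n IH]; first by rewrite add0n smul_pow0.
by rewrite addSn !smul_powS // IH.
Qed.

Lemma smul_pow_le I n k S : submodule S -> (n <= k)%N ->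
  smul (ideal_pow I k) S `<=` smul (ideal_pow I n) S.
Proof.
move=> HS /subnKC <-; rewrite smul_powD //; apply: smulS => //.
by apply: smul_sub => // a y _; apply: submodZ.
Qed.

End IdealPowers.

Section GradedFamilies.
Variables (A : comNzRingType) (V : lmodType A).
Implicit Types (xs : seq A) (G K L : nat -> set V).

(* gfam xs G: the G n are the components of a graded module over the polynomial
   ring A[xs], whose variables act by the scalars xs and raise the degree by 1.
   gacc xs K L: the graded quotient module L / K is Noetherian. *)
Definition gfam xs G := (forall n, submodule (G n)) /\
  forall x n v, x \in xs -> G n v -> G n.+1 (x *: v).

Definition gacc xs K L := forall G : nat -> nat -> set V,
  (forall k, gfam xs (G k)) -> (forall k n, K n `<=` G k n) ->
  (forall k n, G k n `<=` L n) -> (forall k n, G k n `<=` G k.+1 n) ->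
  exists k0, forall k n, (k0 <= k)%N -> G k n `<=` G k0 n.

Lemma gaccW xs K L K' L' : (forall n, K n `<=` K' n) -> (forall n, L' n `<=` L n) ->
  gacc xs K L -> gacc xs K' L'.
Proof.
move=> KK LL H G HG KG GL; apply: H => // k n; first exact: subset_trans (KG k n).
exact: subset_trans (LL n).
Qed.

Definition gzero (n : nat) : set V := [set 0].

Lemma gacc_nil : acc_sub [set: V] ->
  gacc [::] gzero (fun n => if n == 0%N then setT else [set 0]).
Proof.
move=> HV G HG _ GL HS.
have [|||k0 Hk] := HV (fun k => G k 0%N) => //; first by move=> k; case: (HG k).
exists k0 => k [|n] kk; first exact: Hk.
by move=> v /(GL k n.+1) /= ->; case: (HG k0) => /(_ n.+1) /submod0.
Qed.

Section Extension.
Variables (xs : seq A) (x : A) (L : nat -> set V).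
Hypothesis gL : gfam xs L.

Definition gshift j n : set V := if (j <= n)%N then L (n - j)%N else [set 0].

(** Values at the scalar x of polynomials of degree strictly below j and total degree n; the
    coefficient of x^i has degree n - i, whence the shifts. *)
Fixpoint gpoly j n : set V := if j is j'.+1
  then [set v | exists u w, [/\ gpoly j' n u, gshift j' n w & v = u + x ^+ j' *: w]]
  else [set 0].

(* L[x]; no polynomial ring is needed, since representatives of the elements
   suffice for the leading coefficient argument. *)
Definition gext n : set V := [set v | exists j, gpoly j n v].

Lemma gfam_gshift j : gfam xs (gshift j).
Proof.
case: gL => L1 L2; split=> [n|y n v ys]; rewrite /gshift.
  by case: ifP => // _; exact: submod_zero.
case: ifP => [jn|_ ->]; first by rewrite leqW // subSn //; exact: L2.
by case: ifP => _; rewrite scaler0 //; exact: submod0.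
Qed.

Lemma gfam_gpoly j : gfam xs (gpoly j).
Proof.
elim: j => [|j [IH1 IH2]].
  by split=> [n|y n v _ ->]; [exact: submod_zero|rewrite scaler0].
have [S1 S2] := gfam_gshift j; split=> [n|y n _ ys [u [w [Pu Sw ->]]]].
  split; first by exists 0, 0; split; rewrite ?scaler0 ?addr0 //; exact: submod0.
  move=> a _ _ [u [w [Pu Sw ->]]] [u' [w' [Pu' Sw' ->]]].
  exists (a *: u + u'), (a *: w + w'); split.
  - by case: (IH1 n) => _; apply.
  - by case: (S1 n) => _; apply.
  - by rewrite !scalerDr !scalerA [a * _]mulrC addrACA.
exists (y *: u), (y *: w); split; [exact: IH2|exact: S2|].
by rewrite scalerDr !scalerA mulrC.
Qed.

Lemma gpolyS j n : gpoly j n `<=` gpoly j.+1 n.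
Proof.
move=> v Pv; exists v, 0; split=> //; last by rewrite scaler0 addr0.
by case: (gfam_gshift j) => /(_ n) /submod0.
Qed.

Lemma gpoly_mulx j n v : gpoly j n v -> gpoly j.+1 n.+1 (x *: v).
Proof.
elim: j v => [|j IH] v.
  move=> ->; rewrite scaler0; case: (gfam_gpoly 1) => /(_ n.+1) /submod0 //.
move=> [u [w [Pu Sw ->]]]; exists (x *: u), w; split.
- exact: IH.
- by move: Sw; rewrite /gshift ltnS subSS.
- by rewrite scalerDr scalerA -exprS.
Qed.

Lemma gfam_gext : gfam (x :: xs) gext.
Proof.
have Ple := increasing_leq (fun j => @gpolyS j _).
split=> [n|y n v ys [j Pv]].
  split; first by exists 0%N.
  move=> a u v [j Pu] [k Pv]; exists (maxn j k).
  case: (gfam_gpoly (maxn j k)) => /(_ n) [_ H] _; apply: H.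
    exact: (Ple _ _ _ (leq_maxl _ _)).
  exact: (Ple _ _ _ (leq_maxr _ _)).
move: ys; rewrite inE => /orP[/eqP ->|ys].
  by exists j.+1; exact: gpoly_mulx.
by exists j; case: (gfam_gpoly j) => _; apply.
Qed.

Lemma gext_sub n : L n `<=` gext n.
Proof.
move=> v Lv; exists 1%N, 0, v; split=> //; last by rewrite expr0 scale1r add0r.
by rewrite /gshift leq0n subn0.
Qed.

(* The leading coefficients of degree n of Hilbert's argument, for the elements
   of degree at most j in x. *)
Definition gcoef G j n : set V :=
  [set w | L n w /\ exists u, gpoly j (n + j) u /\ G (n + j)%N (u + x ^+ j *: w)].

Lemma gfam_gcoef G j : gfam (x :: xs) G -> gfam xs (gcoef G j).
Proof.
case: gL => L1 L2 [G1 G2]; have [P1 P2] := gfam_gpoly j.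
split=> [n|y n w ys [Lw [u [Pu Gu]]]].
  split.
    split; first exact: submod0.
    by exists 0; split; rewrite ?scaler0 ?addr0; exact: submod0.
  move=> a w w' [Lw [u [Pu Gu]]] [Lw' [u' [Pu' Gu']]]; split.
    by case: (L1 n) => _; apply.
  exists (a *: u + u'); split; first by case: (P1 (n + j)%N) => _; apply.
  rewrite scalerDr scalerA [_ * a]mulrC -scalerA addrACA -scalerDr.
  by case: (G1 (n + j)%N) => _; apply.
split; first exact: L2.
exists (y *: u); split; first exact: P2.
rewrite scalerA [_ * y]mulrC -scalerA -scalerDr; apply: G2 => //.
by rewrite inE ys orbT.
Qed.

Lemma gcoefS G j n : gfam (x :: xs) G -> gcoef G j n `<=` gcoef G j.+1 n.
Proof.
move=> [_ G2] w [Lw [u [Pu Gu]]]; split=> //; exists (x *: u).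
rewrite addnS; split; first exact: gpoly_mulx.
by rewrite exprS -scalerA -scalerDr; apply: G2; rewrite ?mem_head.
Qed.

Lemma gcoef_mono G G' j n : (forall n, G n `<=` G' n) -> gcoef G j n `<=` gcoef G' j n.
Proof. by move=> GG w [Lw [u [Pu /GG Gu]]]; split=> //; exists u. Qed.

(** Leading term subtraction: an element of G' loses its leading term to an element of G, and the
    difference has lower degree in x. Any choice of representation serves. *)
Lemma gcoef_determines G G' : gfam (x :: xs) G -> gfam (x :: xs) G' ->
  (forall n, G n `<=` G' n) ->
  (forall j n, gcoef G' j n `<=` gcoef G j n) ->
  forall j n v, gpoly j n v -> G' n v -> G n v.
Proof.
move=> [G1 G2] [G'1 G'2] GG H; elim=> [|j IH] n v.
  by move=> -> _; exact: submod0.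
move=> [u [w [Pu Sw ->]]] Gv; move: Sw; rewrite /gshift.
case: leqP => [jn Lw|_ w0]; last first.
  by move: Gv; rewrite w0 scaler0 addr0; exact: IH.
have [] := H j (n - j)%N w.
  by split=> //; exists u; rewrite subnK.
move=> _ [u' []]; rewrite subnK // => Pu' Gu'.
rewrite -(subrK (u' + x ^+ j *: w) (u + _)); apply: submodD => //.
have E : u + x ^+ j *: w - (u' + x ^+ j *: w) = u - u'.
  by rewrite opprD addrACA subrr addr0.
rewrite E; apply: IH.
  by apply: submodB => //; case: (gfam_gpoly j).
by rewrite -E; apply: submodB => //; exact: GG.
Qed.

(** The families [gcoef (G k) j] increase in both indices. The diagonal k = j stabilises at some k0,
    which settles all j >= k0; the finitely many j below k0 stabilise separately. *)
Lemma gacc_gext : gacc xs gzero L -> gacc (x :: xs) gzero gext.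
Proof.
move=> aL G HG _ GL HS.
have Gle k l n : (k <= l)%N -> G k n `<=` G l n.
  exact: (increasing_leq (fun k => HS k n)).
have zero_sub H : gfam xs H -> forall n, gzero n `<=` H n.
  by move=> [H1 _] n _ ->; exact: submod0.
have [||||k0 Hk0] := aL (fun k => gcoef (G k) k).
- by move=> k; exact: gfam_gcoef.
- by move=> k n; apply: zero_sub; exact: gfam_gcoef.
- by move=> k n w [].
- by move=> k n; apply: subset_trans (@gcoefS _ _ _ (HG _)); exact: gcoef_mono.
have /choice[c Hc] : forall j, exists cj, forall k n, (cj <= k)%N ->
    gcoef (G k) j n `<=` gcoef (G cj) j n.
  move=> j.
  apply: aL.
  - by move=> k; exact: gfam_gcoef.
  - by move=> k n; apply: zero_sub; exact: gfam_gcoef.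
  - by move=> k n w [].
  - by move=> k n; exact: gcoef_mono.
(* The sum is a common upper bound of k0 and of the [c j]. *)
pose K := (k0 + \sum_(j < k0) c j)%N.
exists K => k n Kk v Gv; have [j Pv] := GL _ _ _ Gv.
apply: (@gcoef_determines (G K) (G k)) Pv Gv => //; first by move=> n'; exact: Gle.
move=> {v n j} j n; have [k0j|jk0] := leqP k0 j.
  apply: (@subset_trans _ (gcoef (G (maxn k j)) (maxn k j) n)).
    apply: (@subset_trans _ (gcoef (G (maxn k j)) j n)).
      by apply: gcoef_mono => n'; apply: Gle; exact: leq_maxl.
    apply: (increasing_leq (fun i => @gcoefS _ i n (HG (maxn k j)))).
    exact: leq_maxr.
  apply: (@subset_trans _ (gcoef (G k0) k0 n)).
    by apply: Hk0; rewrite (leq_trans k0j) // leq_maxr.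
  apply: (@subset_trans _ (gcoef (G k0) j n)).
    exact: (increasing_leq (fun i => @gcoefS _ i n (HG k0))).
  by apply: gcoef_mono => n'; apply: Gle; exact: leq_addr.
have cK : (c j <= K)%N.
  apply: leq_trans (leq_addl _ _).
  by rewrite (bigD1 (Ordinal jk0)) //= leq_addr.
apply: (@subset_trans _ (gcoef (G (c j)) j n)).
  by apply: Hc; exact: leq_trans Kk.
by apply: gcoef_mono => n'; exact: Gle.
Qed.

End Extension.

(** The polynomial module over V is replaced by values in V: starting from V in degree 0, [gext]
    adjoins one variable at a time. *)
Lemma gacc_exists xs : acc_sub [set: V] ->
  exists L, [/\ gfam xs L, L 0%N = setT & gacc xs gzero L].
Proof.
move=> aV; elim: xs => [|x xs [L [gL L0 aL]]].
  exists (fun n => if n == 0%N then setT else [set 0]); split=> //.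
    by split=> // -[|n] //=; exact: submod_zero.
  exact: gacc_nil.
exists (gext x L); split; [exact: gfam_gext|idtac|exact: gacc_gext].
by apply/seteqP; split=> // v _; apply: gext_sub => //; rewrite L0.
Qed.

Lemma gfam_mul xs G (I : set A) n a v : gfam xs G ->
  (I : set A^o) `<=` lspan (xs : seq A^o) -> I a -> G n v -> G n.+1 (a *: v).
Proof.
move=> [G1 G2] Ixs /Ixs + Gv; move: a.
apply: (@lspan_sub _ A^o xs [set a : A^o | G n.+1 ((a : A) *: v)]).
  exact: submod_colon.
by move=> x xs_x; exact: G2.
Qed.

Lemma gfam_smul_pow xs G (I : set A) n k : gfam xs G ->
  (I : set A^o) `<=` lspan (xs : seq A^o) ->
  smul (ideal_pow I n) (G k) `<=` G (n + k)%N.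
Proof.
move=> gG Ixs; have [G1 _] := gG; elim: n => [|n IH].
  by rewrite smul_pow0.
rewrite smul_powS //; apply: smul_sub => // a v Ia /IH.
exact: (gfam_mul gG Ixs).
Qed.

(** The Rees module of V is Noetherian: I^n V lies in degree n of every family stable under xs whose
    degree 0 part is V. *)
Lemma gacc_pow xs (I : set A) : acc_sub [set: V] ->
  (I : set A^o) `<=` lspan (xs : seq A^o) ->
  gacc xs gzero (fun n => smul (ideal_pow I n) setT).
Proof.
move=> aV Ixs; have [L [gL L0 aL]] := gacc_exists xs aV.
apply: gaccW aL => n; first exact: subset_refl.
by have := gfam_smul_pow (n := n) (k := 0) gL Ixs; rewrite L0 addn0.
Qed.

Lemma gfam_pow xs (I : set A) : {subset xs <= [in I]} ->
  gfam xs (fun n => smul (ideal_pow I n) setT : set V).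
Proof.
move=> xsI; split=> [n|x n v /xsI /set_mem Ix Iv]; first exact/submod_smul.
by rewrite smul_powS //; exact: smul_gen.
Qed.

(** The subfamilies [G k], generated modulo T by S in degrees up to k, ascend and exhaust S, so one
    of them is S. *)
Lemma bounded_generation xs (I : set A) (S T : nat -> set V) :
  (I : set A^o) = lspan (xs : seq A^o) ->
  gfam xs S -> gfam xs T -> (forall n, T n `<=` S n) -> gacc xs T S ->
  exists c, forall n, S (n + c)%N `<=` addsub (T (n + c)%N) (smul (ideal_pow I n) (S c)).
Proof.
move=> IE gS gT TS aTS; have [S1 S2] := gS; have [T1 T2] := gT.
have Ixs : (I : set A^o) `<=` lspan (xs : seq A^o) by rewrite IE.
have xsI x : x \in xs -> I x by move=> xx; rewrite IE; exact: lspan_mem.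
pose G k n := if (n <= k)%N then S n
  else addsub (T n) (smul (ideal_pow I (n - k)) (S k)).
have G1 k n : submodule (G k n).
  by rewrite /G; case: ifP => _ //; apply: submod_add => //; exact: submod_smul.
have GE k n : (k <= n)%N ->
    G k n = addsub (T n) (smul (ideal_pow I (n - k)) (S k)).
  rewrite /G; case: ltngtP => // -> _; rewrite subnn smul_pow0 //.
  apply/seteqP; split; first exact: addsubr.
  by apply: addsub_sub.
have GS k n : G k n `<=` S n.
  rewrite /G; case: leqP => [_ v //|kn]; apply: addsub_sub => //.
  by have := gfam_smul_pow (n := n - k) (k := k) gS Ixs; rewrite subnK // ltnW.
have [||||c Hc] := aTS G.
- move=> k; split=> // x n v xx; have [nk|kn] := ltnP n k.
    by rewrite /G nk (ltnW nk); exact: S2.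
  rewrite !GE ?(leq_trans kn) // => -[t [w [Tt Iw ->]]].
  exists (x *: t), (x *: w); split; [exact: T2| |by rewrite scalerDr].
  by rewrite subSn // smul_powS //; apply: smul_gen => //; exact: xsI.
- move=> k n; rewrite /G; case: ifP => _ //; apply: addsubl.
  exact: submod_smul.
- by [].
- move=> k n; case: (leqP n k) => nk; first by rewrite /G nk (leqW nk).
  rewrite !GE ?(ltnW nk) //; apply: addsubS => //.
  rewrite -(subnSK nk) -addn1 smul_powD //; apply: smulS => //.
  rewrite smul_powS // smul_pow0 //; apply: smul_sub => // a v.
  exact: (gfam_mul gS Ixs).
exists c => n; have := GE c (n + c)%N (leq_addl _ _); rewrite addnK => <-.
apply: (@subset_trans _ (G (n + c)%N (n + c)%N)); first by rewrite /G leqnn.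
by apply: Hc; exact: leq_addl.
Qed.

End GradedFamilies.

Lemma gacc_inj (A : comNzRingType) (V W : lmodType A) (f : {linear V -> W})
    xs (K L : nat -> set V) (L' : nat -> set W) :
  (forall v, f v = 0 -> v = 0) -> (forall n v, L n v -> L' n (f v)) ->
  gacc xs (@gzero _ W) L' -> gacc xs K L.
Proof.
move=> finj LL aL G HG _ GL HS.
have [||||k0 Hk] := aL (fun k n => f @` G k n).
- move=> k; have [G1 G2] := HG k; split=> [n|x n _ xx [v Gv <-]].
    exact: submod_image.
  by exists (x *: v); [exact: G2|rewrite linearZ].
- move=> k n _ ->; exists 0; rewrite ?linear0 //.
  by have [G1 _] := HG k; exact: submod0.
- by move=> k n _ [v /GL /LL ? <-].
- by move=> k n _ [v /HS ? <-]; exists v.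
exists k0 => k n kk v Gv; have [|u Gu uv] := Hk k n kk (f v); first by exists v.
have /finj/eqP : f (u - v) = 0 by rewrite linearB uv subrr.
by rewrite subr_eq0 => /eqP <-.
Qed.

(** * Hilbert functions *)

Lemma len_eq (A : comNzRingType) (V W : lmodType A) (K L : set V) (K' L' : set W) :
  submodule K -> submodule L -> K `<=` L ->
  submodule K' -> submodule L' -> K' `<=` L' -> fin_len K' L' ->
  (forall b, len_le K L b <-> len_le K' L' b) -> len K L = len K' L'.
Proof.
move=> HK HL KL HK' HL' KL' fKL' H.
have [b' /H Hb] := fKL'; have fKL : fin_len K L by exists b'.
have [/H l1 _] := lenP HK HL KL fKL; have [/H l2 _] := lenP HK' HL' KL' fKL'.
by apply/eqP; rewrite eqn_leq !len_leP.
Qed.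

Section HilbertSerre.
Variables (A : comNzRingType) (V : lmodType A).
Implicit Types (xs : seq A) (K L : nat -> set V).

Lemma len_le_sub (K L : set V) : L `<=` K -> len_le K L 0.
Proof.
move=> LK [//|n] S [HS HS']; have [_ nS] := HS' 0%N isT; exfalso; apply: nS.
have [_ _ SL] := HS 1%N isT; have [_ KS _] := HS 0%N isT.
exact: subset_trans SL (subset_trans LK KS).
Qed.

(** Multiplication by x on L / K has kernel [ker] / K and cokernel L / [coker], both killed by x, so
    induction applies to them. The forward difference of the length is the difference of theirs, and
    [evpoly_diff] adds one to the degree. *)
Theorem hilbert_serre xs K L : gfam xs K -> gfam xs L ->
  (forall n, K n `<=` L n) -> gacc xs K L -> (forall n, fin_len (K n) (L n)) ->
  evpoly (size xs) (fun n => (len (K n) (L n))%:R).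
Proof.
elim: xs K L => [|x xs IH] K L gK gL KL aKL fKL.
  have [K1 _] := gK; have [L1 _] := gL.
  (* With no variables the truncations of L are already subfamilies; they stabilise only if L and K
     agree in large degrees. *)
  have [||||k0 Hk] := aKL (fun k n => if (n <= k)%N then L n else K n).
  - by move=> k; split=> // n; case: ifP.
  - by move=> k n; case: ifP => _ v //; exact: KL.
  - by move=> k n; case: ifP => _ v //; exact: KL.
  - move=> k n; case: leqP => nk v; first by rewrite leqW.
    by case: ifP => // _; exact: KL.
  apply: evpoly_eventually0; exists k0.+1 => n k0n.
  have := Hk n n (ltnW k0n); rewrite leqnn leqNgt k0n /= => LK.
  have : (len (K n) (L n) <= 0)%N by apply: len_leP => //; exact: len_le_sub.
  by rewrite leqn0 => /eqP ->.
have [K1 K2] := gK; have [L1 L2] := gL.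
have xin : x \in x :: xs by exact: mem_head.
have sub y : y \in xs -> y \in x :: xs by move=> yxs; rewrite inE yxs orbT.
(* Nothing arrives in degree 0 from below. *)
pose xL n : set V := if n is n'.+1 then homothety V x @` L n' else [set 0].
have HxL n : submodule (xL n).
  by case: n => [|n]; [exact: submod_zero|exact: submod_image].
pose ker n := L n `&` homothety V x @^-1` K n.+1.
pose coker n := addsub (K n) (xL n).
have ker1 n : submodule (ker n) by apply: submodI => //; exact: submod_preim.
have coker1 n : submodule (coker n) by exact: submod_add.
have Kker n : K n `<=` ker n by move=> v Kv; split; [exact: KL|exact: K2].
have kerL n : ker n `<=` L n by move=> v [].
have Kcoker n : K n `<=` coker n by exact: addsubl.
have cokerL n : coker n `<=` L n.
  apply: addsub_sub => //; case: n => [|n]; first by move=> _ ->; exact: submod0.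
  by move=> _ [v Lv <-]; exact: L2.
have gsub (G : nat -> set V) : gfam (x :: xs) G -> gfam xs G.
  by move=> [G1 G2]; split=> // y n v /sub; exact: G2.
have gker : gfam xs ker.
  split=> // y n v yxs [Lv Kv]; split; first exact/L2/Lv/sub.
  rewrite /= scalerA mulrC -scalerA; apply: K2; [exact: sub|exact: Kv].
have gcoker : gfam xs coker.
  split=> // y n _ yxs [k [l [Kk xl ->]]]; rewrite scalerDr.
  exists (y *: k), (y *: l); split=> //; first exact/K2/Kk/sub.
  case: n {Kk} xl => [->|n [v Lv <-]].
    by rewrite scaler0; exact: (submod0 (HxL 1%N)).
  exists (y *: v); first exact/L2/Lv/sub.
  by rewrite /= !scalerA mulrC.
(* A family between K and [ker] is stable under x, because x sends [ker] into K. *)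
have aker : gacc xs K ker.
  move=> G HG KG Gker HS; apply: aKL => //; last first.
    by move=> k n; apply: subset_trans (kerL n).
  move=> k; have [G1 G2] := HG k; split=> // y n v.
  rewrite inE => /orP[/eqP ->|]; last exact: G2.
  by move=> /Gker [_ Kv]; exact: KG.
have acoker : gacc xs coker L.
  move=> G HG cG GL HS; apply: aKL => //; last first.
    by move=> k n; apply: subset_trans (cG k n).
  move=> k; have [G1 G2] := HG k; split=> // y n v.
  rewrite inE => /orP[/eqP ->|]; last exact: G2.
  by move=> /GL Lv; apply: cG; apply: addsubr => //; exists v.
have fker n : fin_len (K n) (ker n) by apply: fin_lenW (fKL n).
have fcoker n : fin_len (coker n) (L n) by apply: fin_lenW (fKL n).
have fK n : fin_len (K n) (coker n) by apply: fin_lenW (fKL n).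
have E n : len (ker n) (L n) = len (K n.+1) (coker n.+1).
  apply: len_eq => // b; split.
    apply: (@len_le_surj _ _ _ (homothety V x)) => //; first by move=> v [].
    move=> _ [k [_ [Kk [v Lv <-] ->]]]; exists v => //.
    by rewrite addrK.
  apply: (@len_le_inj _ _ _ (homothety V x)) => //.
  by move=> v Lv; apply: addsubr => //; exists v.
apply: evpoly_diff.
have := evpolyB (evpoly_shift (IH _ _ gcoker (gsub _ gL) cokerL acoker fcoker))
  (IH _ _ (gsub _ gK) gker Kker aker fker).
move=> [P [sP [n0 HP]]]; exists P; split=> //; exists n0 => n /HP <-.
rewrite (len_add (K1 n.+1) (coker1 n.+1)) // (len_add (K1 n) (ker1 n)) //.
by rewrite E !natrD [in X in _ - X]addrC opprD addrACA subrr add0r.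
Qed.

End HilbertSerre.

(** * Saturation of the powers of an ideal on a module *)

Section PowerSaturation.
Variables (A : comNzRingType) (V : lmodType A) (I : set A) (xs : seq A).
Hypotheses (accV : acc_sub [set: V]) (IE : (I : set A^o) = lspan (xs : seq A^o)).

Local Notation M n := (smul (ideal_pow I n) [set: V]).

Let xsI x : x \in xs -> I x. Proof. by rewrite IE; exact: (@lspan_mem _ A^o). Qed.
Let HM n : submodule (M n). Proof. exact: submod_smul. Qed.
Let gM : gfam xs (fun n => M n).
Proof. by apply: gfam_pow => x /xsI Ix; exact/mem_set. Qed.
Let Ixs : (I : set A^o) `<=` lspan (xs : seq A^o). Proof. by rewrite IE. Qed.

Lemma pow_mul k n a v : ideal_pow I k a -> M n v -> M (k + n) (a *: v).
Proof. by move=> Ia Mv; rewrite smul_powD //; exact: smul_gen. Qed.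

(* The elements v of M n killed by a power of I modulo M n.+1 form a graded
   module generated in bounded degree and annihilated by a fixed power of I,
   hence it vanishes in large degrees. *)
Lemma pow_torsion_bounded : exists n0, forall n, (n0 <= n)%N -> forall v k,
  M n v -> (forall a, ideal_pow I k a -> M (n + k).+1 (a *: v)) -> M n.+1 v.
Proof.
pose G k n := [set v | M n v /\ forall a, ideal_pow I k a -> M (n + k).+1 (a *: v)].
have gG k : gfam xs (G k).
  split=> [n|x n v xx [Mv Hv]].
    split; first by split=> [|a _]; rewrite ?scaler0; exact: submod0.
    move=> c u v [Mu Hu] [Mv Hv]; split; first by case: (HM n) => _; apply.
    move=> a Ia; rewrite scalerDr scalerA [a * c]mulrC -scalerA.
    by case: (HM (n + k).+1) => _; apply; [exact: Hu|exact: Hv].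
  split; first by case: gM => _; apply.
  move=> a /Hv Mav; rewrite scalerA mulrC -scalerA addSn.
  by case: gM => _; apply.
have GS k n : G k n `<=` G k.+1 n.
  move=> v [Mv Hv]; split=> //; rewrite addnS.
  apply: (@smul_sub _ A^o _ _ [set a : A^o | M (n + k).+2 ((a : A) *: v)]).
    exact: submod_colon.
  move=> a b Ia /Hv Mbv; rewrite /= -scalerA.
  exact: (gfam_mul gM Ixs Ia Mbv).
have aM : gacc xs (fun n => M n.+1) (fun n => M n).
  apply: (gaccW _ _ (gacc_pow accV Ixs)) => n //.
  by move=> _ ->; exact: submod0.
have TG k n : M n.+1 `<=` G k n.
  move=> v Mv; split; first by apply: smul_pow_le Mv.
  by move=> a Ia; rewrite addnC -addnS; exact: pow_mul.
have [||||k0 Hk0] := aM G => //; first by move=> k n v [].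
have gT : gfam xs (fun n => M n.+1).
  by split=> [n|x n v]; [exact: HM|case: gM => _; apply].
have aT : gacc xs (fun n => M n.+1) (G k0).
  apply: (gaccW _ _ aM) => n; [exact: subset_refl|by move=> v []].
have [c Hc] := bounded_generation IE (gG k0) gT (TG k0) aT.
exists (k0 + c)%N => n n0n v k Mv Hv.
have Gv : G k0 n v.
  apply: (Hk0 (maxn k k0)); first exact: leq_maxr.
  exact: (increasing_leq (fun k => GS k n) (leq_maxl k k0)).
have cn : (c <= n)%N := leq_trans (leq_addl _ _) n0n.
have := Hc (n - c)%N v; rewrite subnK // => /(_ Gv) [t [u [Mt Iu ->]]].
apply: submodD => //; move: u Iu.
(* I^k0 sends [G k0 c] into [M (c + k0).+1]; the other n - c - k0 factors, available since n >= k0 +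
   c, lead to [M n.+1]. *)
have -> : (n - c = n - c - k0 + k0)%N.
  by rewrite subnK // leq_subRL // addnC.
rewrite smul_powD; last by case: (gG k0).
have -> : (n.+1 = n - c - k0 + (c + k0).+1)%N.
  by rewrite addnS -subnDA subnK // addnC.
rewrite smul_powD //; apply: smulS => //.
by apply: smul_sub => // a u Ia [_]; apply.
Qed.

(** Induction on p: v is already in [M p], and its class modulo [M p.+1] is killed by a power of I,
    hence zero. The climb starts from [M n0 v], so vectors are first moved into I^n0 V. *)
Lemma pow_saturation : exists n0, forall p, (n0 <= p)%N -> forall v k,
  M n0 v -> (forall a, ideal_pow I k a -> M (p + k) (a *: v)) -> M p v.
Proof.
have [n0 H] := pow_torsion_bounded; exists n0; elim=> [|p IH].
  by rewrite leqn0 => /eqP ->.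
rewrite leq_eqVlt => /orP[/eqP <- //|]; rewrite ltnS => n0p v k Mv Hv.
apply: (H p n0p v k); last by move=> a /Hv.
apply: (IH n0p v k) => // a /Hv; apply: smul_pow_le => //.
Qed.

End PowerSaturation.

(** * Ratliff-Rush ideals *)

Lemma leq_expW (k l e : nat) : (k <= l)%N -> (k ^ e <= l ^ e)%N.
Proof. by case: e => // e; rewrite leq_exp2r. Qed.

Section RatliffRushBasics.
Variables (A : comNzRingType) (I : set A) (V : lmodType A).
Local Notation M n := (smul (ideal_pow I n) [set: V]).
Local Notation rr n := (ratliff_rush I n V : set A^o).

Let HM n : submodule (M n). Proof. exact: submod_smul. Qed.

Lemma rr_shift a n k : (forall x : V, M k x -> M (n + k) (a *: x)) ->
  forall j x, M (j + k) x -> M (j + (n + k)) (a *: x).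
Proof.
move=> H j; rewrite (@smul_powD _ V I j k) // (@smul_powD _ V I j (n + k)) //.
pose T := homothety V a @^-1` smul (ideal_pow I j) (M (n + k)).
apply: (@smul_sub _ _ _ _ T); first by apply: submod_preim; exact: submod_smul.
move=> b y Ib My; rewrite /T /= scalerA mulrC -scalerA.
by apply: smul_gen => //; exact: H.
Qed.

(** The colons in the definition increase with k, so that two exponents have a common one. *)
Lemma rr_le a n k : (forall x : V, M k x -> M (n + k) (a *: x)) ->
  forall l, (k <= l)%N -> forall x, M l x -> M (n + l) (a *: x).
Proof.
move=> H l kl x; have := @rr_shift a n k H (l - k) x.
by rewrite addnCA subnK.
Qed.

Lemma submod_rr n : submodule (rr n).
Proof.
split; first by exists 0%N => x _; rewrite scale0r; exact: submod0.
move=> c a b [k Hk] [l Hl]; exists (maxn k l) => x Mx.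
rewrite scalerDl -scalerA; case: (HM (n + maxn k l)) => _; apply.
  exact: (rr_le Hk (leq_maxl _ _)).
exact: (rr_le Hl (leq_maxr _ _)).
Qed.

Lemma rr_mul n x a : I x -> rr n a -> rr n.+1 (x * a).
Proof.
move=> Ix [k Hk]; exists k => v /Hk Mv.
by rewrite -scalerA addSn smul_powS //; exact: smul_gen.
Qed.

Lemma pow_sub_rr n : ideal_pow I n `<=` rr n.
Proof.
move=> a Ia; exists 0%N => v _; rewrite addn0.
by apply: smul_gen.
Qed.

Lemma rr_closure_sub n : rr_closure I n `<=` rr n.
Proof.
move=> a [k Hk]; exists k; apply: smul_sub.
  exact: (submod_preim (homothety V a)).
move=> b u Ib _; rewrite /= scalerA.
suff Iab : ideal_pow I (n + k) (a * b) by exact: smul_gen.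
have Ib' : smul (ideal_pow I k) (setT : set A^o) b.
  by rewrite -[b]mulr1; exact: (@smul_gen _ A^o).
move/Hk: Ib'; rewrite -[_ *: _]/(a * b).
apply: (@smul_sub _ A^o) => [|c y Ic _]; first exact: submod_pow.
by apply: (ideal_mull _ (@submod_pow _ _ _)).
Qed.

Lemma gfam_rr xs : {subset xs <= [in I]} -> gfam xs (fun n => rr n).
Proof.
move=> xsI; split=> [n|x n a /xsI /set_mem Ix]; first exact: submod_rr.
exact: rr_mul.
Qed.

End RatliffRushBasics.

Lemma gacc_rr (A : comNzRingType) (I : set A) (xs : seq A) (V : lmodType A)
    (x : A) (z : V) :
  acc_sub [set: V] -> (I : set A^o) = lspan (xs : seq A^o) ->
  I x -> GRing.lreg x -> (forall a : A, a *: z = 0 -> a = 0) ->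
  gacc xs (fun n => rr_closure I n : set A^o) (fun n => ratliff_rush I n V : set A^o).
Proof.
move=> accV IE Ix regx annz.
have [n0 Hn0] := pow_saturation accV IE.
(* The factor x^n0 puts w in I^n0 V, where [pow_saturation] turns a in r(I^n, V) into a w in I^(n +
   n0) V. As x is regular, w still has zero annihilator. *)
pose w := x ^+ n0 *: z.
have Ixn n : ideal_pow I n (x ^+ n).
  elim: n => [|n IH] //; rewrite exprS; exact: (@smul_gen _ A^o).
have Mw : smul (ideal_pow I n0) setT w by exact: smul_gen.
apply: (@gacc_inj _ A^o V (orbit_map w) _ _ _ (fun n => smul (ideal_pow I n) setT)).
- move=> a; rewrite orbit_mapE /w scalerA => /annz E.
  have regn : GRing.lreg (x ^+ n0) by apply: GRing.lregX.
  by apply: (regn (a : A) 0); rewrite mulr0 mulrC.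
- move=> n a [k Hk]; rewrite orbit_mapE.
  apply: (@smul_pow_le _ _ _ n (n + n0)) => //; first exact: leq_addr.
  apply: (Hn0 _ _ _ k); first exact: leq_addl.
    by apply: submodZ => //; exact: submod_smul.
  move=> b Ib; rewrite scalerA mulrC -scalerA -addnA [(n0 + k)%N]addnC.
  apply: (rr_le Hk); first exact: leq_addr.
  exact: pow_mul.
- by apply: gacc_pow => //; rewrite IE.
Qed.

(** * Lengths of quotients by powers of an ideal *)

Section PowerLengths.
Variables (A : comNzRingType) (noethA : noetherian A).

Lemma fin_len_add (V : lmodType A) (K L M : set V) :
  submodule K -> submodule L -> submodule M -> K `<=` L -> L `<=` M ->
  fin_len K L -> fin_len L M -> fin_len K M.
Proof.
move=> HK HL HM KL LM [a Ha] [b Hb]; exists (a + b)%N.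
exact: (@len_le_add _ _ K L M).
Qed.

Variable q : set A.
Hypotheses (Hq : submodule (q : set A^o)) (finq : fin_len (q : set A^o) setT).
Local Notation Q n := (ideal_pow q n : set A^o).

Lemma ideal_powS_sub n : Q n.+1 `<=` Q n.
Proof.
apply: (@smul_sub _ A^o) => [|a y _ Qy]; first exact: submod_pow.
by apply: submodZ => //; exact: submod_pow.
Qed.

Lemma ideal_pow_le n k : (n <= k)%N -> Q k `<=` Q n.
Proof.
elim: k => [|k IH]; first by rewrite leqn0 => /eqP ->; exact: subset_refl.
rewrite leq_eqVlt => /orP[/eqP <-|]; first exact: subset_refl.
by rewrite ltnS => /IH; apply: subset_trans; exact: ideal_powS_sub.
Qed.

Lemma fin_len_pow n : fin_len (Q n) setT.
Proof.
elim: n => [|n IH]; first by exists 0%N; exact: len_le_sub.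
apply: (@fin_len_add _ _ (Q n)) => //; try exact: submod_pow.
  exact: ideal_powS_sub.
have [c Hc] := finq; have [s Es] := ideal_fin_gen noethA (@submod_pow _ q n).
exists (size s * c)%N; apply: (@len_leW _ _ (Q n.+1) (addsub (lspan s) (Q n.+1))) => //.
  by rewrite -Es; apply: addsubl; exact: submod_pow.
apply: (@len_le_gen _ A^o q) => //; first exact: submod_pow.
move=> a v qa vs; have Qv : Q n v by rewrite Es; exact: lspan_mem.
exact: (@smul_gen _ A^o).
Qed.

Lemma len_pow_sum n k : len (Q (n + k)) (Q n) =
  (\sum_(j < k) len (Q (n + j).+1) (Q (n + j)))%N.
Proof.
elim: k => [|k IH].
  rewrite big_ord0 addn0; apply/eqP; rewrite -leqn0.
  by apply: len_leP; [exact: submod_pow|exact: submod_pow| |exact: len_le_sub].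
rewrite big_ord_recr /= -IH addnS [RHS]addnC.
apply: len_add; try exact: submod_pow.
- exact: ideal_powS_sub.
- by apply: ideal_pow_le; exact: leq_addr.
- by apply: fin_lenW (fin_len_pow (n + k).+1).
Qed.

Lemma evpoly_len_pow (xs : seq A) : q = lspan (xs : seq A^o) ->
  evpoly (size xs) (fun n => (len (Q n.+1) (Q n))%:R).
Proof.
move=> qE; have xsq : {subset xs <= [in q]}.
  by move=> x xx; apply/mem_set; rewrite qE; exact: (@lspan_mem _ A^o).
have gQ : gfam xs (fun n => Q n).
  split=> [n|x n v /xsq /set_mem qx Qv]; first exact: submod_pow.
  exact: (@smul_gen _ A^o).
apply: hilbert_serre => //.
- by case: gQ => G1 G2; split=> [n|x n v]; [exact: G1|exact: G2].
- by move=> n; exact: ideal_powS_sub.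
- have qxs : (q : set A^o) `<=` lspan (xs : seq A^o) by rewrite qE.
  apply: (gaccW _ _ (gacc_pow (noetherian_acc noethA) qxs)) => n.
    by move=> _ ->; exact: (submod0 (@submod_pow _ q n.+1)).
  by move=> a Qa; rewrite -[a]mulr1; exact: (@smul_gen _ A^o).
- by move=> n; apply: fin_lenW (fin_len_pow n.+1).
Qed.

(** The exponent is the number of generators; for a regular sequence of length d this will be d. *)
Lemma len_pow_growth (xs : seq A) : q = lspan (xs : seq A^o) -> (0 < size xs)%N ->
  exists C, forall n, (len (Q n) setT <= C * n.+1 ^ size xs)%N.
Proof.
move=> qE xs0; have := evpoly_len_pow qE; rewrite -(prednK xs0).
move=> /evpoly_bound [C HC]; exists C => n.
have := len_pow_sum 0 n; rewrite add0n => ->.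
apply: (@leq_trans (\sum_(j < n) C * n.+1 ^ (size xs).-1)%N).
  apply: leq_sum => j _; apply: leq_trans (HC _) _.
  rewrite leq_mul2l; apply/orP; right; apply: leq_expW.
  exact: (leqW (ltn_ord j)).
rewrite big_const_ord iter_addn_0 expnS -mulnA leq_mul2l [(_ ^ _ * n)%N]mulnC.
by rewrite leq_mul2r leqnSn !orbT.
Qed.

End PowerLengths.

(** * Growth in the Rees algebra *)

Section ReesPrimes.
Variables (A : comNzRingType) (I : set A).
Local Notation R := (fun p : {poly A} => forall n, ideal_pow I n p`_n).

Lemma reesP (p : {poly A}) : (p \in rees_pred I) <-> R p.
Proof. by split=> [/asboolP|H]; last apply/asboolP. Qed.

Lemma rees_polyC c : R c%:P.
Proof.
by move=> [|n] //; rewrite coefC; exact: (submod0 (@submod_pow _ I n.+1)).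
Qed.

Lemma rees_monomial a n : ideal_pow I n a -> R (a *: 'X^n).
Proof.
move=> Ia k; rewrite coefZ coefXn; case: eqP => [->|_]; first by rewrite mulr1.
by rewrite mulr0; exact: (submod0 (@submod_pow _ I k)).
Qed.

Lemma rees_mul p q : R p -> R q -> R (p * q).
Proof.
by move=> /reesP Rp /reesP Rq; apply/reesP; exact: (rpredM (s := rees_pred I)).
Qed.

Lemma rees_exp p n : R p -> R (p ^+ n).
Proof. by move=> /reesP Rp; apply/reesP; exact: (rpredX (S := rees_pred I)). Qed.

Lemma submod_rees : submodule (R : set {poly A}).
Proof.
split; first by move=> n; rewrite coef0; exact: (submod0 (@submod_pow _ I n)).
move=> a p q Rp Rq n; rewrite coefD coefZ.
by case: (@submod_pow _ I n) => _; apply.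
Qed.

(** Primes of the Rees algebra are viewed inside A[t], whose A-module structure is what lengths
    refer to. *)
Definition rees_prime (P : set {poly A}) := [/\ P `<=` R, submodule P,
  forall r p, R r -> P p -> P (r * p), ~ P 1 &
  forall p q, R p -> R q -> P (p * q) -> P p \/ P q].

Lemma rees_prime_val (P : set (rees I)) : prime_ideal P -> rees_prime (val @` P).
Proof.
move=> /prime_idealP[[P0 PD] P1 Pp].
have PM (r p : rees I) : P p -> P (r * p).
  by move=> Pq; have := PD r p 0 Pq P0; rewrite addr0.
have Pval (p : rees I) : (val @` P) (val p) <-> P p.
  by split=> [[q Pq /val_inj <-] //|Pp']; exists p.
have lift p : R p -> exists p' : rees I, val p' = p.
  by move=> /reesP Rp; exists (exist _ p Rp).
split.
- by move=> _ [p Pq <-]; apply/reesP; exact: valP.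
- split; first by exists 0 => //; exact: raddf0.
  move=> c _ _ [p Pq <-] [q Pq' <-]; have [c' Ec] := lift _ (rees_polyC c).
  exists (c' * p + q); first exact: PD.
  by rewrite rmorphD rmorphM /= Ec mul_polyC.
- move=> r _ /lift[r' <-] [p Pq <-]; exists (r' * p); first exact: PM.
  by rewrite rmorphM.
- move=> [p Pq E]; apply: P1; suff -> : 1 = p by [].
  by apply: val_inj; rewrite E rmorph1.
- move=> p q /lift[p' <-] /lift[q' <-].
  by rewrite -rmorphM => /Pval /Pp [] /Pval; [left|right].
Qed.

(** A filtration instead of graded pieces, as the primes of a chain may be inhomogeneous. The
    degrees are below n. *)
Definition rees_le n : set {poly A} := [set p | R p /\ (size p <= n)%N].

Lemma submod_rees_le n : submodule (rees_le n).
Proof.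
split; first by split; [exact: (submod0 submod_rees)|rewrite size_poly0].
move=> a p q [Rp sp] [Rq sq]; split; first by case: submod_rees => _; apply.
apply: leq_trans (size_polyD _ _) _; rewrite geq_max sq andbT.
exact: leq_trans (size_scale_leq _ _) sp.
Qed.

Lemma rees_le_mono n k : (n <= k)%N -> rees_le n `<=` rees_le k.
Proof. by move=> nk p [Rp sp]; split=> //; exact: leq_trans nk. Qed.

Lemma rees_le_exp_mul c n i f v : rees_le c f -> rees_le n v ->
  rees_le (n + i * c) (f ^+ i * v).
Proof.
move=> [Rf sf] [Rv sv]; split; first by apply: rees_mul => //; exact: rees_exp.
elim: i => [|i IH]; first by rewrite expr0 mul1r addn0.
rewrite exprS -mulrA; apply: leq_trans (size_polyMleq _ _) _.
apply: leq_trans (leq_pred _) _; rewrite mulSn addnCA.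
exact: leq_add.
Qed.

Definition rees_growth (e : nat) (P : set {poly A}) :=
  exists C, forall n, len_le (rees_le n `&` P) (rees_le n) (C * n.+1 ^ e).

(** Passing from size n to n + 1 adds the coefficient of t^n, which lies in I^n and counts only
    modulo [ann n]. *)
Lemma rees_growth_base (g : nat -> nat) (ann : nat -> set A^o) (P : set {poly A}) C e :
  rees_prime P -> (forall n, submodule (ann n)) ->
  (forall n, ann n `<=` ideal_pow I n) ->
  (forall n a, ann n a -> P (a *: 'X^n)) ->
  (forall n, len_le (ann n) (ideal_pow I n) (g n)) ->
  (forall n, \sum_(j < n) g j <= C * n.+1 ^ e)%N -> rees_growth e P.
Proof.
move=> [PR HP _ _ _] Hann annI annP lann gC; exists C => n.
apply: len_le_leq (gC n) _; elim: n {gC} => [|n IH].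
  rewrite big_ord0; apply: len_le_sub => p [Rp]; rewrite leqn0 size_poly_eq0.
  move=> /eqP ->; split; last exact: submod0.
  by split; [exact: (submod0 submod_rees)|rewrite size_poly0].
rewrite big_ord_recr /=.
have HWP k : submodule (rees_le k `&` P).
  by apply: submodI => //; exact: submod_rees_le.
have Wn := rees_le_mono (leqnSn n).
pose X := addsub (rees_le n.+1 `&` P) (rees_le n).
have XW : X `<=` rees_le n.+1.
  by apply: addsub_sub; [exact: submod_rees_le|move=> p []|exact: Wn].
have HX : submodule X by apply: submod_add => //; exact: submod_rees_le.
apply: (@len_le_add _ _ _ X) => //; first exact: submod_rees_le.
- by apply: addsubl; exact: submod_rees_le.
- apply: (@len_le_surj _ _ _ idfun) IH; first exact: submod_rees_le.
  + by move=> p [].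
  + by move=> p [Wp Pq]; split=> //; exact: Wn.
  + by move=> _ [p [q [Wp Wq ->]]]; exists q => //; rewrite addrK.
apply: (@len_le_surj _ A^o {poly A} (orbit_map 'X^n) (ann n) (ideal_pow I n)) => //.
- exact: submod_pow.
- move=> a anna; apply: addsubl; first exact: submod_rees_le.
  split; last exact: annP.
  split; first by apply: rees_monomial; exact: annI.
  by apply: leq_trans (size_scale_leq _ _) _; rewrite size_polyXn.
move=> p [Rp sp]; exists p`_n; first exact: Rp.
apply: addsubr => //; split.
  by apply: (submodB submod_rees) => //; exact: rees_monomial.
apply/leq_sizeP => j; rewrite coefB orbit_mapE coefZ coefXn leq_eqVlt.
case/orP => [/eqP <-|nj]; first by rewrite eqxx mulr1 subrr.
rewrite gtn_eqF // mulr0 subr0; apply: nth_default.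
exact: leq_trans nj.
Qed.

(* For f in Q outside P, the subspaces f ^+ i * rees_le n, i <= n, contribute
   independently to the growth of rees_le modulo P, each at least as much as
   rees_le n modulo Q. *)
Lemma rees_growth_step e (P Q : set {poly A}) :
  rees_prime P -> rees_prime Q -> P `<` Q -> rees_growth e P ->
  exists C, forall n l S, chain_in (rees_le n `&` Q) (rees_le n) l S ->
    (n.+1 * l <= C * n.+1 ^ e)%N.
Proof.
move=> [PR HP PM P1 Pp] [QR HQ QM Q1 Qp] [PQ nQP] [C HC].
have [f Qf nPf] : exists2 f, Q f & ~ P f.
  apply: contrapT => H; apply: nQP => p Qq; apply: contrapT => nPp.
  by apply: H; exists p.
have Rf := QR _ Qf; pose c := size f.
have nPfi i : ~ P (f ^+ i).
  elim: i => [|i IH]; first by rewrite expr0.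
  by rewrite exprS => /Pp []//; exact: rees_exp.
(* N bounds the size of f^i r for i <= n and r of size at most n; N + 1 <= (n + 1)(c + 1) gives the
   constant. *)
exists (C * c.+1 ^ e)%N => n l S cS; pose N := (n + n * c)%N.
pose Z i : set {poly A} := [set p | exists2 r, R r & P (p - f ^+ i * r)].
have HZ i : submodule (Z i).
  split.
    exists 0; first exact: (submod0 submod_rees).
    by rewrite mulr0 subr0; exact: submod0.
  move=> a p q [r Rr Pr] [s Rs Ps]; exists (a *: r + s).
    by case: submod_rees => _; apply.
  rewrite mulrDr -scalerAr opprD addrACA -scalerBr.
  by case: HP => _; apply.
have PZ i : P `<=` Z i.
  by move=> p Pq; exists 0; [exact: (submod0 submod_rees)|rewrite mulr0 subr0].
have ZS i : Z i.+1 `<=` Z i.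
  move=> p [r Rr Pr]; exists (f * r); first exact: rees_mul.
  by rewrite mulrA -exprSr.
pose X i := Z i `&` rees_le N.
have HX i : submodule (X i) by apply: submodI => //; exact: submod_rees_le.
(* Z i is P + f^i R. Multiplication by f^i transports the chain above Q into the layer between
   [X i.+1] and [X i]; the n + 1 layers are then stacked. *)
have step i : (i <= n)%N -> exists T, chain_in (X i.+1) (X i) l T.
  move=> i_n; have fX v : rees_le n v -> X i (f ^+ i * v).
    move=> Wv; split.
      by case: Wv => Rv _; exists v; rewrite ?subrr //; exact: submod0.
    have := @rees_le_exp_mul c n i f v (conj Rf (leqnn _)) Wv.
    by apply: rees_le_mono; rewrite leq_add2l leq_mul2r i_n orbT.
  have lin : linear (fun v : {poly A} => f ^+ i * v).
    by move=> a u v; rewrite mulrDr scalerAr.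
  case: cS => HS HS'.
  exists (fun j => addsub (X i.+1) (lin_of lin @` S j)); split=> j jl.
    have [HSj QS SW] := HS j jl; split.
    - by apply: submod_add => //; exact: submod_image.
    - by apply: addsubl; exact: submod_image.
    - apply: addsub_sub => //; first by move=> p [/ZS].
      by move=> _ [v /SW Wv <-]; exact: fX.
  have [HSj QS SW] := HS j (ltnW jl); have [HSj' QS' SW'] := HS j.+1 jl.
  have [SS nSS] := HS' j jl; split.
    by apply: addsubS => // _ [v /SS Sv <-]; exists v.
  move=> H; apply: nSS => v Sv.
  have [|p [_ [[[r Rr Pr] _] [w Sw <-] /= E]]] := H (f ^+ i * v).
    by apply: addsubr => //; exists v.
  have [Rv sv] := SW' _ Sv; have [Rw sw] := SW _ Sw.
  have Rvw : R (v - w) by exact: (submodB submod_rees).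
  have Rfr : R (f * r) by exact: rees_mul.
  (* Since f^i is outside the prime P it cancels, and v - w lies in P + f R, which is inside Q. *)
  have Pvw : P (v - w - f * r).
    have : P (f ^+ i * (v - w - f * r)).
      rewrite 2!mulrBr mulrA -exprSr; suff -> : f ^+ i * v - f ^+ i * w = p by [].
      by rewrite E addrK.
    case/Pp => //; first exact: rees_exp.
      exact: (submodB submod_rees).
    by move/nPfi.
  have Qvw : Q (v - w).
    rewrite -(subrK (f * r) (v - w)); apply: submodD => //; first exact: PQ.
    by rewrite mulrC; exact: QM.
  rewrite -(subrK w v); apply: submodD => //; apply: QS.
  by split=> //; apply: (submodB (submod_rees_le n)); [exact: SW'|exact: SW].
have chains i : (i <= n.+1)%N -> exists T, chain_in (X i) (rees_le N) (i * l) T.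
  elim: i => [_|i IH i_n].
    exists (fun=> X 0%N); rewrite mul0n; apply: chain_widen (chain0 (HX 0%N)) => //.
    by move=> p [].
  have [T cT] := step i i_n; have [U cU] := IH (ltnW i_n).
  rewrite mulSn; apply: chain_cat cT cU; last by move=> p [].
  by move=> p [/ZS ? ?].
have [T cT] := chains n.+1 (leqnn _).
have /HC : chain_in (rees_le N `&` P) (rees_le N) (n.+1 * l) T.
  by apply: chain_widen cT => // p [Wp /PZ].
move=> /leq_trans; apply; rewrite -mulnA leq_mul2l -expnMn; apply/orP; right.
by apply: leq_expW; rewrite /N; nia.
Qed.

(** Dividing the bound of [rees_growth_step] by n + 1 lowers the order by one at each inclusion;
    order 0 leaves no room for the last one. *)
Lemma rees_growth_chain e (P : nat -> set {poly A}) :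
  (forall i, (i <= e.+1)%N -> rees_prime (P i)) ->
  (forall i, (i < e.+1)%N -> P i `<` P i.+1) ->
  ~ rees_growth e (P 0%N).
Proof.
elim: e P => [|e IH] P HP PP gP.
  have Q := HP 1%N isT; have [C HC] := rees_growth_step (HP 0%N isT) Q (PP 0%N isT) gP.
  (* As 1 is outside the larger prime, there is a step already in size C + 1; the bound then reads C
     + 2 <= C. *)
  have [S cS] : exists S, chain_in (rees_le C.+1 `&` P 1%N) (rees_le C.+1) 1 S.
    case: Q => QR HQ _ Q1 _.
    have HW := submod_rees_le C.+1.
    apply: (chain_extend HW _ _ (chain0 (submodI HW HQ))) => //.
    split=> [p []//|/(_ 1)[|//]]; split; first exact: rees_polyC.
    by rewrite size_poly1.
  by have := HC _ _ _ cS; rewrite muln1 expn0 muln1; lia.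
apply: (IH (fun i => P i.+1)) => [i ie|i ie|]; [exact: HP|exact: PP|].
have [C HC] := rees_growth_step (HP 0%N isT) (HP 1%N isT) (PP 0%N isT) gP.
by exists C => n l S /HC; rewrite expnS mulnCA leq_mul2l => /orP[].
Qed.

End ReesPrimes.

(** * Growth of the Ratliff-Rush quotients *)

Lemma evpolyD k f g : evpoly k f -> evpoly k g -> evpoly k (fun n => f n + g n).
Proof.
move=> [P [sP [n0 HP]]] [Q [sQ [n1 HQ]]]; exists (P + Q); split.
  by apply: leq_trans (size_polyD _ _) _; rewrite geq_max sP sQ.
exists (maxn n0 n1) => n; rewrite geq_max => /andP[/HP -> /HQ ->].
by rewrite hornerD.
Qed.

Lemma evpoly_ext k f g : f =1 g -> evpoly k f -> evpoly k g.
Proof.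
move=> fg [P [sP [n0 HP]]]; exists P; split=> //.
by exists n0 => n; rewrite -fg; exact: HP.
Qed.

Lemma evpoly_addn k (f : nat -> rat) j : evpoly k f -> evpoly k (fun n => f (n + j)%N).
Proof.
move=> Hf; elim: j => [|j IH]; first by apply: evpoly_ext Hf => n; rewrite addn0.
by apply: evpoly_ext (evpoly_shift IH) => n; rewrite addSnnS.
Qed.

Section RatliffRushGrowth.
Variables (A : comNzRingType) (m : set A) (V : lmodType A) (x : A) (z : V).
Hypotheses (noethA : noetherian A) (localm : is_local m) (fgV : fin_gen V).
Hypotheses (mx : m x) (regx : GRing.lreg x).
Hypothesis annz : forall a : A, a *: z = 0 -> a = 0.
Variables (ys : seq A).
Hypotheses (ys_gt0 : (0 < size ys)%N) (ysm : lspan (ys : seq A^o) `<=` m).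
Hypothesis finys : fin_len (lspan (ys : seq A^o)) setT.
Local Notation d := (size ys).
Local Notation Q n := (ideal_pow m n : set A^o).
Local Notation T n := (rr_closure m n : set A^o).
Local Notation S n := (ratliff_rush m n V : set A^o).

Let Hm : submodule (m : set A^o). Proof. exact: local_submod. Qed.
Let HT n : submodule (T n). Proof. exact: submod_rr. Qed.
Let HS n : submodule (S n). Proof. exact: submod_rr. Qed.
Let TS n : T n `<=` S n. Proof. exact: rr_closure_sub. Qed.
Let QT n : Q n `<=` T n. Proof. exact: pow_sub_rr. Qed.
Let finm : fin_len (m : set A^o) setT.
Proof. by exists 1%N; exact: len_le_local. Qed.
Let finQ n : fin_len (Q n) setT. Proof. exact: fin_len_pow. Qed.

Lemma fin_len_rr n : fin_len (T n) (S n).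
Proof. exact: fin_lenW (finQ n). Qed.

Definition rr_length n : nat := len (T n) (S n).

(** Hilbert-Serre for m only bounds the degree by the number of generators of m. The d generators of
    (ys), an ideal inside m, give A / m^n length of order n^d, hence layers of order n^(d-1). *)
Lemma len_local_pow_growth :
  exists C, forall n, (len (Q n.+1) (Q n) <= C * n.+1 ^ d.-1)%N.
Proof.
apply: evpoly_bound; rewrite prednK //.
have Hq := submod_lspan (ys : seq A^o).
have [xs Exs] := ideal_fin_gen noethA Hm.
have [C HC] := len_pow_growth noethA Hq finys erefl ys_gt0.
apply: (evpoly_sum_growth (C := C) (evpoly_len_pow noethA Hm finm Exs)) => n.
have := len_pow_sum noethA Hm finm 0 n; rewrite add0n => <-.
apply: leq_trans (HC n).
have sub : ideal_pow (lspan (ys : seq A^o)) n `<=` Q n.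
  elim: n => [|n IH]; first exact: subset_refl.
  exact: (@smulS _ A^o).
apply: len_leP => //; try exact: submod_pow.
apply: (@len_leW _ _ (ideal_pow (lspan (ys : seq A^o)) n) setT) => //.
have [] // := lenP (@submod_pow _ (lspan (ys : seq A^o)) n) (@submodT _ A^o).
exact: (fin_len_pow noethA Hq finys).
Qed.

Lemma local_gens : exists xs : seq A,
  [/\ (m : set A^o) = lspan (xs : seq A^o),
      gfam xs (fun n => S n), gfam xs (fun n => T n) &
      gacc xs (fun n => T n) (fun n => S n)].
Proof.
have [xs Exs] := ideal_fin_gen noethA Hm.
have xsm : {subset xs <= [in m]}.
  by move=> y yxs; apply/mem_set; rewrite Exs; exact: (@lspan_mem _ A^o).
exists xs; split=> //; [exact: gfam_rr|exact: gfam_rr|].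
apply: (gacc_rr (x := x) (z := z)) => //; exact: fin_gen_acc.
Qed.

Lemma rr_bounded_generation : exists c, forall n,
  S (n + c)%N `<=` addsub (T (n + c)%N) (smul (ideal_pow m n) (S c)).
Proof.
have [xs [Exs gS gT aTS]] := local_gens.
exact: (bounded_generation Exs gS gT).
Qed.

Lemma evpoly_rr_length : evpoly d (fun n => (rr_length n)%:R).
Proof.
have [xs [Exs gS gT aTS]] := local_gens.
have [c Hc] := rr_bounded_generation.
have [C HC] := len_local_pow_growth.
have Hp := hilbert_serre gT gS TS aTS fin_len_rr.
(* S n lies in T n + m^(n-c), so its length over T n is at most that of m^(n-c) / m^n, which has c
   layers: hence [c * C]. *)
rewrite -(prednK ys_gt0); apply: (evpoly_growth (C := c * C) (n0 := c) Hp) => n cn.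
apply: (@leq_trans (len (Q (n - c + c)%N) (Q (n - c)%N))).
  have HQ k := @submod_pow _ m k.
  apply: len_leP => //.
  have QQ : Q (n - c + c)%N `<=` Q (n - c)%N.
    by apply: ideal_pow_le => //; exact: leq_addr.
  apply: (@len_le_surj _ _ A^o idfun (Q (n - c + c)%N) (Q (n - c)%N)) => //.
  - by rewrite subnK // => a; exact: QT.
  - move=> a; rewrite -{1}(subnK cn) => /Hc [t [u [Tt Iu ->]]].
    exists u; last by rewrite addrK -(subnK cn).
    move: u Iu; apply: smul_sub => // b v Qb _.
    exact: (ideal_mull _ (HQ _)).
  - have fQ : fin_len (Q (n - c + c)%N) (Q (n - c)%N).
      by apply: fin_lenW (finQ (n - c + c)%N).
    by have [] := lenP (HQ _) (HQ _) QQ fQ.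
rewrite (len_pow_sum noethA Hm finm).
apply: (@leq_trans (\sum_(j < c) C * n.+1 ^ d.-1)%N).
  apply: leq_sum => j _; apply: leq_trans (HC _) _.
  rewrite leq_mul2l; apply/orP; right; apply: leq_expW.
  rewrite ltnS -[X in (_ <= X)%N](subnK cn) leq_add2l; exact: ltnW.
by rewrite big_const_ord iter_addn_0 mulnC mulnA.
Qed.

(** S is generated modulo T in degrees up to c, so annihilation of S / T is tested on the finitely
    many ideal generators of those components. *)
Lemma rr_generators : exists gens : seq (nat * A),
  (forall p, p \in gens -> S p.1 p.2) /\
  forall n a, Q n a -> (forall p, p \in gens -> T (n + p.1)%N (a * p.2)) ->
    forall j b, S j b -> T (n + j)%N (a * b).
Proof.
have [xs [Exs gS gT aTS]] := local_gens.
have [c Hc] := rr_bounded_generation.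
have /choice[s Hs] : forall j, exists s : seq A^o, S j = lspan s.
  by move=> j; exact: ideal_fin_gen.
have Hss j b : b \in s j -> S j b by rewrite Hs; exact: lspan_mem.
have mxs : (m : set A^o) `<=` lspan (xs : seq A^o) by rewrite Exs.
exists [seq (j, b) | j <- iota 0 c.+1, b <- s j]; split.
  by move=> _ /allpairsPdep [j [b [_ bs ->]]]; exact: Hss.
move=> n a Qa Ha j.
have step i : (i <= c)%N -> forall b, S i b -> T (n + i)%N (a * b).
  move=> ic; rewrite Hs.
  pose X : set A^o := homothety A^o a @^-1` T (n + i)%N.
  apply: (@lspan_sub _ A^o (s i) X); first exact: submod_preim.
  move=> b bs; apply: (Ha (i, b)); apply/allpairsPdep; exists i, b; split=> //.
  by rewrite mem_iota add0n ltnS.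
have Tpow k i b t : Q k b -> T i t -> T (k + i)%N (b * t).
  move=> Qb Tt; apply: (gfam_smul_pow gT mxs).
  exact: (@smul_gen _ A^o).
have [/step //|cj] := leqP j c.
move=> b; rewrite -{1}(subnK (ltnW cj)) => /Hc [t [u [Tt Iu ->]]].
rewrite mulrDr; apply: submodD => //.
  by apply: Tpow => //; rewrite subnK // in Tt; exact: ltnW.
pose X : set A^o := homothety A^o a @^-1` T (n + j)%N.
move: u Iu; apply: (@smul_sub _ A^o _ _ X); first exact: submod_preim.
move=> p v Qp Sv; rewrite /X /= -[a *: _]/(a * (p * v)) mulrCA.
rewrite -(subnK (ltnW cj)) addnCA; apply: Tpow => //.
exact: step.
Qed.

Definition rr_ann n : set A^o := [set a : A^o | Q n a /\
  forall j b, S j b -> T (n + j)%N ((a : A) * b)].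

Lemma submod_rr_ann n : submodule (rr_ann n).
Proof.
split.
  split; first exact: (submod0 (@submod_pow _ m n)).
  by move=> j b _; rewrite mul0r; exact: (submod0 (HT (n + j)%N)).
move=> c u v [Qu Hu] [Qv Hv]; split; first by case: (@submod_pow _ m n) => _; apply.
move=> j b Sb; rewrite mulrDl -[c *: u]/(c * u) -mulrA.
by case: (HT (n + j)%N) => _; apply; [apply: Hu|apply: Hv].
Qed.

(** Multiplication by the generators embeds m^n / [rr_ann n] in a product of quotients S / T; the
    product is unrolled by imposing one generator at a time. *)
Lemma len_le_rr_ann : exists gens : seq nat, forall n,
  len_le (rr_ann n) (Q n) (\sum_(e <- gens) rr_length (n + e)).
Proof.
have [gens [gensS Hgens]] := rr_generators.
exists (map fst gens) => n.
have HQ := @submod_pow _ m n.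
pose X (l : seq (nat * A)) : set A^o :=
  [set a : A^o | Q n a /\ forall p, p \in l -> T (n + p.1)%N ((a : A) * p.2)].
have HX l : submodule (X l).
  split.
    split; first exact: submod0.
    by move=> p _; rewrite mul0r; exact: (submod0 (HT (n + p.1)%N)).
  move=> c u v [Qu Hu] [Qv Hv]; split; first by case: HQ => _; apply.
  move=> p pl; rewrite mulrDl -[c *: u]/(c * u) -mulrA.
  by case: (HT (n + p.1)%N) => _; apply; [apply: Hu|apply: Hv].
have Xann : X gens `<=` rr_ann n.
  by move=> a [Qa Ha]; split=> // j b; exact: Hgens.
apply: (len_leW Xann (@subset_refl _ _)) => {Xann}.
rewrite big_map; elim: gens gensS {Hgens} => [|p l IH] gensS.
  by rewrite big_nil; apply: len_le_sub => a Qa; split.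
have sub q : q \in l -> q \in p :: l by move=> ql; rewrite inE ql orbT.
rewrite big_cons; apply: (@len_le_add _ _ _ (X l)) => //.
- by move=> a [Qa Ha]; split=> // q /sub; exact: Ha.
- by move=> a [].
- have Sp : S p.1 p.2 by apply: gensS; exact: mem_head.
  have [xs [Exs gS gT aTS]] := local_gens.
  have mxs : (m : set A^o) `<=` lspan (xs : seq A^o) by rewrite Exs.
  apply: (@len_le_inj _ A^o A^o (homothety A^o p.2) _ _
    (T (n + p.1)%N) (S (n + p.1)%N)) => //.
  + move=> a [Qa _]; rewrite homothetyE -[_ *: _]/(p.2 * a) mulrC.
    by apply: (gfam_smul_pow gS mxs); exact: (@smul_gen _ A^o).
  + move=> a [Qa Ha]; rewrite homothetyE -[_ *: _]/(p.2 * a) mulrC => Tpa.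
    by split=> // q; rewrite inE => /orP[/eqP ->|/Ha].
  + by have [] := lenP (HT _) (HS _) (@TS (n + p.1)) (fin_len_rr (n + p.1)).
- by apply: IH => q /sub; exact: gensS.
Qed.

(** [evpoly d.-1] stands for degree at most d - 2. After summation the quotient by the first prime
    would have growth of order at most d - 1, too small for d strict inclusions. *)
Lemma rr_length_growth (omega : lmodType A) (P : nat -> set (rees m)) :
  (forall n, ratliff_rush m n omega `<=` S n) ->
  prime_chain_over (@rr_quotient_annihilator A m omega) d P ->
  ~ evpoly d.-1 (fun n => (rr_length n)%:R).
Proof.
move=> omegaS [HP PP] Hl.
have [gens Hgens] := len_le_rr_ann.
pose g n := (\sum_(e <- gens) rr_length (n + e))%N.
have Hg : evpoly d.-1 (fun n => (g n)%:R).
  rewrite /g; elim: (gens) => [|e l IH].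
    apply: (evpolyW (leq0n _)); apply: evpoly_eventually0; exists 0%N => n _.
    by rewrite big_nil.
  apply: (evpoly_ext _ (evpolyD (evpoly_addn e Hl) IH)) => n.
  by rewrite big_cons natrD.
have [C HC] : exists C, forall n, (\sum_(j < n) g j <= C * n.+1 ^ d.-1)%N.
  apply: evpoly_bound; apply: evpoly_diff; apply: (evpoly_ext _ Hg) => n.
  by rewrite big_ord_recr /= natrD addrC addKr.
have prP i : (i <= d)%N -> rees_prime m (val @` P i).
  by move=> /HP [Pi _]; exact: rees_prime_val.
pose PV i := val @` P i.
apply: (@rees_growth_chain _ m d.-1 PV); first by rewrite prednK.
  rewrite prednK // => i /PP [PS nPS]; split; first by move=> _ [p /PS ? <-]; exists p.
  move=> H; apply: nPS => p Pp; have [|q Pq /val_inj <- //] := H (val p).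
  by exists p.
apply: (@rees_growth_base _ m g rr_ann _ C _ (prP 0%N isT)) => //.
- exact: submod_rr_ann.
- by move=> n a [].
(* What kills S / T also kills the smaller quotient attached to [omega], so it lies in the
   annihilator and in [P 0]. *)
move=> n a [Qa Ha]; have [_ annP] := HP 0%N isT.
have /reesP Rp := rees_monomial Qa.
exists (exist _ (a *: 'X^n) Rp) => //; apply: annP => q Sq k.
rewrite /= -scalerAl coefZ coefXnM.
case: ltnP => [_|nk]; first by rewrite mulr0; exact: (submod0 (HT k)).
by rewrite -{1}(subnKC nk); apply: Ha; apply: omegaS; exact: Sq.
Qed.

End RatliffRushGrowth.

(** * Regular sequences *)

Section SequenceSubmodules.
Variables (A : comNzRingType) (V : lmodType A).
Implicit Types (s : seq A).

Definition seq_smul s : set V := smul [set` s] setT.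

Lemma submod_seq_smul s : submodule (seq_smul s).
Proof. exact: submod_smul. Qed.

Lemma seq_smul_nil : seq_smul [::] = [set 0].
Proof.
apply/seteqP; split=> [|_ ->]; last exact: smul0.
by apply: smul_sub => //; exact: submod_zero.
Qed.

Lemma seq_smul_rcons s x v :
  seq_smul (rcons s x) v <-> exists w y, seq_smul s w /\ v = w + x *: y.
Proof.
split; last first.
  move=> [w [y [Hw ->]]]; apply: (submodD (submod_seq_smul _)).
    by move: w Hw; apply: smulS => // a /= ax; rewrite mem_rcons inE ax orbT.
  by apply: smul_gen => //=; rewrite mem_rcons mem_head.
apply: (@smul_sub _ _ _ _ (fun v => exists w y, seq_smul s w /\ v = w + x *: y)).
  split; first by exists 0, 0; split; [exact: smul0|rewrite scaler0 addr0].
  move=> a _ _ [w [y [Hw ->]]] [w' [y' [Hw' ->]]].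
  exists (a *: w + w'), (a *: y + y'); split.
    by case: (submod_seq_smul s) => _; apply.
  by rewrite !scalerDr !scalerA [a * x]mulrC addrACA.
move=> a y /=; rewrite mem_rcons inE => /orP[/eqP ->|as_] _.
  by exists 0, y; split; [exact: smul0|rewrite add0r].
by exists (a *: y), 0; split; [exact: smul_gen|rewrite scaler0 addr0].
Qed.

End SequenceSubmodules.
Arguments seq_smul {A} V s.

Lemma seq_smul_lspan (A : comNzRingType) (s : seq A) :
  seq_smul A^o s = lspan (s : seq A^o).
Proof.
apply/seteqP; split; apply: (@smul_sub _ A^o).
- exact: submod_lspan.
- move=> a y /= xs _; rewrite -[_ *: _]/(a * y) mulrC.
  by apply: (submodZ y (submod_lspan (s : seq A^o))); exact: (@lspan_mem _ A^o).
- exact: submod_seq_smul.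
- by move=> a y _ /= ys; rewrite -[_ *: _]/(a * y) mulrC; exact: (@smul_gen _ A^o).
Qed.

Section PrimeChains.
Variables (A : comNzRingType).

Definition prime_chain_to (n : nat) (P : set A) := exists c : nat -> set A,
  [/\ forall i, (i <= n)%N -> prime_ideal (c i),
      forall i, (i < n)%N -> c i `<` c i.+1 & c n = P].

Lemma prime_chain_to0 P : prime_ideal P -> prime_chain_to 0 P.
Proof. by exists (fun=> P). Qed.

Lemma prime_chain_toS n P P' :
  prime_chain_to n P -> prime_ideal P' -> P `<` P' -> prime_chain_to n.+1 P'.
Proof.
move=> [c [c1 c2 cP]] pP' PP'; exists (fun i => if (i <= n)%N then c i else P').
split=> [i _|i lin|]; last by rewrite ltnn.
  by case: leqP => // /c1.
case: (ltnP i n) => [ni|ni]; first by rewrite (ltnW ni); exact: c2.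
have -> : i = n by apply/eqP; rewrite eqn_leq ni -ltnS lin.
by rewrite leqnn cP.
Qed.

Lemma prime_chain_le d n P : krull_dim A d -> prime_chain_to n P -> (n <= d)%N.
Proof.
move=> [_ H] [c [c1 c2 _]]; apply: (H n c); split=> // i /c1 pc; split=> //.
by move=> _ ->; exact: (submod0 (prime_sub pc)).
Qed.

End PrimeChains.

Section RegularSequences.
Variables (A : comNzRingType) (m : set A) (d : nat).
Hypotheses (noethA : noetherian A) (localm : is_local m) (dimA : krull_dim A d).

Lemma regular_seqE (V : lmodType A) (s : seq A) i (v : V) :
  (i < size s)%N -> seq_smul V (take i.+1 s) v <->
    exists w y, seq_smul V (take i s) w /\ v = w + s`_i *: y.
Proof. by move=> si; rewrite (take_nth 0 si); exact: seq_smul_rcons. Qed.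

Lemma seq_smul_takeS (V : lmodType A) (s : seq A) i :
  (i < size s)%N -> seq_smul V (take i s) `<=` seq_smul V (take i.+1 s).
Proof.
by move=> si v Hv; apply/(regular_seqE _ si); exists v, 0; rewrite scaler0 addr0.
Qed.

(** As x is regular modulo the earlier elements, the products x^n a with a outside P avoid their
    ideal. A prime over that ideal avoiding them lies in P and misses x. *)
Lemma regular_prime_descent (s : seq A) i (P : set A) :
  regular_sequence m A^o s -> (i < size s)%N -> prime_ideal P ->
  seq_smul A^o (take i.+1 s) `<=` P ->
  exists P' : set A, [/\ prime_ideal P', seq_smul A^o (take i s) `<=` P' & P' `<` P].
Proof.
move=> [_ reg _] si pP YP; set x := s`_i.
pose W : set A := [set w | exists a n, ~ P a /\ w = x ^+ n * a].
have [||||P' [pP' YP' P'W]] := @prime_disjoint _ noethA W (seq_smul A^o (take i s)).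
- by exists 1, 0%N; split; [exact: prime_1|rewrite mul1r].
- move=> _ _ [a [n [na ->]]] [b [k [nb ->]]]; exists (a * b), (n + k)%N.
  by split; [case/(prime_mul pP)|rewrite exprD mulrACA].
- exact: submod_seq_smul.
- move=> w Yw [a [n [na wE]]]; apply: na; apply: YP; apply: (seq_smul_takeS si).
  move: Yw; rewrite wE {w wE}; elim: n => [|n IH]; first by rewrite mul1r.
  by rewrite exprS -mulrA => /(reg i _ si); exact: IH.
exists P'; split=> //; split.
  move=> a P'a; apply: contrapT => nPa; apply: (P'W a P'a).
  by exists a, 0%N; rewrite mul1r.
move=> PP'; apply: (P'W x).
  apply: PP'; apply: YP; apply/(regular_seqE _ si); exists 0, 1.
  by split; [exact: smul0|rewrite add0r -[_ *: _]/(x * 1) mulr1].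
by exists 1, 1%N; split; [exact: prime_1|rewrite mulr1].
Qed.

Lemma regular_prime_chain (s : seq A) i (P : set A) :
  regular_sequence m A^o s -> (i <= size s)%N -> prime_ideal P ->
  seq_smul A^o (take i s) `<=` P -> prime_chain_to i P.
Proof.
move=> reg; elim: i P => [|i IH] P si pP YP; first exact: prime_chain_to0.
have [P' [pP' YP' P'P]] := regular_prime_descent reg si pP YP.
by apply: (prime_chain_toS (IH P' (ltnW si) pP' YP')).
Qed.

(** Descent along s gives a chain of length d ending at P; a strict inclusion in m would prolong it
    beyond the dimension. *)
Lemma parameter_prime (s : seq A) (P : set A) :
  regular_sequence m A^o s -> size s = d -> prime_ideal P ->
  seq_smul A^o s `<=` P -> P = m.
Proof.
move=> reg sd pP YP; apply: contrapT => nPm.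
have Pm : P `<=` m by apply: (local_sub noethA localm (prime_sub pP)); exact: prime_1.
have cP : prime_chain_to d P.
  by apply: (@regular_prime_chain s) => //; rewrite -?sd // take_size.
suff /(prime_chain_le dimA) : prime_chain_to d.+1 m by rewrite ltnn.
apply: prime_chain_toS cP _ _; first exact: local_prime.
by split=> // mP; apply: nPm; apply/seteqP.
Qed.

Lemma ideal_pow_mem_mul (I : set A^o) (a b : A) t u :
  submodule I ->
  ideal_pow m t `<=` adjoin I a -> ideal_pow m u `<=` adjoin I b -> I (a * b) ->
  ideal_pow m (t + u) `<=` I.
Proof.
move=> HI ta ub Iab c.
have -> : ideal_pow m (t + u) = smul (ideal_pow m t) (ideal_pow m u : set A^o).
  have E n : smul (ideal_pow m n) (setT : set A^o) = ideal_pow m n.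
    apply/seteqP; split.
      apply: (@smul_sub _ A^o) => [|e y Ie _]; first exact: submod_pow.
      by apply: (ideal_mull _ (@submod_pow _ _ _)).
    by move=> e Ie; rewrite -[e]mulr1; exact: (@smul_gen _ A^o).
  by rewrite -E smul_powD // E.
move: c; apply: (@smul_sub _ A^o) => // e f /ta [c [i [Ii ->]]] /ub [c' [i' [Ii' ->]]].
rewrite -[_ *: (_ + _)]/((c * a + i) * (c' * b + i')).
rewrite mulrDl; apply: (submodD HI); last exact: (ideal_mull _ HI).
rewrite mulrDr; apply: (submodD HI); last exact: (ideal_mulr _ HI).
by rewrite mulrACA; exact: (ideal_mulr _ HI).
Qed.

(** Noetherian induction over the ideals containing (s): a prime one is m, and if ab is in I, powers
    of m inside I + (a) and I + (b) multiply into I. *)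
Lemma parameter_pow (s : seq A) : regular_sequence m A^o s -> size s = d ->
  exists t, ideal_pow m t `<=` seq_smul A^o s.
Proof.
move=> reg sd.
suff H : forall I : set A^o, submodule I -> seq_smul A^o s `<=` I ->
    exists t, ideal_pow m t `<=` I.
  by apply: (H _ (@submod_seq_smul _ _ s)); exact: subset_refl.
apply: (acc_ind (noetherian_acc noethA)) => I HI IH YI.
have [I1|nI1] := pselect (I 1).
  by exists 0%N => x _; rewrite -[x]mulr1; exact: (ideal_mulr _ HI).
have [pI|[a [b [Iab na nb]]]] := prime_or_factor HI nI1.
  rewrite (parameter_prime reg sd pI YI); exists 1%N.
  apply: (@smul_sub _ A^o); first exact: local_submod.
  by move=> a y ma _; exact: (ideal_mull _ (local_submod localm)).
have Ysub c : seq_smul A^o s `<=` adjoin I c.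
  exact: subset_trans YI (@adjoin_sub _ _ _ _).
have [t ta] := IH _ (@submod_adjoin _ A^o I a HI) (adjoin_proper HI na) (Ysub a).
have [u ub] := IH _ (@submod_adjoin _ A^o I b HI) (adjoin_proper HI nb) (Ysub b).
exists (t + u)%N; have := ideal_pow_mem_mul HI ta ub Iab; apply.
Qed.

Lemma seq_smul_local (s : seq A) : regular_sequence m A^o s -> seq_smul A^o s `<=` m.
Proof.
move=> [sm _ _]; apply: (@smul_sub _ A^o); first exact: local_submod.
by move=> a y /= /sm ma _; exact: (ideal_mull _ (local_submod localm)).
Qed.

Lemma parameter_fin_len (s : seq A) : regular_sequence m A^o s -> size s = d ->
  fin_len (seq_smul A^o s) setT.
Proof.
move=> reg sd; have [t tY] := parameter_pow reg sd.
have finm : fin_len (m : set A^o) setT by exists 1%N; exact: len_le_local.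
apply: (@fin_lenW _ A^o (ideal_pow m t) setT) => //.
exact: (fin_len_pow noethA (local_submod localm) finm).
Qed.

(** The last power of m not inside (s) provides the element. It embeds A / m in A / (s), which gives
    access to Ext of the residue field. *)
Lemma parameter_socle (s : seq A) : regular_sequence m A^o s -> size s = d ->
  exists a : A, ~ seq_smul A^o s a /\ forall b, m b -> seq_smul A^o s (b * a).
Proof.
move=> reg sd; have ex := parameter_pow reg sd.
have n1 : ~ seq_smul A^o s 1 by move=> /(seq_smul_local reg); exact: local_1.
apply: contrapT => H.
suff : forall t, ~ (ideal_pow m t `<=` seq_smul A^o s).
  by case: ex => t tY /(_ t).
elim=> [|t IH]; first by move=> /(_ 1 I).
move=> tY; apply: H.
have [a [ta na]] : exists a, ideal_pow m t a /\ ~ seq_smul A^o s a.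
  apply: contrapT => H; apply: IH => a ta; apply: contrapT => na.
  by apply: H; exists a.
exists a; split=> // b mb; apply: tY; exact: (@smul_gen _ A^o).
Qed.

(* Chains of associated primes of V / (s_1, ..., s_i) V, i = 0, ..., d: such a
   prime of positive height at i = 0 would give a chain longer than d. *)
Lemma regular_torsion_free (V : lmodType A) (s : seq A) (a : A) (v : V) :
  prime_ideal [set 0 : A] -> fin_gen V -> regular_sequence m V s -> size s = d ->
  a != 0 -> a *: v = 0 -> v = 0.
Proof.
move=> p0 fgV [sm reg _] sd a0 av0; apply: contrapT => v0.
have accV := fin_gen_acc noethA fgV.
pose Y i := seq_smul V (take i s).
have HY i : submodule (Y i) by exact: submod_seq_smul.
suff H : forall i, (i <= d)%N -> exists u : V,
    prime_ideal [set c | Y i (c *: u)] /\ prime_chain_to i.+1 [set c | Y i (c *: u)].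
  by have [u [_ /(prime_chain_le dimA)]] := H d (leqnn _); rewrite ltnn.
have Y0 : Y 0%N = [set 0] by rewrite /Y take0 seq_smul_nil.
elim=> [_|i IH lid].
  have [|u [pu vu]] := @associated_prime _ noethA V (Y 0%N) v (HY _); first by rewrite Y0.
  exists u; split=> //; apply: prime_chain_toS (prime_chain_to0 p0) pu _; split.
    by move=> _ ->; rewrite /= scale0r; exact: submod0.
  move=> /(_ a) /= H; have := vu a; rewrite Y0 => /(_ av0) au.
  by move: a0; rewrite H ?Y0 ?eqxx.
have [u [pu cu]] := IH (ltnW lid).
have si : (i < size s)%N by rewrite sd.
set x := s`_i; have mx : m x by apply: sm; exact: mem_nth.
(* U consists of the elements that the prime (Y i : u) sends into [Y i]. If U were inside [Y i.+1],
   each w in U would be x y modulo [Y i] with y again in U, and Nakayama would put U, hence u, in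
   [Y i]. *)
pose U := [set w : V | forall c, Y i (c *: u) -> Y i (c *: w)].
have HU : submodule U.
  split; first by move=> c _; rewrite scaler0; exact: submod0.
  move=> b w w' Uw Uw' c Yc; rewrite scalerDr scalerA mulrC -scalerA.
  by case: (HY i) => _; apply; [exact: Uw|exact: Uw'].
have nYu : ~ Y i u by move=> Yu; apply: (prime_1 pu); rewrite /= scale1r.
have Yx w : Y i (x *: w) -> Y i w by exact: reg.
have [w [Uw nYw]] : exists w, U w /\ ~ Y i.+1 w.
  apply: contrapT => H; apply: nYu.
  have UY : U `<=` Y i.+1.
    by move=> w Uw; apply: contrapT => nw; apply: H; exists w.
  have : U u by move=> c.
  apply: (nakayama1 noethA localm (HY i) (acc_fg accV HU) mx) => w Uw.
  have [t [y [Yt wE]]] := (regular_seqE _ si).1 (UY w Uw).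
  exists y; split; last by rewrite wE addrK.
  move=> c Yc; apply: Yx; rewrite scalerA mulrC -scalerA.
  rewrite -/x in wE; rewrite (_ : x *: y = w - t); last by rewrite wE addrC addKr.
  by rewrite scalerBr; apply: submodB => //; [exact: Uw|exact: submodZ].
have YS := seq_smul_takeS (V := V) si.
have [w' [pw' ww']] := @associated_prime _ noethA V (Y i.+1) w (HY _) nYw.
exists w'; split=> //; apply: prime_chain_toS cu pw' _; split.
  by move=> c Yc; apply: ww'; apply: YS; exact: Uw.
(* The inclusion is strict because x belongs to the new prime but, being regular modulo [Y i], not
   to the old one. *)
move=> /(_ x) /= H; apply: nYu; apply: Yx; apply: H; apply: ww'.
by apply/(regular_seqE _ si); exists 0, w; rewrite add0r; split=> //; exact: smul0.
Qed.

End RegularSequences.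

(** * Injective modules and Ext *)

Section Subtypes.
Variables (A : comNzRingType) (V : lmodType A) (S : set V).

Definition submod_pred (HS : submodule S) : {pred V} := fun x => `[< S x >].

Lemma submod_pred_closed (HS : submodule S) : submod_closed (submod_pred HS).
Proof.
case: (HS) => S0 SD; split; first exact/asboolP.
by move=> a u v /asboolP Su /asboolP Sv; apply/asboolP; exact: SD.
Qed.
HB.instance Definition _ HS :=
  GRing.isSubmodClosed.Build A _ (submod_pred HS) (submod_pred_closed HS).

Definition submod_type (HS : submodule S) := {x | x \in submod_pred HS}.
HB.instance Definition _ HS := [isSub of submod_type HS for sval].
HB.instance Definition _ HS := [Choice of submod_type HS by <:].
HB.instance Definition _ HS := [SubChoice_isSubZmodule of submod_type HS by <:].
HB.instance Definition _ HS := [SubZmodule_isSubLmodule of submod_type HS by <:].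

End Subtypes.

(** Extension along the injection of U' / alpha^-1(K) into U / K, without quotients: f defines a map
    on K + im alpha that vanishes on K. *)
Lemma injective_extension (A : comNzRingType) (E U' U : lmodType A)
    (alpha : {linear U' -> U}) (K : set U) (f : {linear U' -> E}) :
  injective_module E -> submodule K -> (forall u, K (alpha u) -> f u = 0) ->
  exists h : {linear U -> E}, (forall k, K k -> h k = 0) /\
    forall u, h (alpha u) = f u.
Proof.
move=> injE HK fK.
have HL : submodule (addsub K (range alpha)).
  by apply: submod_add => //; exact: submod_image.
pose L := submod_type HL.
have pick (x : L) : exists u, K (val x - alpha u).
  case: x => x /= /asboolP [k [_ [Kk [u _ <-] ->]]]; exists u.
  by rewrite addrK.
have [phi Hphi] := choice pick.
have fE (x : L) u : K (val x - alpha u) -> f (phi x) = f u.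
  move=> Ku; apply/eqP; rewrite -subr_eq0 -linearB; apply/eqP; apply: fK.
  have -> : alpha (phi x - u) = (val x - alpha u) - (val x - alpha (phi x)).
    by rewrite linearB opprB [RHS]addrC addrA subrK.
  by apply: (submodB HK Ku); exact: Hphi.
have lin : linear (fun x : L => f (phi x)).
  move=> a x y; rewrite -linearP; apply: fE.
  have -> : val (a *: x + y) = a *: val x + val y.
    exact: (linearP (val : {linear L -> U})).
  rewrite (linearP alpha) opprD addrACA -scalerBr.
  by case: HK => _; apply; exact: Hphi.
have [|h Hh] := injE L U (val : {linear L -> U}) (lin_of lin); first exact: val_inj.
have inL x : addsub K (range alpha) x -> exists y : L, val y = x.
  by move=> Lx; exists (exist _ x (asboolT Lx)).
exists h; split=> [k Kk|u].
  have [|y yE] := inL k; first by apply: addsubl => //; exact: submod_image.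
  rewrite -yE Hh lin_ofE (fE y 0) ?linear0 //.
  by rewrite addr0 yE.
have [|y yE] := inL (alpha u); first by apply: addsubr => //; exists u.
by rewrite -yE Hh lin_ofE; apply: fE; rewrite yE subrr; exact: submod0.
Qed.

Lemma linear_lift_inj (A : comNzRingType) (U V W : lmodType A)
    (e : {linear V -> W}) (f : {linear U -> W}) :
  injective e -> (forall u, exists y, f u = e y) ->
  exists g : {linear U -> V}, forall u, f u = e (g u).
Proof.
move=> inje /choice[g Hg]; have lin : linear g.
  by move=> a u v; apply: inje; rewrite linearP -!Hg linearP.
by exists (lin_of lin).
Qed.

Lemma linear_lift_free (A : comNzRingType) (n : nat) (V W : lmodType A)
    (e : {linear V -> W}) (f : {linear 'rV[A]_n -> W}) :
  (forall u, exists y, f u = e y) ->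
  exists g : {linear 'rV[A]_n -> V}, forall u, f u = e (g u).
Proof.
move=> H; have /choice[y Hy] : forall i : 'I_n, exists y, f (delta_mx 0 i) = e y.
  by move=> i; exact: H.
have lin : linear (fun u : 'rV[A]_n => \sum_i u 0 i *: y i).
  move=> a u v; rewrite scaler_sumr -big_split /=; apply: eq_bigr => i _.
  by rewrite !mxE scalerDl scalerA.
exists (lin_of lin) => u; rewrite lin_ofE {1}[u]row_sum_delta !linear_sum.
by apply: eq_bigr => i _; rewrite !linearZ Hy.
Qed.

Section HomEvaluation.
Variables (A : comNzRingType) (U W : lmodType A).
Implicit Types f g : modHom U W.

Lemma modHomDE f g u : (f + g : modHom U W) u = f u + g u. Proof. by []. Qed.
Lemma modHomBE f g u : (f - g : modHom U W) u = f u - g u. Proof. by []. Qed.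
Lemma modHomZE a f u : (a *: f : modHom U W) u = a *: f u. Proof. by []. Qed.
Lemma modHomPE a f g u : (a *: f + g : modHom U W) u = a *: f u + g u.
Proof. by []. Qed.
Lemma modHom0E u : (0 : modHom U W) u = 0. Proof. by []. Qed.
Lemma modHom_linear f : linear f.
Proof. exact: (linearP (f : {linear U -> W})). Qed.
Lemma modHom_zero f : f 0 = 0.
Proof. exact: (linear0 (f : {linear U -> W})). Qed.

Lemma modHomZ f a u : f (a *: u) = a *: f u.
Proof. exact: (linearZ_LR (f : {linear U -> W})). Qed.
Lemma modHom_sum f n (F : 'I_n -> U) : f (\sum_i F i) = \sum_i f (F i).
Proof. exact: (linear_sum (f : {linear U -> W})). Qed.
Lemma modHom_sumE n (F : 'I_n -> modHom U W) u :
  (\sum_i F i : modHom U W) u = \sum_i F i u.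
Proof. exact: (big_morph (fun g : modHom U W => g u)). Qed.

End HomEvaluation.

Section HomComposition.
Variables (A : comNzRingType) (U V W : lmodType A).

Definition modHom_comp (e : {linear V -> W}) (g : modHom U V) : modHom U W :=
  (e \o (g : {linear U -> V}) : {linear U -> W}).
Lemma modHom_compE e g u : modHom_comp e g u = e (g u). Proof. by []. Qed.
Lemma modHom_comp_linear e : linear (modHom_comp e).
Proof. by move=> a f g; apply: modHomP => u; exact: (linearP e). Qed.

Definition modHom_pre (alpha : {linear U -> V}) (g : modHom V W) : modHom U W :=
  ((g : {linear V -> W}) \o alpha : {linear U -> W}).
Lemma modHom_preE alpha g u : modHom_pre alpha g u = g (alpha u). Proof. by []. Qed.

End HomComposition.

Section InjectiveComplex.
Variables (A : comNzRingType) (omega : lmodType A) (E : nat -> lmodType A).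
Variables (eps : {linear omega -> E 0%N}) (del : forall i, {linear E i -> E i.+1}).
Hypotheses (injE : forall i, injective_module (E i)) (injeps : injective eps).
Hypothesis exact0 : forall x, del 0%N x = 0 <-> exists y, x = eps y.
Hypothesis exactS : forall i x, del i.+1 x = 0 <-> exists y, x = del i y.

Let deldel i x : del i.+1 (del i x) = 0.
Proof. by apply/exactS; exists x. Qed.

(* Ext^(j+1) (U / K, omega) = 0: maps on the quotient U / K are maps on U that
   vanish on K. *)
Definition ext_zero (U : lmodType A) (K : set U) (j : nat) : Prop :=
  forall f : {linear U -> E j.+1}, (forall k, K k -> f k = 0) ->
    (forall u, del j.+1 (f u) = 0) ->
  exists g : {linear U -> E j}, (forall k, K k -> g k = 0) /\
    forall u, f u = del j (g u).

Lemma ext_zero_eq (U : lmodType A) (K K' : set U) j :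
  (forall u, K u <-> K' u) -> ext_zero K j -> ext_zero K' j.
Proof. by move=> KK; suff -> : K = K' by []; apply/seteqP; split=> u /KK. Qed.

Section LongExactSequence.
Variables (U' U : lmodType A) (alpha : {linear U' -> U}) (K : set U).
Hypothesis HK : submodule K.
Local Notation K' := (alpha @^-1` K).
Local Notation K'' := (addsub K (range alpha)).

Let kill (W : lmodType A) (f : {linear U -> W}) :
  (forall k, K k -> f k = 0) -> (forall u, f (alpha u) = 0) -> forall k, K'' k -> f k = 0.
Proof. by move=> H1 H2 _ [k [_ [Kk [u _ <-] ->]]]; rewrite linearD H1 // H2 addr0. Qed.
Let K''K k : K k -> K'' k.
Proof. by apply: addsubl; exact: submod_image. Qed.
Let K''alpha u : K'' (alpha u).
Proof. by apply: addsubr => //; exists u. Qed.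

(** This and the next two are parts of the long exact sequence of 0 -> U'/K' -> U/K -> U/K'' ->
    0. *)
Lemma ext_zero_middle j : ext_zero K' j -> ext_zero K'' j -> ext_zero K j.
Proof.
move=> V' V'' f fK fdel.
have [|u|g' [g'K Hg']] := V' (f \o alpha : {linear U' -> E j.+1}).
- by move=> k /fK.
- exact: fdel.
have [g [gK Hg]] := injective_extension (@injE j) HK (f := g') g'K.
have [||g2 [g2K Hg2]] := V'' (f \- (del j \o g) : {linear U -> E j.+1}).
- apply: kill => [k Kk|u] /=; first by rewrite fK // gK // linear0 subrr.
  by rewrite Hg -Hg' subrr.
- by move=> u /=; rewrite linearB fdel deldel subrr.
exists (g \+ g2 : {linear U -> E j}); split=> [k Kk|u] /=.
  by rewrite gK // g2K ?addr0 //; exact: K''K.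
by rewrite linearD -Hg2 /= addrC subrK.
Qed.

Lemma ext_zero_left j : ext_zero K j -> ext_zero K'' j.+1 -> ext_zero K' j.
Proof.
move=> V V'' f fK fdel.
have [h [hK Hh]] := injective_extension (@injE j.+1) HK (f := f) fK.
(* The composite [del j.+1 \o h] represents the image of f under the connecting map; once it is a
   coboundary, h can be corrected to a cocycle that still extends f. *)
have [||g2 [g2K Hg2]] := V'' (del j.+1 \o h : {linear U -> E j.+2}).
- apply: kill => [k Kk|u] /=; first by rewrite hK // linear0.
  by rewrite Hh fdel.
- by move=> u; exact: deldel.
have [||g [gK Hg]] := V (h \- g2 : {linear U -> E j.+1}).
- by move=> k Kk /=; rewrite hK // g2K ?subrr //; exact: K''K.
- by move=> u /=; rewrite linearB -Hg2 subrr.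
exists (g \o alpha : {linear U' -> E j}); split=> [k /gK //|u].
by rewrite /= -Hg /= Hh g2K ?subr0 //; exact: K''alpha.
Qed.

Lemma ext_zero_right j : ext_zero K' j -> ext_zero K j.+1 -> ext_zero K'' j.+1.
Proof.
move=> V' V f fK fdel.
have [||g [gK Hg]] := V f; [by move=> k /K''K; exact: fK|exact: fdel|].
have [||h' [h'K Hh']] := V' (g \o alpha : {linear U' -> E j.+1}); first by move=> k /gK.
  by move=> u; rewrite /= -Hg fK //; exact: K''alpha.
have [h [hK Hh]] := injective_extension (@injE j) HK (f := h') h'K.
exists (g \- (del j \o h) : {linear U -> E j.+1}); split.
  apply: kill => [k Kk|u] /=; first by rewrite gK // hK // linear0 subrr.
  by rewrite Hh -Hh' subrr.
by move=> u; rewrite /= linearB deldel subr0.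
Qed.

End LongExactSequence.

Lemma ext_zero_free n j : ext_zero ([set 0] : set 'rV[A]_n) j.
Proof.
move=> f _ fdel; have [|g Hg] := @linear_lift_free _ n _ _ (del j) f.
  by move=> u; apply/exactS; exact: fdel.
by exists g; split=> // k ->; rewrite linear0.
Qed.

Lemma ext_zero_T (U : lmodType A) j : ext_zero (setT : set U) j.
Proof.
move=> f f0 _; exists (\0 : {linear U -> E j}); split=> // u.
by rewrite f0 //= linear0.
Qed.

Section Finiteness.
Hypotheses (noethA : noetherian A) (fgomega : fin_gen omega).

Definition ext_cocycle (U : lmodType A) (K : set U) (j : nat) : set (modHom U (E j)) :=
  [set f | (forall k, K k -> f k = 0) /\ forall u, del j (f u) = 0].

Definition ext_coboundary (U : lmodType A) (K : set U) (j : nat) :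
    set (modHom U (E j)) :=
  match j with
  | 0 => [set 0]
  | i.+1 => [set f | exists g : modHom U (E i), (forall k, K k -> g k = 0) /\
                       forall u, f u = del i (g u)]
  end.

Arguments ext_cocycle {U} K j.
Arguments ext_coboundary {U} K j.

Lemma submod_coboundary (U : lmodType A) (K : set U) j : submodule (ext_coboundary K j).
Proof.
case: j => [|j]; first exact: submod_zero.
split; first by exists 0; split=> // u; rewrite !modHom0E linear0.
move=> a f f' [g [gK Hg]] [g' [g'K Hg']].
exists (a *: g + g'); split=> [k Kk|u].
  by rewrite modHomPE gK // g'K // scaler0 addr0.
by rewrite !modHomPE linearP Hg Hg'.
Qed.

Lemma ext_zeroP (U : lmodType A) (K : set U) j :
  ext_zero K j <-> ext_cocycle K j.+1 `<=` ext_coboundary K j.+1.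
Proof.
split=> [H f [fK fd]|H f fK fd]; last exact: (H f (conj fK fd)).
exact: H.
Qed.

Lemma modHom_fin_gen n : fin_gen (modHom 'rV[A]_n omega).
Proof.
have [s Es] := fgomega.
have lin (i : 'I_n) (w : omega) : linear (fun v : 'rV[A]_n => v 0 i *: w).
  by move=> a u v; rewrite !mxE scalerDl scalerA.
pose elem i w : modHom 'rV[A]_n omega := lin_of (lin i w).
have lin' i : linear (elem i).
  move=> a w w'; apply: modHomP => v.
  rewrite modHomPE -[LHS]/(v 0 i *: (a *: w + w')).
  by rewrite -[RHS]/(a *: (v 0 i *: w) + v 0 i *: w') scalerDr !scalerA mulrC.
exists [seq elem i w | i <- enum 'I_n, w <- s]; apply/seteqP; split=> // f _.
suff -> : f = \sum_i elem i (f (delta_mx 0 i)).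
  apply: submod_sum => [|i _]; first exact: submod_lspan.
  have : lspan s (f (delta_mx 0 i)) by rewrite /lspan -Es.
  pose X := (lin_of (lin' i)) @^-1` lspan [seq elem i w | i <- enum 'I_n, w <- s].
  apply: (@lspan_sub _ _ s X); first by apply: submod_preim; exact: submod_lspan.
  by move=> w ws; apply: lspan_mem; apply/allpairsP; exists (i, w); rewrite mem_enum.
apply: modHomP => v.
rewrite modHom_sumE {1}[v]row_sum_delta modHom_sum.
by apply: eq_bigr => i _; rewrite modHomZ.
Qed.

Lemma modHom_extension (U' U : lmodType A) (alpha : {linear U' -> U}) (K : set U)
    j (f : modHom U' (E j)) : submodule K -> (forall u, K (alpha u) -> f u = 0) ->
  exists h : modHom U (E j), (forall k, K k -> h k = 0) /\
    forall u, h (alpha u) = f u.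
Proof. exact: (injective_extension (@injE j)). Qed.

Lemma lspan_image (V W : lmodType A) (f : {linear V -> W}) s v :
  lspan s v -> lspan (map f s) (f v).
Proof.
apply: (@lspan_sub _ _ s (f @^-1` lspan (map f s))).
  by apply: submod_preim; exact: submod_lspan.
by move=> x xs; apply: lspan_mem; exact: map_f.
Qed.

Lemma coboundary_extension (U' U : lmodType A) (alpha : {linear U' -> U}) j
    (b : modHom U' (E j)) : ext_coboundary (alpha @^-1` [set 0]) j b ->
  exists b' : modHom U (E j),
    (forall u, b' (alpha u) = b u) /\ forall u, del j (b' u) = 0.
Proof.
case: j b => [|j] b; first by move=> ->; exists 0; split=> // u; exact: linear0.
move=> [e [eK He]]; have [e' [_ He']] := modHom_extension (@submod_zero _ U) eK.
exists (modHom_comp (del j) e'); split=> u; rewrite modHom_compE ?deldel //.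
by rewrite He' He.
Qed.

(* Ext^j (A^n / K, omega) is finitely generated. For j > 0, it is a quotient
   of Ext^(j-1) (K, omega). *)
Lemma ext_fin_gen j n (K : set 'rV[A]_n) : submodule K ->
  exists c : seq (modHom 'rV[A]_n (E j)), (forall x, x \in c -> ext_cocycle K j x) /\
    ext_cocycle K j `<=` addsub (lspan c) (ext_coboundary K j).
Proof.
elim: j n K => [|j IH] n K HK.
  pose Z : set (modHom 'rV[A]_n omega) := [set g | forall k, K k -> g k = 0].
  have HZ : submodule Z.
    split=> // a f g fK gK k Kk.
    by rewrite modHomPE fK // gK // scaler0 addr0.
  have [s Es] := fin_gen_submod noethA (modHom_fin_gen n) HZ.
  exists (map (modHom_comp eps) s); split.
    move=> _ /mapP[g gs ->]; have Zg : Z g by rewrite Es; exact: lspan_mem.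
    split=> [k Kk|u]; first by rewrite modHom_compE Zg // linear0.
    by rewrite modHom_compE; apply/exact0; exists (g u).
  move=> f [fK fd]; apply: addsubl; first exact: submod_zero.
  have [g Hg] : exists g : modHom 'rV[A]_n omega, forall u, f u = eps (g u).
    by apply: linear_lift_inj => // u; apply/exact0; exact: fd.
  have -> : f = lin_of (modHom_comp_linear eps) g by apply: modHomP => u; exact: Hg.
  apply: (@lspan_image _ _ (lin_of (modHom_comp_linear eps)) s g).
  by rewrite -Es => k Kk; apply: injeps; rewrite linear0 -Hg; exact: fK.
have [s Es] : exists s, K = lspan s.
  apply: (fin_gen_submod noethA) => //.
  exists [seq delta_mx 0 i | i <- enum 'I_n]; apply/seteqP; split=> // v _.
  rewrite [v]row_sum_delta; apply: (submod_sum _ (submod_lspan _)) => i _.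
  apply: submodZ; first exact: submod_lspan.
  by apply: lspan_mem; apply: map_f; rewrite mem_enum.
(* [kappa] presents K as a quotient of a free module, the form required by the induction
   hypothesis. *)
have klin : linear (fun v : 'rV[A]_(size s) => \sum_i v 0 i *: s`_i).
  move=> a u v; rewrite scaler_sumr -big_split /=; apply: eq_bigr => i _.
  by rewrite !mxE scalerDl scalerA.
pose kappa := lin_of klin.
have kappaK u : K (kappa u).
  rewrite Es; apply: (submod_sum _ (submod_lspan _)) => i _.
  by apply: submodZ; [exact: submod_lspan|apply: lspan_mem; exact: mem_nth].
have Kkappa k : K k -> exists u, k = kappa u.
  rewrite Es; move: k; apply: (@lspan_sub _ _ s (fun k => exists u, k = kappa u)).
    split; first by exists 0; rewrite linear0.
    by move=> a _ _ [u ->] [u' ->]; exists (a *: u + u'); rewrite linearP.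
  move=> x xs; have ix : (index x s < size s)%N by rewrite index_mem.
  exists (delta_mx 0 (Ordinal ix)).
  rewrite lin_ofE (bigD1 (Ordinal ix)) //= mxE !eqxx scale1r nth_index //.
  by rewrite big1 ?addr0 // => i /negPf ni; rewrite mxE eqxx ni scale0r.
pose K0 := kappa @^-1` [set 0].
have HK0 : submodule K0 by apply: submod_preim; exact: submod_zero.
have [c [cZ cgen]] := IH _ K0 HK0.
(* The value 0 is a default that makes [choice] applicable. *)
have ext (x : modHom 'rV[A]_(size s) (E j)) : exists g : modHom 'rV[A]_n (E j),
    (forall k, K0 k -> x k = 0) -> forall u, g (kappa u) = x u.
  have [xK|nxK] := pselect (forall k, K0 k -> x k = 0); last by exists 0.
  have [g [_ Hg]] := modHom_extension (@submod_zero _ 'rV[A]_n) xK.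
  by exists g.
have [G HG] := choice ext.
exists [seq modHom_comp (del j) (G x) | x <- c]; split.
  move=> _ /mapP[x xc ->]; have [xK xd] := cZ x xc.
  split=> [_ /Kkappa[u ->]|u]; rewrite modHom_compE; last exact: deldel.
  by rewrite HG.
set c' := [seq modHom_comp (del j) (G x) | x <- c].
have lift y : lspan c y -> exists g : modHom 'rV[A]_n (E j),
    (forall u, g (kappa u) = y u) /\ lspan c' (modHom_comp (del j) g).
  move: y; apply: lspan_sub.
    split.
      exists 0; split=> //; suff -> : modHom_comp (del j) (0 : modHom 'rV[A]_n _) = 0.
        exact: smul0.
      by apply: modHomP => u; rewrite modHom_compE !modHom0E linear0.
    move=> a y y' [g [Hg Dg]] [g' [Hg' Dg']]; exists (a *: g + g'); split=> [u|].
      by rewrite !modHomPE Hg Hg'.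
    by rewrite modHom_comp_linear; case: (submod_lspan c') => _; apply.
  move=> x xc; exists (G x); split; last by apply: lspan_mem; exact: map_f.
  by apply: HG; case: (cZ x xc).
move=> f [fK fd].
(* On the free module the cocycle f is a coboundary; the restriction of g to K is a class that the
   connecting map sends to f. *)
have [g Hg] : exists g : modHom 'rV[A]_n (E j), forall u, f u = del j (g u).
  by apply: linear_lift_free => u; apply/exactS; exact: fd.
have [|y [b [cy Bb yb]]] := cgen (modHom_pre kappa g).
  split=> [k K0k|u]; rewrite modHom_preE; first by rewrite K0k modHom_zero.
  by rewrite -Hg; exact/fK/kappaK.
have [y' [Hy' Dy']] := lift y cy.
have [b' [Hb' Db']] : exists b' : modHom 'rV[A]_n (E j),
    (forall u, b' (kappa u) = b u) /\ forall u, del j (b' u) = 0.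
  exact: coboundary_extension Bb.
exists (modHom_comp (del j) y'), (modHom_comp (del j) (g - y' - b')); split=> //.
  exists (g - y' - b'); split=> // _ /Kkappa[u ->].
  rewrite !modHomBE Hy' Hb' -modHom_preE yb modHomDE.
  by rewrite addrAC addrK subrr.
apply: modHomP => u; rewrite Hg modHomDE !modHom_compE -linearD !modHomBE.
by rewrite linearD !linearB Db' subr0 addrC subrK.
Qed.

(** Vanishing one degree higher on the quotient by a makes multiplication by a surjective on
    Ext^(j+1), which is finitely generated, so Nakayama applies. *)
Lemma ext_zero_regular (m : set A) n (K : set 'rV[A]_n) (a : A) j :
  is_local m -> submodule K -> m a -> (forall u, K (a *: u) -> K u) ->
  ext_zero (addsub K (range (homothety 'rV[A]_n a))) j.+1 -> ext_zero K j.
Proof.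
move=> localm HK ma rega V''; apply/ext_zeroP.
have [c [cZ cgen]] := ext_fin_gen j.+1 HK.
have HB := submod_coboundary K j.+1.
suff cB : forall x, x \in c -> ext_coboundary K j.+1 x.
  by apply: subset_trans cgen _; apply: addsub_sub => //; exact: lspan_sub.
apply: (nakayama_seq noethA localm HB) => x xc; have [xK xd] := cZ x xc.
have [h [hK Hh]] := modHom_extension (alpha := homothety _ a) HK
  (fun u Ku => xK u (rega u Ku)).
have [g [gK Hg]] : exists g : modHom 'rV[A]_n (E j.+1),
    (forall k, addsub K (range (homothety 'rV[A]_n a)) k -> g k = 0) /\
    forall u, modHom_comp (del j.+1) h u = del j.+1 (g u).
  apply: V'' => [_ [k [_ [Kk [u _ <-] ->]]]|u]; last exact: deldel.
  rewrite -[LHS]/(del j.+1 (h (k + a *: u))).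
  have -> : h (k + a *: u) = h k + h (homothety _ a u).
    exact: (linearD (h : {linear _ -> _})).
  by rewrite hK // Hh add0r xd.
have yZ : ext_cocycle K j.+1 (h - g).
  split=> [k Kk|u]; rewrite modHomBE.
    rewrite hK // gK ?subrr //.
    by apply: addsubl => //; exact: submod_image.
  by rewrite linearB -Hg subrr.
have [l [b [cl Bb yE]]] := cgen _ yZ.
exists (a *: l), (a *: b); split; [exact: smul_gen|exact: submodZ|].
rewrite -scalerDr -yE; apply: modHomP => u; rewrite modHomZE modHomBE scalerBr.
have -> : a *: g u = 0.
  by rewrite -modHomZ gK //; apply: addsubr => //; exists u.
by rewrite subr0 -modHomZ -Hh.
Qed.

End Finiteness.
End InjectiveComplex.

(** * Vanishing of Ext *)

Lemma scale_regE (A : comNzRingType) (a b : A) : a *: (b : A^o) = a * b.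
Proof. by []. Qed.

Section ExtVanishing.
Variables (A : comNzRingType) (m : set A) (d : nat).
Hypotheses (noethA : noetherian A) (localm : is_local m) (dimA : krull_dim A d).
Variables (ys : seq A).
Hypotheses (regys : regular_sequence m A^o ys) (szys : size ys = d).
Variables (omega : lmodType A) (E : nat -> lmodType A).
Variables (eps : {linear omega -> E 0%N}) (del : forall i, {linear E i -> E i.+1}).
Hypotheses (injE : forall i, injective_module (E i)) (injeps : injective eps).
Hypothesis exact0 : forall x, del 0%N x = 0 <-> exists y, x = eps y.
Hypothesis exactS : forall i x, del i.+1 x = 0 <-> exists y, x = del i y.
Variable ninj : nat.
Hypothesis E0 : forall i, (ninj < i)%N -> forall x : E i, x = 0.
Hypothesis fgomega : fin_gen omega.

Local Notation ext0 := (@ext_zero A E del _).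

Let row1 : 'rV[A]_1 := const_mx 1.
Let row1E (v : 'rV[A]_1) : v = v 0 0 *: row1.
Proof. by apply/rowP => i; rewrite !mxE ord1 mulr1. Qed.

(** A / I as a quotient of row vectors of length 1, so that results about 'rV[A]_n apply to it. *)
Definition ideal_row (I : set A^o) : set 'rV[A]_1 := [set v | I (v 0 0)].

Lemma submod_ideal_row I : submodule I -> submodule (ideal_row I).
Proof.
move=> [I0 IS]; split; first by rewrite /ideal_row /= mxE.
by move=> a u v Iu Iv; rewrite /ideal_row /= !mxE; exact: IS.
Qed.

Lemma ideal_row_adjoin I (a : A) (v : 'rV[A]_1) : submodule I ->
  addsub (ideal_row I) (range (homothety 'rV[A]_1 a)) v <-> ideal_row (adjoin I a) v.
Proof.
move=> HI; split.
  move=> [k [_ [Ik [u _ <-] ->]]]; exists (u 0 0), (k 0 0); split=> //.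
  by rewrite !mxE addrC scale_regE mulrC.
move=> [c [i [Ii vE]]]; exists (i *: row1), (homothety _ a (c *: row1)); split.
- by rewrite /ideal_row /= !mxE mulr1.
- by exists (c *: row1).
- by rewrite {1}[v]row1E vE homothetyE scalerA -scalerDl addrC mulrC.
Qed.

(** The quotient of A by i elements of a regular sequence has projective dimension at most i: each
    element costs one degree in the long exact sequence. *)
Lemma ext_zero_seq i j : (i <= d)%N -> (i <= j)%N ->
  ext0 (ideal_row (seq_smul A^o (take i ys))) j.
Proof.
elim: i j => [|i IH] j.
  move=> _ _; rewrite take0 seq_smul_nil.
  apply: ext_zero_eq (@ext_zero_free _ _ del exactS 1 j) => u.
  split; first by move=> ->; rewrite /ideal_row /= mxE.
  by rewrite /ideal_row /= {2}[u]row1E => ->; rewrite scale0r.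
move=> lid; case: j => // j; rewrite ltnS => ij.
have si : (i < size ys)%N by rewrite szys.
have HY := submod_ideal_row (@submod_seq_smul _ A^o (take i ys)).
have lid' := ltnW lid.
have := @ext_zero_right _ _ _ injE exactS _ _ (homothety _ ys`_i) _ HY j.
move=> H; apply: ext_zero_eq (H _ (IH j.+1 lid' (leqW ij))).
  move=> u; split.
    move/ideal_row_adjoin => /(_ (submod_seq_smul _ _)) [c [k [Yk uE]]].
    apply/(regular_seqE _ si); exists k, c; split=> //.
    by rewrite uE addrC scale_regE mulrC.
  move=> /(regular_seqE _ si) [k [c [Yk uE]]].
  apply/ideal_row_adjoin; first exact: submod_seq_smul.
  by exists c, k; split=> //; rewrite uE addrC scale_regE mulrC.
apply: ext_zero_eq (IH j lid' ij) => u; rewrite /ideal_row /= mxE.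
split; last by case: regys => _ reg _; exact: reg.
by move=> Yu; exact: (ideal_mulr _ (submod_seq_smul _ _)).
Qed.

Section DescendingStep.
Variable j : nat.
Hypothesis dj : (d <= j)%N.
Hypothesis above : forall n (K : set 'rV[A]_n), submodule K -> ext0 K j.+1.

(** A socle element embeds A / m in A / (ys), where Ext^(j+1) vanishes, and [above] handles
    Ext^(j+2) of the cokernel. *)
Lemma ext_zero_residue : ext0 (ideal_row m) j.
Proof.
have [a [na ma]] := parameter_socle noethA localm dimA regys szys.
have HY := @submod_seq_smul _ A^o ys.
have HYr := submod_ideal_row HY.
have V : ext0 (ideal_row (seq_smul A^o ys)) j.
  by have := ext_zero_seq (leqnn d) dj; rewrite -szys take_size.
have := @ext_zero_left _ _ _ injE exactS _ _ (homothety _ a) _ HYr j V (above _).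
move=> H; apply: ext_zero_eq (H _); last first.
  by apply: submod_add => //; exact: submod_image.
move=> u; rewrite /ideal_row /= mxE; split; last first.
  by move=> /ma; rewrite mulrC.
move=> Yu; apply: contrapT => nm; apply: na.
have [b b1] := local_inv noethA localm nm.
rewrite -[a]mul1r -b1 -mulrA [_ * a]mulrC; exact: (ideal_mulr _ HY).
Qed.

(** Noetherian induction. If I is not prime, A / I is an extension of A / (I + (a)) by A / (I : a),
    with larger ideals; if I is a prime other than m, an element of m outside I is regular on A /
    I. *)
Lemma ext_zero_cyclic (I : set A^o) : submodule I -> ext0 (ideal_row I) j.
Proof.
move: I; apply: (acc_ind (noetherian_acc noethA)) => I HI IH.
have HIr := submod_ideal_row HI.
have [I1|nI1] := pselect (I 1).
  apply: (ext_zero_eq _ (@ext_zero_T _ _ del 'rV[A]_1 j)) => u; split=> // _.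
  by rewrite /ideal_row /= -[u 0 0]mulr1; exact: (ideal_mulr _ HI).
have [pI|[a [b [Iab na nb]]]] := prime_or_factor HI nI1; last first.
  apply: (@ext_zero_middle _ _ _ injE exactS _ _ (homothety _ a) _ HIr).
    apply: (@ext_zero_eq _ _ _ _ (ideal_row [set c | I (c *: (a : A^o))])).
      by move=> u; rewrite /ideal_row /= mxE -[_ *: _]/(u 0 0 * a) mulrC.
    apply: IH; first exact: submod_colon.
    split=> [c Ic|/(_ b)]; first exact: (ideal_mull _ HI).
    by move=> H; apply: nb; apply: H; rewrite /= -[_ *: _]/(b * a) mulrC.
  apply: (@ext_zero_eq _ _ _ _ (ideal_row (adjoin I a))).
    by move=> u; split=> /ideal_row_adjoin; apply.
  by apply: IH; [exact: submod_adjoin|exact: adjoin_proper].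
have [Im|nIm] := pselect (m `<=` I).
  have -> : I = m.
    apply/seteqP; split=> //; exact: (local_sub noethA localm HI nI1).
  exact: ext_zero_residue.
have [x [mx nIx]] : exists x, m x /\ ~ I x.
  apply: contrapT => H; apply: nIm => x mx; apply: contrapT => nx.
  by apply: H; exists x.
apply: (ext_zero_regular injE injeps exact0 exactS noethA fgomega localm HIr mx).
  by move=> u; rewrite /ideal_row /= mxE => /(prime_mul pI) [].
by apply: above; apply: submod_add => //; exact: submod_image.
Qed.

Lemma ext_zero_step n (K : set 'rV[A]_n) : submodule K -> ext0 K j.
Proof.
have accV : acc_sub [set: 'rV[A]_n].
  apply: fin_gen_acc => //; exists [seq delta_mx 0 i | i <- enum 'I_n].
  apply/seteqP; split=> // v _.
  rewrite [v]row_sum_delta; apply: (submod_sum _ (submod_lspan _)) => i _.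
  apply: submodZ; first exact: submod_lspan.
  by apply: lspan_mem; apply: map_f; rewrite mem_enum.
move: K; apply: (acc_ind accV) => K HK IH.
have [KT|nKT] := pselect (K = setT); first by rewrite KT; exact: ext_zero_T.
have [u nKu] : exists u, ~ K u.
  apply: contrapT => /forallNP H; apply: nKT; apply/seteqP; split=> // u _.
  by apply: contrapT; exact: H.
have lin : linear (fun v : 'rV[A]_1 => v 0 0 *: u).
  by move=> a v w; rewrite !mxE scalerDl scalerA.
apply: (@ext_zero_middle _ _ _ injE exactS _ _ (lin_of lin) _ HK).
  exact: (ext_zero_cyclic (submod_colon u HK)).
apply: IH; first by apply: submod_add => //; exact: submod_image.
split; first by apply: addsubl; exact: submod_image.
move=> H; apply: nKu; apply: H; apply: addsubr => //.
by exists row1 => //; rewrite lin_ofE mxE scale1r.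
Qed.

End DescendingStep.

(* Finite injective dimension starts a descending induction on j.  The condition
   d <= j comes from the residue field, which embeds in the quotient of A by a
   regular sequence of length d. *)
Lemma ext_zero_above_dim n (K : set 'rV[A]_n) j :
  (d <= j)%N -> submodule K -> ext0 K j.
Proof.
suff H k : forall j, (d <= j)%N -> (ninj <= j + k)%N -> forall n (K : set 'rV[A]_n),
    submodule K -> ext0 K j.
  by move=> dj; apply: (H ninj); rewrite ?leq_addl.
elim: k => [|k IH] {}j dj; last first.
  move=> nj n' K'; apply: ext_zero_step => // n2 K2; apply: IH; first exact: leqW.
  by rewrite addSnnS.
rewrite addn0 => nj n' K' _ f _ _; exists (\0 : {linear _ -> _}); split=> // u.
by rewrite (E0 _ (f u)) ?ltnS //= linear0.
Qed.

Section Resolution.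
Variables (M : lmodType A) (F : free_resolution M) (xs : seq A).
Hypotheses (regxs : regular_sequence m M xs) (szxs : size xs = d).

(** Descending induction on i: [ext_zero_regular] trades one regular element for one degree. At i =
    d the index j + d is in the range of [ext_zero_above_dim], and i = 0 concerns M itself. *)
Lemma ext_zero_module i j : (i <= d)%N ->
  ext0 (aug F @^-1` seq_smul M (take i xs)) (j + i).
Proof.
move=> lid; move: {2}(d - i)%N (erefl (d - i)%N) => k; elim: k i lid => [|k IH] i lid kE.
  apply: ext_zero_above_dim; last by apply: submod_preim; exact: submod_seq_smul.
  by move/eqP: kE; rewrite subn_eq0 => /leq_trans; apply; exact: leq_addl.
have si : (i < d)%N by rewrite -subn_gt0 kE.
have si' : (i < size xs)%N by rewrite szxs.
have HY := @submod_seq_smul _ M (take i xs).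
have Hpre := submod_preim (aug F) HY.
have [xm reg _] := regxs.
apply: (ext_zero_regular (a := xs`_i) injE injeps exact0 exactS noethA fgomega
  localm Hpre).
- by apply: xm; exact: mem_nth.
- by move=> u; rewrite /= linearZ; exact: reg.
have := IH i.+1 si; rewrite addnS subnS kE => /(_ erefl).
apply: ext_zero_eq => u; rewrite /= regular_seqE //; split.
  move=> [w [y [Yw uE]]]; have [v vE] := aug_surj F y.
  exists (u - xs`_i *: v), (homothety _ xs`_i v); split; last by rewrite subrK.
    by rewrite /= linearB linearZ /= vE uE addrK.
  by exists v.
move=> [k' [_ [Yk [v _ <-] ->]]]; exists (aug F k'), (aug F v); split=> //.
by rewrite linearD; congr (_ + _); exact: linearZ.
Qed.

Let dlin i : linear (fun y : 'rV[A]_(rk F i.+1) => y *m dmx F i).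
Proof. by move=> a u v; rewrite mulmxDl scalemxAl. Qed.
Let dmap i := lin_of (@dlin i).

(** The cokernel of [dmx F p] is the p-th syzygy, so the induction is dimension shifting, with M at
    p = 0. *)
Lemma ext_zero_syzygy p j :
  ext0 ([set x | exists y : 'rV[A]_(rk F p.+1), x = y *m dmx F p] :
    set 'rV[A]_(rk F p)) j.
Proof.
elim: p j => [|p IH] j.
  have := @ext_zero_module 0 j (leq0n _); rewrite addn0 take0 seq_smul_nil.
  by apply: ext_zero_eq => u; exact: aug_exact.
move=> f fK fd.
have [h [_ Hh]] := @injective_extension _ _ _ _ (dmap p) _ f (@injE j.+1)
  (@submod_zero _ _)
  (fun u Ku => fK u ((dmx_exact u).1 Ku)).
have [||g [gK Hg]] := IH j.+1 (del j.+1 \o h : {linear _ -> _}).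
- by move=> _ [y ->]; rewrite -[y *m _]/(dmap p y) /= Hh.
- by move=> u; apply/exactS; exists (h u).
have [e He] : exists e : {linear 'rV[A]_(rk F p) -> E j},
    forall u, (h \- g) u = del j (e u).
  apply: (@linear_lift_free _ _ _ _ (del j) (h \- g : {linear _ -> _})) => u; apply/exactS.
  by rewrite /= linearB -Hg subrr.
exists (e \o dmap p : {linear _ -> _}); split=> [_ [y ->]|u].
  by rewrite /= (dmx_exact (y *m dmx F p.+1)).2 ?linear0 //; exists y.
by rewrite /= -He /= gK ?subr0 -?Hh //; exists u.
Qed.

(** Balancing of Ext in one place: Ext^1 of the p-th syzygy, zero by the injective resolution, gives
    exactness of Hom(F, omega) at p + 1. *)
Lemma cocycles_coboundaries p :
  @cocycles A M F omega p.+1 `<=` @coboundaries A M F omega p.+1.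
Proof.
move=> f Hf.
have fK u : dmap p u = 0 -> eps (f u) = 0.
  by move=> /dmx_exact [y ->]; rewrite Hf linear0.
have [h [_ Hh]] := @injective_extension _ _ _ _ (dmap p) _ (modHom_comp eps f) (@injE 0%N)
  (@submod_zero _ _) fK.
have [||g [gK Hg]] := @ext_zero_syzygy p 0 (del 0%N \o h : {linear _ -> _}).
- move=> _ [y ->]; rewrite -[y *m _]/(dmap p y) /= Hh.
  by apply/exact0; exists (f y).
- by move=> u; apply/exactS; exists (h u).
have [|e He] := @linear_lift_inj _ _ _ _ eps (h \- g : {linear _ -> _}) injeps.
  by move=> u; apply/exact0; rewrite /= linearB -Hg subrr.
exists e => x; apply: injeps; have := He (x *m dmx F p).
rewrite /= gK ?subr0; last by exists x.
by rewrite -[x *m _]/(dmap p x) Hh => H; exact: H.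
Qed.

End Resolution.
End ExtVanishing.

(** * Duals of syzygies *)

Lemma fin_gen_surj (A : comNzRingType) (V W : lmodType A) (f : {linear V -> W}) :
  (forall w, exists v, w = f v) -> fin_gen V -> fin_gen W.
Proof.
move=> fsurj [s Es]; exists (map f s); apply/seteqP; split=> // w _.
by have [v ->] := fsurj w; apply: lspan_image; rewrite /lspan -Es.
Qed.

(** W is a sum of images of V, so the inclusion of a I^k V in I^(n+k) V passes to W with the same
    k. *)
Lemma ratliff_rush_sub (A : comNzRingType) (I : set A) (V W : lmodType A) n :
  (forall w : W, exists k (rho : 'I_k -> {linear V -> W}) (v : 'I_k -> V),
     w = \sum_i rho i (v i)) ->
  ratliff_rush I n V `<=` ratliff_rush I n W.
Proof.
move=> Wsum a [k Hk]; exists k.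
have HT : submodule (smul (ideal_pow I (n + k)) [set: W]) by exact: submod_smul.
apply: (@smul_sub _ _ _ _ (homothety W a @^-1` smul (ideal_pow I (n + k)) [set: W])).
  exact: submod_preim.
move=> b w Ib _; have [l [rho [v ->]]] := Wsum w.
rewrite /= linear_sum scaler_sumr; apply: (submod_sum _ HT) => i _.
have Mbv : smul (ideal_pow I k) [set: V] (b *: v i) by exact: smul_gen.
have := smulS (@subset_refl _ _) (@subsetT _ _) (smul_image (rho i) (Hk _ Mbv)).
suff -> : rho i (a *: (b *: v i)) = a *: (b *: rho i (v i)).
  by rewrite scalerA mulrC -scalerA.
by rewrite linearZ; congr (_ *: _); exact: linearZ.
Qed.

Lemma quot_krull_dim_inj (A : comNzRingType) (I : set A) d d' :
  quot_krull_dim I d -> quot_krull_dim I d' -> d = d'.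
Proof.
move=> [[P cP] maxd] [[P' cP'] maxd'].
by apply/eqP; rewrite eqn_leq (maxd' _ _ cP) (maxd _ _ cP').
Qed.

Lemma local_jacobson (A : comNzRingType) (m : set A) :
  is_local m -> jacobson_radical A = m.
Proof.
move=> [maxm uniqm]; apply/seteqP; split=> [x|x mx m' /uniqm -> //].
exact.
Qed.

Section SyzygyDuals.
Variables (A : comNzRingType) (omega M : lmodType A) (F : free_resolution M).
Hypothesis ext_syz : forall p,
  @cocycles A M F omega p.+1 `<=` @coboundaries A M F omega p.+1.
Local Notation N i := (modHom (syz F i.+1) omega).

Lemma syz_val_lin i :
  linear (fun u : syz F i.+1 => sval (u : syz_image F i) : 'rV[A]_(rk F i)).
Proof. by move=> a u v. Qed.
Definition syz_val i : {linear syz F i.+1 -> 'rV[A]_(rk F i)} := lin_of (@syz_val_lin i).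
Arguments syz_val {i}.

Lemma syz_val_inj i : injective (@syz_val i).
Proof. exact: val_inj. Qed.

Lemma syz_valP i (u : syz F i.+1) : exists y, syz_val u = y *m dmx F i.
Proof. by case: u => u Hu; exact/asboolP. Qed.

Lemma syz_lift i (y : 'rV[A]_(rk F i.+1)) :
  exists u : syz F i.+1, syz_val u = y *m dmx F i.
Proof.
have Hu : y *m dmx F i \in @syz_pred A M F i by apply/asboolP; exists y.
by exists (exist (fun x => x \in @syz_pred A M F i) _ Hu).
Qed.

(** Pulled back to F_(i+1), phi is a cocycle, hence factors through F_i. So Hom(F_i, omega), a power
    of [omega], maps onto the dual. *)
Lemma syz_dual_extend i (phi : N i) :
  exists g : modHom 'rV[A]_(rk F i) omega, forall u, phi u = g (syz_val u).
Proof.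
have [s Hs] := choice (@syz_lift i).
have lin : linear (fun y => phi (s y)).
  move=> a y z; rewrite -modHom_linear; congr (modHom_fun phi _).
  by apply: syz_val_inj; rewrite linearP !Hs mulmxDl scalemxAl.
have [|g Hg] := @ext_syz i (lin_of lin).
  move=> y; rewrite -[LHS]/(phi (s _)).
  have -> : s (y *m dmx F i.+1) = 0; last exact: modHom_zero.
  apply: syz_val_inj; rewrite Hs linear0.
  by apply: (dmx_exact (y *m dmx F i.+1)).2; exists y.
exists g => u; have [y uE] := syz_valP u.
rewrite uE -Hg -[RHS]/(phi (s y)); congr (modHom_fun phi _).
by apply: syz_val_inj; rewrite Hs.
Qed.

Lemma coord_lin i (k : 'I_(rk F i)) (w : omega) :
  linear (fun u : syz F i.+1 => syz_val u 0 k *: w).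
Proof. by move=> a u v; rewrite linearP !mxE scalerDl scalerA. Qed.
Definition coord_dual i k w : N i := lin_of (@coord_lin i k w).

Lemma coord_dualE i k w (u : syz F i.+1) : @coord_dual i k w u = syz_val u 0 k *: w.
Proof. by []. Qed.

Lemma coord_dual_lin i k : linear (@coord_dual i k).
Proof.
move=> a w w'; apply: modHomP => u.
by rewrite modHomPE !coord_dualE scalerDr !scalerA mulrC.
Qed.

Lemma syz_dual_sum i (phi : N i) :
  exists k (rho : 'I_k -> {linear omega -> N i}) (v : 'I_k -> omega),
    phi = \sum_j rho j (v j).
Proof.
have [g Hg] := syz_dual_extend phi.
exists (rk F i), (fun k => lin_of (@coord_dual_lin i k)), (fun k => g (delta_mx 0 k)).
apply: modHomP => u; rewrite modHom_sumE Hg {1}[syz_val u]row_sum_delta modHom_sum.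
by apply: eq_bigr => k _; rewrite modHomZ.
Qed.

Lemma syz_dual_fin_gen i : fin_gen omega -> fin_gen (N i).
Proof.
move=> fgomega.
have lin : linear (modHom_pre (@syz_val i) : modHom 'rV[A]_(rk F i) omega -> N i).
  by move=> a f g; apply: modHomP.
apply: (@fin_gen_surj _ _ _ (lin_of lin)); last exact: modHom_fin_gen.
move=> phi; have [g Hg] := syz_dual_extend phi.
by exists g; apply: modHomP => u; exact: Hg.
Qed.

(** If [dmx F i.+1] is zero, every map from F_(i+1) to [omega] is a coboundary, so by minimality has
    values in m omega; a coordinate times w has not. The nonzero [dmx F i] provides the coordinate.
    If [dmx F 0] is zero, M is free. *)
Lemma syz_neq0 (m : set A) (w : omega) : submodule (m : set A^o) ->
  minimal_resolution m F -> ~ is_free M -> ~ smul m setT w ->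
  forall i, exists y : 'rV[A]_(rk F i.+1), y *m dmx F i <> 0.
Proof.
move=> Hm minF nfree nw; elim=> [|i [y0 ny0]]; apply: contrapT => /forallNP dmx0.
  apply: nfree; exists (rk F 0), (aug F).
  have [inv Hinv] := choice (aug_surj F); exists inv => // x.
  apply/eqP; rewrite -subr_eq0; apply/eqP.
  have /aug_exact [y ->] : aug F (inv (aug F x) - x) = 0 by rewrite linearB Hinv subrr.
  apply: contrapT; exact: dmx0.
have [k _] : exists k : 'I_(rk F i.+1), y0 0 k <> 0.
  apply: contrapT => /forallNP H; apply: ny0; suff -> : y0 = 0 by rewrite mul0mx.
  by apply/rowP => k; rewrite mxE; apply: contrapT; exact: H.
have lin : linear (fun v : 'rV[A]_(rk F i.+1) => v 0 k *: w).
  by move=> a u v; rewrite !mxE scalerDl scalerA.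
have [|g Hg] := @ext_syz i (lin_of lin).
  move=> y; have -> : y *m dmx F i.+1 = 0 by apply: contrapT; exact: dmx0.
  by rewrite -[LHS]/((0 : 'rV[A]_(rk F i.+1)) 0 k *: w) mxE scale0r.
apply: nw; have := Hg (delta_mx 0 k).
rewrite -[X in X = _]/((delta_mx 0 k : 'rV[A]_(rk F i.+1)) 0 k *: w).
rewrite mxE !eqxx scale1r => ->.
rewrite [_ *m _]row_sum_delta modHom_sum.
apply: submod_sum => [|j _]; first exact: submod_smul.
rewrite modHomZ; apply: smul_gen => //; rewrite mxE.
apply: (submod_sum _ Hm) => l _; exact: (ideal_mulr _ Hm).
Qed.

End SyzygyDuals.
Arguments syz_val {A M F i}.

Theorem theorem1p3 (A : idomainType) (m : set A) (d : nat)
    (omega M : lmodType A) (F : free_resolution M) :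
  noetherian A -> is_local m -> (1 <= d)%N -> cohen_macaulay m d ->
  canonical_module m d omega ->
  maximal_cohen_macaulay m d M -> ~ is_free M ->
  minimal_resolution m F ->
  quasi_hilbert omega ->
  forall i : nat, (1 <= i)%N ->
  exists P : {poly rat}, size P = d /\
  exists n0 : nat, forall n : nat, (n0 <= n)%N ->
  exists l : nat,
    has_length (rr_closure m n : set A^o)
      (ratliff_rush m n (modHom (syz F i) omega)) l /\
    P.[n%:R] = l%:R.
Proof.
move=> noethA localm d1 [dimA [[ys [regys szys]] _]].
move=> [[fgomega [[zs [regzs szzs]] _]] _].
move=> [E [eps [del [injE injeps exact0 exactS [ninj E0]]]]].
move=> [_ [[xs [regxs szxs]] _]] nfree minF.
rewrite /quasi_hilbert (local_jacobson localm).
move=> [[x [mx regx]] [d' [_ dimA' [[P0 chainP0] _]]]] [//|i] _.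
have dd' := quot_krull_dim_inj dimA' dimA; subst d'.
have Hm := local_submod localm.
have ext_syz p := @cocycles_coboundaries A m d noethA localm dimA ys regys szys
  omega E eps del injE injeps exact0 exactS ninj E0 fgomega M F xs regxs szxs p.
(* By Nakayama, as the regular sequence on [omega] excludes the zero module. *)
have [w nw] : exists w : omega, ~ smul m setT w.
  apply: contrapT => /forallNP Hw; have [zm _ nT] := regzs; apply: nT.
  have om0 : [set: omega] `<=` [set 0].
    apply: (nakayama noethA localm (@submod_zero _ omega) fgomega) => v _.
    by apply: addsubl; [exact: submod_zero|apply: contrapT; exact: Hw].
  by apply/seteqP; split=> // v /om0 ->; exact: smul0.
have [y yN0] := syz_neq0 ext_syz Hm minF nfree nw i.
have [u uE] := syz_lift y.
have [k uk] : exists k, syz_val u 0 k != 0.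
  apply: contrapT => /forallNP H; apply: yN0; rewrite -uE; apply/rowP => k.
  by rewrite mxE; apply/eqP; apply: contrapT => nk; apply: (H k); exact/negP.
have p0 : prime_ideal [set 0 : A].
  apply/prime_idealP; split; first exact: (@submod_zero _ A^o).
    by move=> /eqP; rewrite oner_eq0.
  by move=> a b /eqP; rewrite mulf_eq0 => /orP[/eqP|/eqP]; [left|right].
(* z sends u to u_k w. For a nonzero, a u_k is nonzero in the domain A and w is not torsion, so a z
   is nonzero. *)
pose z : modHom (syz F i.+1) omega := coord_dual k w.
have annz a : a *: z = 0 -> a = 0.
  move=> az0; apply/eqP; apply: contrapT => /negP na.
  have : a * syz_val u 0 k != 0 by rewrite mulf_neq0.
  move/(regular_torsion_free noethA localm dimA p0 fgomega regzs szzs) => /(_ w).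
  rewrite -scalerA -coord_dualE -modHomZE -/z az0 modHom0E => /(_ erefl) w0.
  by apply: nw; rewrite w0; exact: smul0.
have fgN := syz_dual_fin_gen ext_syz i fgomega.
have ys0 : (0 < size ys)%N by rewrite szys.
have ysm : lspan (ys : seq A^o) `<=` m.
  by rewrite -seq_smul_lspan; exact: seq_smul_local.
have finys : fin_len (lspan (ys : seq A^o)) setT.
  by rewrite -seq_smul_lspan; exact: (parameter_fin_len noethA localm dimA).
pose l := rr_length m (modHom (syz F i.+1) omega).
have [P [sP [n0 HP]]] : evpoly d (fun n => (l n)%:R).
  by rewrite -szys; exact: (evpoly_rr_length noethA localm fgN mx regx annz).
exists P; split.
  (* A size below d means [evpoly d.-1], which the chain of primes excludes. *)
  apply/eqP; rewrite eqn_leq sP leqNgt; apply/negP => ltPd.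
  have omegaN n :
      ratliff_rush m n omega `<=` ratliff_rush m n (modHom (syz F i.+1) omega).
    by apply: ratliff_rush_sub; exact: syz_dual_sum.
  rewrite -szys in chainP0.
  apply: (rr_length_growth noethA localm fgN mx regx annz ys0 omegaN chainP0).
  by exists P; split; [rewrite szys -ltnS prednK|exists n0].
exists n0 => n /HP <-; exists (l n); split=> //.
apply: has_length_len; [exact: submod_rr|exact: submod_rr|exact: rr_closure_sub|].
exact: fin_len_rr.
Qed.
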